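(* Let $n\ge 2$. For the hemispherical transform $H$, the inequality $$\Bigg(\int_{\mathbb{R}^{n-1}}\Big[\int_0^\infty |(H\varphi)(x',r)|^s\, r^{1-s}\,dr\Big]^{q/s}dx'\Bigg)^{1/q}\le c_{p,q,s}\Bigg(\int_{\mathbb{R}^n_+}|\varphi(y)|^p\,y_n^{1-p}\,dy\Bigg)^{1/p}$$ (for all $\varphi$, with a finite constant $c_{p,q,s}$ independent of $\varphi$) holds if and only if $$1\le p<\frac{n}{n-1},\qquad q=p',\qquad \frac1s=1-\frac{n}{p'},$$ where $p'$ is the dual exponent, defined by $1/p+1/p'=1$. In particular, for $q=s=n+1$ and $p=(n+1)/n$, $$\Bigg(\int_{\mathbb{R}^{n-1}}\int_0^\infty |(H\varphi)(x',r)|^{n+1}\,\frac{dr\,dx'}{r^n}\Bigg)^{1/(n+1)}\le c_n\Bigg(\int_{\mathbb{R}^n_+}|\varphi(y)|^{(n+1)/n}\,\frac{dy}{y_n^{1/n}}\Bigg)^{n/(n+1)}.$$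
   Context: $\mathbb{R}^n_+=\{y=(y',y_n): y'\in\mathbb{R}^{n-1},\ y_n>0\}$. The hemispherical (sonar) transform of a function $\varphi$ on $\mathbb{R}^n_+$ is $$(H\varphi)(x',r)=\int_{S_+(x',r)}\varphi(y)\,d\sigma(y),\qquad x'\in\mathbb{R}^{n-1},\ r>0,$$ where $S_+(x',r)=\{y\in\mathbb{R}^n_+:|y-x'|=r\}$ (with $x'$ identified with $(x',0)\in\mathbb{R}^n$) and $d\sigma$ is the induced surface area measure. The constant $c_n$ is finite and independent of $\varphi$. When $p=1$ one has $q=p'=\infty$ and $s=1$, and the outer $L^q$ norm in $x'$ is read, as usual, as an essential supremum. *)

(* Defs.v *)
From HB Require Import structures.
From mathcomp Require Import all_boot all_order all_algebra.
From mathcomp Require Import all_classical all_reals all_analysis.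
Import Order.TTheory GRing.Theory Num.Theory.
Import numFieldNormedType.Exports.

Set Implicit Arguments.
Unset Strict Implicit.
Unset Printing Implicit Defensive.

Local Open Scope classical_set_scope.
Local Open Scope ring_scope.

(* R^m with its product (= Borel) sigma-algebra. *)
Notation euclid R m := (m.-tuple (measurableTypeR R)).

(* R^(m+1), with points written y = (y', y_n): y.1 is y' and y.2 is y_n. *)
Notation euclidS R m := (euclid R m * measurableTypeR R)%type.

Section lebesgue_cons.
Context {R : realType} {m : nat}.
Variable mu : {sigma_finite_measure set (euclid R m) -> \bar R}.

Definition consE (z : measurableTypeR R * euclid R m) : euclid R m.+1 :=
  [the m.+1.-tuple (measurableTypeR R) of z.1 :: z.2].

Definition unconsE (x : euclid R m.+1) : measurableTypeR R * euclid R m :=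
  (thead x, [tuple of behead x]).

Lemma consEK : cancel consE unconsE.
Proof.
by case=> t x; rewrite /unconsE /consE/= theadE; congr (_, _); exact: val_inj.
Qed.

Lemma unconsEK : cancel unconsE consE.
Proof. by move=> x; rewrite /consE/= [RHS]tuple_eta; apply: val_inj. Qed.

Lemma measurable_consE : measurable_fun [set: measurableTypeR R * euclid R m] consE.
Proof. exact: measurable_cons. Qed.

Lemma measurable_unconsE : measurable_fun [set: euclid R m.+1] unconsE.
Proof.
apply/measurable_fun_pairP; split => /=.
  exact: measurable_tnth.
exact: measurable_behead.
Qed.

Definition lebesgue_cons : set (euclid R m.+1) -> \bar R :=
  pushforward (@lebesgue_measure R \x mu)%E consE.

Let measurable_preimage_consE A :
  measurable A -> measurable (consE @^-1` A).
Proof. by move=> mA; rewrite -[X in measurable X]setTI; exact: measurable_consE. Qed.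

Let lebesgue_cons0 : lebesgue_cons set0 = 0%E.
Proof. exact: (measure0 (@lebesgue_measure R \x mu)%E). Qed.

Let lebesgue_cons_ge0 A : (0 <= lebesgue_cons A)%E.
Proof. exact: (measure_ge0 (@lebesgue_measure R \x mu)%E). Qed.

Let lebesgue_cons_sigma_additive : semi_sigma_additive lebesgue_cons.
Proof.
move=> F mF tF mUF; rewrite /lebesgue_cons /pushforward preimage_bigcup.
apply: (@measure_semi_sigma_additive _ _ _ (@lebesgue_measure R \x mu)%E).
- by move=> i; exact: measurable_preimage_consE.
- apply/trivIsetP => /= i j _ _ ij; rewrite -preimage_setI.
  by move/trivIsetP : tF => /(_ _ _ _ _ ij) ->//; rewrite preimage_set0.
- by rewrite -preimage_bigcup; exact: measurable_preimage_consE.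
Qed.

HB.instance Definition _ := isMeasure.Build _ _ _ lebesgue_cons
  lebesgue_cons0 lebesgue_cons_ge0 lebesgue_cons_sigma_additive.

Let lebesgue_cons_sigma_finite : sigma_finite setT lebesgue_cons.
Proof.
have /sigma_finiteP[F [FT ndF Foo]] := sigma_finiteT (@lebesgue_measure R).
have /sigma_finiteP[G [GT ndG Goo]] := sigma_finiteT mu.
exists (fun i => unconsE @^-1` (F i `*` G i)).
  rewrite -preimage_bigcup -[LHS](preimage_setT unconsE); congr (_ @^-1` _).
  rewrite -setXTT FT GT predeqE => -[x y]; split.
    move=> [/= [i _ Fix] [k _ Gky]]; exists (maxn i k) => //; split.
    - by move: x Fix; exact/subsetPset/ndF/leq_maxl.
    - by move: y Gky; exact/subsetPset/ndG/leq_maxr.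
  by move=> [i _ []/= ? ?]; split; exists i.
move=> i; have [mF Fi] := Foo i; have [mG Gi] := Goo i; split.
  by rewrite -[X in measurable X]setTI; apply: measurable_unconsE => //; exact: measurableX.
rewrite /lebesgue_cons /pushforward -comp_preimage.
rewrite (_ : unconsE \o consE = id); last by apply/funext => z /=; rewrite consEK.
by rewrite preimage_id product_measure1E// lte_mul_pinfty// ge0_fin_numE.
Qed.

HB.instance Definition _ := @Measure_isSigmaFinite.Build _ _ _ lebesgue_cons
  lebesgue_cons_sigma_finite.

End lebesgue_cons.

(* On R^0 Lebesgue measure is the unit mass at the only point. *)
Fixpoint lebesgue_euclid {R : realType} (m : nat) :
    {sigma_finite_measure set (euclid R m) -> \bar R} :=
  match m return {sigma_finite_measure set (euclid R m) -> \bar R} with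
  | 0%N => @dirac _ (euclid R 0) [tuple] R
  | m'.+1 => lebesgue_cons (lebesgue_euclid m')
  end.

Lemma lebesgue_euclid_box {R : realType} (m : nat)
    (A : 'I_m -> set (measurableTypeR R)) : (forall i, measurable (A i)) ->
  lebesgue_euclid m [set x | forall i, A i (tnth x i)] =
  (\prod_(i < m) lebesgue_measure (A i))%E.
Proof.
elim: m A => [|m IH] A mA.
  by rewrite big_ord0 /= /dirac indicE mem_set// => -[].
rewrite big_ord_recl -IH//= /lebesgue_cons /pushforward.
rewrite -product_measure1E//; last first.
  rewrite (_ : [set _ | _] = \bigcap_(i in [set: 'I_m])
      ((@tnth m (measurableTypeR R))^~ i @^-1` A (lift ord0 i))); last first.
    by apply/seteqP; split => x /= Ax i; [move=> _|]; exact: Ax.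
  apply: fin_bigcap_measurable => // i _.
  by rewrite -[X in measurable X]setTI; exact: measurable_tnth.
congr product_measure1; apply/seteqP; split => -[t x] /=.
  move=> h; split; first exact: (h ord0).
  by move=> i; have := h (lift ord0 i); rewrite tnthS.
move=> [At Ax] i; case: (unliftP ord0 i) => [j ->|->]; last exact: At.
by rewrite tnthS; exact: Ax.
Qed.

Definition lebesgue_euclidS {R : realType} (m : nat) :
    {measure set (euclidS R m) -> \bar R} :=
  (lebesgue_euclid m \x @lebesgue_measure R)%E.

Section graph_integral.
Context {R : realType} {m : nat}.
Implicit Types (g : euclid R m -> R) (x y : euclid R m).

Definition upd x (i : 'I_m) (t : R) : euclid R m :=
  [tuple (if j == i then t else tnth x j) | j < m].

Definition partial g (i : 'I_m) x : R :=
  derive1 (fun t : R => g (upd x i t)) (tnth x i).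

Definition area_density g x : R :=
  Num.sqrt (1 + \sum_(i < m) partial g i x ^+ 2).

(* Integral of [f] over the hypersurface {(y', g y') : y' in D} with respect
   to the surface area measure induced by the Euclidean metric of R^(m+1),
   i.e. dsigma = sqrt(1 + |grad g|^2) dy'. *)
Definition graph_integral (D : set (euclid R m)) g (f : euclidS R m -> R)
    : \bar R :=
  (\int[lebesgue_euclid m]_(y in D) (f (y, g y) * area_density g y)%:E)%E.

End graph_integral.

Section hemispherical.
Context {R : realType} {m : nat}.
Implicit Types (x : euclid R m) (r : R).

Definition half_space : set (euclidS R m) := [set y | 0 < y.2].

Definition dist2 x (y : euclid R m) : R :=
  \sum_(i < m) (tnth y i - tnth x i) ^+ 2.

(* S_+(x', r), with x' identified with (x', 0). *)
Definition hemisphere x r : set (euclidS R m) :=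
  half_space `&` [set y | Num.sqrt (dist2 x y.1 + y.2 ^+ 2) = r].

(* The hemisphere is the graph of [cap x r] over [disk x r]. *)
Definition disk x r : set (euclid R m) := [set y | Num.sqrt (dist2 x y) < r].

Definition cap x r (y : euclid R m) : R := Num.sqrt (r ^+ 2 - dist2 x y).

Lemma hemisphereE x r : 0 < r ->
  hemisphere x r = (fun y => (y, cap x r y)) @` disk x r.
Proof.
move=> r0.
have d0 y : 0 <= dist2 x y by apply: sumr_ge0 => i _; exact: sqr_ge0.
apply/seteqP; split => [[y t] /= [t0 <-]|_ [y /= yr <-]].
  rewrite /half_space/= in t0.
  have s0 : 0 <= dist2 x y + t ^+ 2 by rewrite addr_ge0// sqr_ge0.
  exists y; first by rewrite /disk/= ltr_sqrt ?ltrDl ?exprn_gt0// ltr_wpDl// exprn_gt0.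
  by rewrite /cap sqr_sqrtr// addrAC subrr add0r sqrtr_sqr gtr0_norm.
have yr2 : dist2 x y < r ^+ 2.
  by rewrite -(sqr_sqrtr (d0 y)) ltr_pXn2r// nnegrE ?sqrtr_ge0 ?ltW.
split; first by rewrite /half_space/= /cap sqrtr_gt0 subr_gt0.
by rewrite /= /cap sqr_sqrtr ?subr_ge0 1?ltW// addrCA subrr addr0 sqrtr_sqr gtr0_norm.
Qed.

(* Where the integral is oo - oo, its value in \bar R is -oo and hence
   |H phi (x, r)| = +oo: a bound on a norm of H phi thus includes the almost
   everywhere existence of H phi. *)
Definition hemispherical (phi : euclidS R m -> R) x r : \bar R :=
  graph_integral (disk x r) (cap x r) phi.

End hemispherical.

Section mixed_norms.
Context {R : realType} {m : nat}.
Implicit Types (phi : euclidS R m -> R).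
Local Open Scope ereal_scope.

(* For finite q, |(...)^(1/s)|^q is the integrand [...]^(q/s); for q = +oo,
   [Lnorm] is the essential supremum in x'. *)
Definition hemispherical_norm (q : \bar R) (s : R) phi : \bar R :=
  Lnorm (lebesgue_euclid m) q (fun x =>
    (\int[lebesgue_measure]_(r in `]0%R, +oo[)
       (`|hemispherical phi x r| `^ s * (r `^ (1 - s))%:E)) `^ s^-1).

Definition half_space_norm (p : R) phi : \bar R :=
  (\int[lebesgue_euclidS m]_(y in half_space)
     (`|phi y| `^ p * y.2 `^ (1 - p))%:E) `^ p^-1.

End mixed_norms.

(* Main.v *)
(* In the coordinates t = r^2 and u = y_n^2 the hemisphere |y - x'| = r is the
   paraboloid u + |x' - y'|^2 = t, with surface measure (r / y_n) dy'.  Hence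
   |H phi (x', r)| <= r * Pf (x', t), where f (y', u) = |phi (y', sqrt u)| / sqrt u
   and Pf (x', t) = int f (y', t - |x' - y'|^2) dy', and the inequality becomes
   ||Pf||_{L^q_x L^s_t} <= C ||f||_p.  For p = 1 this is Fubini.  For p > 1 one
   bounds the adjoint Qh (y, u) = int h (x, u + |x - y|^2) dx in mixed norms.
   In dimension one, Minkowski's inequality applied to the square of Q reduces
   the diagonal case to pairs x <> x', for which the map
   (y, u) |-> (u + (x - y)^2, u + (x' - y)^2) has Jacobian 2 |x - x'|; what is
   left is a Hardy-Littlewood-Sobolev inequality.  Interpolating with the trivial
   L^1 bound gives the other mixed norms, and in dimension m the operator is a
   composition of one-dimensional ones, Minkowski's inequality being used to
   exchange the norms.

   For necessity, phi = y_n on {y' in a cube of side l, A < |y|^2 < A + v} has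
   right-hand side at most (v l^m)^(1/p), while the left-hand side is at least a
   constant times l^m (v / l)^(m/q) v^(1/s); letting l and v vary independently
   forces both relations between the exponents. *)

Require Import Defs.
From HB Require Import structures.
From mathcomp Require Import all_boot all_order all_algebra.
From mathcomp Require Import all_classical all_reals all_analysis.
From mathcomp Require Import measurable_realfun ess_sup_inf.
From mathcomp Require Import ring lra.
Import Order.TTheory GRing.Theory Num.Theory.
Import numFieldNormedType.Exports.

Set Implicit Arguments.
Unset Strict Implicit.
Unset Printing Implicit Defensive.

Local Open Scope classical_set_scope.
Local Open Scope ring_scope.

Local Open Scope ereal_scope.

(** * Powers of extended reals *)

(** The adjoint Q is estimated, and not P itself, because its target norm is the diagonal one,
    L^q(dy du) with q = p'. For p > 1 and n >= 2 the condition 1/s > 0 reads n/q < 1, hence q > 2,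
    and the exponent q/2 left after squaring is one to which Minkowski's inequality applies. Peeling
    off one coordinate at a time leaves the diagonal, however. In reciprocal exponents each
    coordinate carries [ro] in the target and [1 - ro] in the source, and adds [ro] to the exponent
    in u. The one-dimensional estimate is therefore required at beta = ro, 2 ro, ..., m ro, all
    within the triangle ro <= beta, beta + ro < 1, and this triangle is what interpolating the
    diagonal with the L^1 bound gives. After m = n - 1 coordinates the exponent in u is n ro = 1 -
    1/s, the relation of the theorem. All operators being positive, interpolation is Hoelder's
    inequality under the integral sign, applied to a pointwise factorisation of the input. *)

Section extended_powers.
Context {R : realType}.
Implicit Types (x y : \bar R) (r s : R).

Lemma ge0_poweRD x r s : 0 <= x -> (0 <= r)%R -> (0 <= s)%R ->
  x `^ (r + s) = x `^ r * x `^ s.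
Proof.
move=> x0 r0 s0; have [->|xn0] := eqVneq x 0; last first.
  by apply: poweRD; exact: nneg_neq0_poweRD_def.
have [->|rn0] := eqVneq r 0%R; first by rewrite add0r poweRe0 mul1e.
rewrite (poweR0r rn0) mul0e poweR0r// gt_eqF// ltr_wpDr// lt_neqAle eq_sym rn0//.
Qed.

Lemma lee_poweR x y r : (0 <= r)%R -> 0 <= x -> x <= y -> x `^ r <= y `^ r.
Proof.
move=> r0 x0 xy; apply: gt0_ler_poweR => //; rewrite in_itv/= leey andbT//.
exact: le_trans xy.
Qed.

Lemma poweRK x r : 0 <= x -> r != 0%R -> (x `^ r) `^ r^-1 = x.
Proof. by move=> x0 r0; rewrite -poweRrM divff// poweRe1. Qed.

Lemma poweRVK x r : 0 <= x -> r != 0%R -> (x `^ r^-1) `^ r = x.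
Proof. by move=> x0 r0; rewrite -poweRrM mulVf// poweRe1. Qed.

Lemma lee_poweRV x y r : (0 < r)%R -> 0 <= x -> 0 <= y ->
  x <= y `^ r -> x `^ r^-1 <= y.
Proof.
move=> r0 x0 y0 xy; rewrite -(poweRK y0 (lt0r_neq0 r0)).
by apply: lee_poweR => //; rewrite invr_ge0 ltW.
Qed.

(** Young's inequality scaled so that equality holds at x = A, y = B. When A and B are the integrals
    of two functions, the bracket integrates to s + (1 - s) = 1, which gives Hoelder's inequality
    with constant 1. *)
Lemma weighted_amgm (A B s : R) x y : (0 < A)%R -> (0 < B)%R ->
  (0 < s < 1)%R -> 0 <= x -> 0 <= y ->
  x `^ s * y `^ (1 - s) <=
  (A `^ s * B `^ (1 - s))%:E * ((s / A)%:E * x + ((1 - s) / B)%:E * y).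
Proof.
move=> A0 B0 /andP[s0 s1].
have AB0 : (0 < A `^ s * B `^ (1 - s))%R by rewrite mulr_gt0// powR_gt0.
have s1' : (0 < 1 - s)%R by rewrite subr_gt0.
case: x => [x x0|_|//]; last first.
  move=> y0; rewrite gt0_muley ?lte_fin ?divr_gt0// addye; last first.
    by rewrite gt_eqF// (lt_le_trans ltNy0)// mule_ge0// lee_fin divr_ge0// ltW.
  by rewrite gt0_muley// leey.
case: y => [y y0|_|//]; last first.
  rewrite [X in _ + X]gt0_muley ?lte_fin ?divr_gt0// addey; last first.
    by rewrite gt_eqF// ltNyr.
  by rewrite gt0_muley// leey.
rewrite !lee_fin in x0 y0.
suff: (x `^ s * y `^ (1 - s) <=
    A `^ s * B `^ (1 - s) * (s / A * x + (1 - s) / B * y))%R.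
  by rewrite -lee_fin !(EFinM, EFinD).
have := @conjugate_powR R ((x / A) `^ s)%R ((y / B) `^ (1 - s))%R s^-1%R (1 - s)^-1%R.
rewrite !powR_ge0 !invr_gt0 !invrK => /(_ isT isT s0 s1').
have s1E : (s + (1 - s) = 1)%R by ring.
move=> /(_ s1E).
have xA : (0 <= x / A)%R by rewrite divr_ge0// ltW.
have yB : (0 <= y / B)%R by rewrite divr_ge0// ltW.
rewrite -!powRrM !mulfV ?gt_eqF// !powRr1// => h.
have -> : (x `^ s * y `^ (1 - s) = (A `^ s * B `^ (1 - s)) *
    ((x / A) `^ s * (y / B) `^ (1 - s)))%R.
  rewrite mulrACA -!powRM//; [|exact: ltW..].
  by rewrite ![(_ * (_ / _))%R]mulrC !divfK ?gt_eqF.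
rewrite ler_pM2l//; apply: le_trans h _.
by rewrite [leLHS](_ : _ = (s / A * x + (1 - s) / B * y)%R)//; ring.
Qed.

End extended_powers.

Section hoelder_minkowski.
Context {R : realType} {d1 d2} {X : measurableType d1} {Y : measurableType d2}.

Lemma measurable_fun_poweR (D : set X) (f : X -> \bar R) (r : R) :
  measurable_fun D f -> measurable_fun D (fun x => f x `^ r).
Proof. by move=> mf; exact: (measurableT_comp (measurable_poweR r)). Qed.

(* Hoelder's inequality in geometric-mean form; interpolation between two
   estimates for a positive operator is an instance of it. *)
Lemma geometric_hoelder (mu : {measure set X -> \bar R}) (f g : X -> \bar R)
    (s : R) : (0 <= s <= 1)%R ->
  measurable_fun setT f -> measurable_fun setT g ->
  (forall x, 0 <= f x) -> (forall x, 0 <= g x) ->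
  \int[mu]_x (f x `^ s * g x `^ (1 - s)) <=
  (\int[mu]_x f x) `^ s * (\int[mu]_x g x) `^ (1 - s).
Proof.
move=> /andP[]; rewrite le_eqVlt => /predU1P[<- _|s0].
  move=> mf mg f0 g0; rewrite subr0 poweRe0 mul1e poweRe1 ?integral_ge0//.
  under eq_integral do rewrite poweRe0 mul1e poweRe1//.
  by [].
rewrite le_eqVlt => /predU1P[->|s1].
  move=> mf mg f0 g0; rewrite subrr poweRe0 mule1 poweRe1 ?integral_ge0//.
  under eq_integral do rewrite poweRe0 mule1 poweRe1//.
  by [].
have s1' : (0 < 1 - s)%R by rewrite subr_gt0.
move=> mf mg f0 g0.
(* If one integral vanishes, its integrand is zero almost everywhere and so is the product, even
   where the other factor is infinite, since 0 times +oo is 0. *)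
have z (h k : X -> \bar R) : measurable_fun setT h -> (forall x, 0 <= h x) ->
    measurable_fun setT k ->
    \int[mu]_x h x = 0 -> forall r, (0 < r)%R ->
    \int[mu]_x (h x `^ r * k x) = 0.
  move=> mh h0 mk ih r r0.
  rewrite (ae_eq_integral (cst 0))//=; first by rewrite integral0.
    by apply: emeasurable_funM => //; exact: measurable_fun_poweR.
  have : ae_eq mu setT h (cst 0).
    apply/(ae_eq_integral_abs mu measurableT mh).1; rewrite -ih.
    by apply: eq_integral => x _; rewrite gee0_abs.
  apply: filterS => x /= /(_ I) -> _.
  by rewrite poweR0r ?mul0e// gt_eqF.
have [If0|If0] := eqVneq (\int[mu]_x f x) 0.
  rewrite z//; first by rewrite mule_ge0// poweR_ge0.
  exact: measurable_fun_poweR.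
have [Ig0|Ig0] := eqVneq (\int[mu]_x g x) 0.
  under eq_integral do rewrite muleC.
  rewrite z//; first by rewrite mule_ge0// poweR_ge0.
  exact: measurable_fun_poweR.
have If : 0 < \int[mu]_x f x by rewrite lt_neqAle eq_sym If0 integral_ge0.
have Ig : 0 < \int[mu]_x g x by rewrite lt_neqAle eq_sym Ig0 integral_ge0.
have [fy|fy] := eqVneq (\int[mu]_x f x) +oo.
  by rewrite fy poweRyr ?gt_eqF// gt0_mulye ?leey// poweR_gt0.
have [gy|gy] := eqVneq (\int[mu]_x g x) +oo.
  by rewrite gy poweRyr ?gt_eqF// gt0_muley ?leey// poweR_gt0.
have : \int[mu]_x f x \is a fin_num by rewrite gt0_fin_numE// ltey.
move: If => /[swap] /fineK <-; rewrite lte_fin; set A := fine _ => A0.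
have : \int[mu]_x g x \is a fin_num by rewrite gt0_fin_numE// ltey.
move: Ig => /[swap] /fineK <-; rewrite lte_fin; set B := fine _ => B0.
rewrite !poweR_EFin -EFinM.
have mfs : measurable_fun setT (fun x => (s / A)%:E * f x).
  exact: emeasurable_funM.
have mgs : measurable_fun setT (fun x => ((1 - s) / B)%:E * g x).
  exact: emeasurable_funM.
have sA : (0 <= s / A)%R by rewrite divr_ge0// ltW.
have sB : (0 <= (1 - s) / B)%R by rewrite divr_ge0// ltW.
have sf x : 0 <= (s / A)%:E * f x by rewrite mule_ge0.
have sg x : 0 <= ((1 - s) / B)%:E * g x by rewrite mule_ge0.
apply: (@le_trans _ _ (\int[mu]_x ((A `^ s * B `^ (1 - s))%:E *
    ((s / A)%:E * f x + ((1 - s) / B)%:E * g x)))).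
  apply: ge0_le_integral => //.
  - by move=> x _; rewrite mule_ge0// poweR_ge0.
  - by apply: emeasurable_funM; exact: measurable_fun_poweR.
  - by apply: emeasurable_funM => //; exact: emeasurable_funD.
  - by move=> x _; apply: weighted_amgm => //; rewrite s0.
rewrite ge0_integralZl//; last 3 first.
- by apply: emeasurable_funD.
- by move=> x _; rewrite adde_ge0.
- by rewrite lee_fin mulr_ge0// powR_ge0.
rewrite -[leRHS]mule1; apply: lee_wpmul2l.
  by rewrite lee_fin mulr_ge0// powR_ge0.
rewrite ge0_integralD// !ge0_integralZl//.
have fE : \int[mu]_x f x = A%:E by rewrite /A fineK// gt0_fin_numE ?ltey// lt_neqAle eq_sym If0 integral_ge0.
have gE : \int[mu]_x g x = B%:E by rewrite /B fineK// gt0_fin_numE ?ltey// lt_neqAle eq_sym Ig0 integral_ge0.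
rewrite fE gE -!EFinM -EFinD !divfK ?gt_eqF//.
by rewrite addrC subrK.
Qed.

(** Writing the second factor as a power [r - 1] keeps the dual exponent r/(r-1) out of sight and
    includes r = 1. It is also the shape in which extremal test functions arise: equality holds for
    g = f. *)
Lemma hoelder_conjugate_integral (mu : {measure set X -> \bar R})
    (f g : X -> \bar R) (r : R) : (1 <= r)%R ->
  measurable_fun setT f -> measurable_fun setT g ->
  (forall x, 0 <= f x) -> (forall x, 0 <= g x) ->
  \int[mu]_x (f x * g x `^ (r - 1)) <=
  (\int[mu]_x (f x `^ r)) `^ r^-1 * (\int[mu]_x (g x `^ r)) `^ (1 - r^-1).
Proof.
move=> r1 mf mg f0 g0; have r0 : (0 < r)%R by exact: lt_le_trans r1.
rewrite [leLHS](_ : _ =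
    \int[mu]_x ((f x `^ r) `^ r^-1 * (g x `^ r) `^ (1 - r^-1))); last first.
  apply: eq_integral => x _; rewrite poweRK ?gt_eqF// -poweRrM.
  by rewrite mulrBr mulr1 mulfV ?gt_eqF.
apply: geometric_hoelder.
- by rewrite invr_ge0 (ltW r0) invf_le1.
- exact: measurable_fun_poweR.
- exact: measurable_fun_poweR.
- by move=> x; exact: poweR_ge0.
- by move=> x; exact: poweR_ge0.
Qed.

End hoelder_minkowski.

(** * Duality and Minkowski's integral inequality *)

#[local] Hint Resolve poweR_ge0 : core.

Definition increases_to {R : realType} (u : nat -> \bar R) (l : \bar R) :=
  nondecreasing_seq u /\ u n @[n --> \oo] --> l.

(** * Monotone limits and truncations *)

Section monotone_limits.
Context {R : realType}.
Implicit Types (u : nat -> \bar R) (l : \bar R).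

Lemma increases_to_sup u : nondecreasing_seq u ->
  increases_to u (ereal_sup (range u)).
Proof. by move=> ndu; split => //; exact: ereal_nondecreasing_cvgn. Qed.

Lemma increases_toE u l : increases_to u l -> l = ereal_sup (range u).
Proof.
move=> [ndu ul]; have := ereal_nondecreasing_cvgn ndu.
by move/cvg_lim => <-//; move/cvg_lim : ul => <-.
Qed.

Lemma increases_to_ge u l n : increases_to u l -> u n <= l.
Proof. by move=> /increases_toE ->; apply: ereal_sup_ubound; exists n. Qed.

Lemma increases_to_le u l M : increases_to u l -> (forall n, u n <= M) -> l <= M.
Proof. by move=> /increases_toE -> uM; apply: ge_ereal_sup => _ [n _ <-]. Qed.

(** The power is an order isomorphism of [0, +oo] whose inverse is the power [r^-1], so it commutes
    with the supremum of a monotone sequence; the value +oo is covered as well. *)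
Lemma increases_to_poweR u l (r : R) : (0 < r)%R -> (forall n, 0 <= u n) ->
  increases_to u l -> increases_to (fun n => u n `^ r) (l `^ r).
Proof.
move=> r0 u0 ul.
have l0 : 0 <= l by exact: le_trans (increases_to_ge 0%N ul).
have nd : nondecreasing_seq (fun n => u n `^ r).
  by move=> m n mn; apply: lee_poweR => //; [exact: ltW|exact: ul.1].
have [_ +] := increases_to_sup nd; set L := ereal_sup _.
suff -> : L = l `^ r by [].
have uL n : u n `^ r <= L by apply: ereal_sup_ubound; exists n.
apply/eqP; rewrite eq_le; apply/andP; split.
  apply: ge_ereal_sup => _ [n _ <-]; apply: lee_poweR => //; first exact: ltW.
  exact: increases_to_ge ul.
have L0 : 0 <= L by apply: le_trans (uL 0%N); exact: poweR_ge0.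
rewrite -(poweRVK L0 (lt0r_neq0 r0)); apply: lee_poweR => //; first exact: ltW.
apply: increases_to_le ul _ => n; rewrite -(poweRK (u0 n) (lt0r_neq0 r0)).
by apply: lee_poweR => //; rewrite invr_ge0 ltW.
Qed.

Lemma increases_to_integral d (X : measurableType d)
    (mu : {measure set X -> \bar R}) (g : nat -> X -> \bar R) (f : X -> \bar R) :
  (forall n, measurable_fun setT (g n)) -> (forall n x, 0 <= g n x) ->
  (forall x, increases_to (g ^~ x) (f x)) ->
  increases_to (fun n => \int[mu]_x g n x) (\int[mu]_x f x).
Proof.
move=> mg g0 gf; split.
  by move=> m n mn; apply: ge0_le_integral => // x _; exact: (gf x).1.
have -> : \int[mu]_x f x = \int[mu]_x limn (g ^~ x).
  by apply: eq_integral => x _; rewrite (cvg_lim _ (gf x).2).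
by apply: cvg_monotone_convergence => // x _; exact: (gf x).1.
Qed.

End monotone_limits.

Section truncation.
Context {R : realType} {d} {X : measurableType d}.

(** The cut is made in height and in support, so that over sets of finite measure the truncated
    function has finite norms. Duality arguments divide by such a norm. *)
Definition truncation (E : nat -> set X) (F : X -> \bar R) n x : \bar R :=
  mine (F x) n%:R%:E * (\1_(E n) x)%:E.

Variables (E : nat -> set X) (F : X -> \bar R).
Hypotheses (mE : forall n, measurable (E n))
  (ndE : {homo E : m n / (m <= n)%N >-> m `<=` n})
  (ET : \bigcup_n E n = setT) (mF : measurable_fun setT F)
  (F0 : forall x, 0 <= F x).

Let m0 n x : 0 <= mine (F x) n%:R%:E.
Proof. by rewrite le_min F0 lee_fin ler0n. Qed.

Lemma truncation_ge0 n x : 0 <= truncation E F n x.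
Proof. by rewrite mule_ge0// lee_fin indicE. Qed.

Lemma truncation_le n x : truncation E F n x <= F x.
Proof.
rewrite /truncation indicE; case: (x \in E n); rewrite ?mule0// mule1.
by rewrite ge_min lexx.
Qed.

Lemma truncation_bound n x : truncation E F n x <= n%:R%:E * (\1_(E n) x)%:E.
Proof.
rewrite /truncation; apply: lee_wpmul2r; first by rewrite lee_fin indicE.
by rewrite ge_min lexx orbT.
Qed.

Lemma measurable_truncation n : measurable_fun setT (truncation E F n).
Proof.
apply: emeasurable_funM; first exact: measurable_mine.
exact/measurable_EFinP/measurable_indic.
Qed.

Lemma truncation_increases x : increases_to (truncation E F ^~ x) (F x).
Proof.
have nd : nondecreasing_seq (truncation E F ^~ x).
  move=> m n mn; apply: lee_pmul; first exact: m0.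
  - by rewrite lee_fin indicE.
  - by rewrite le_min ge_min lexx/= ge_min lee_fin ler_nat mn orbT.
  - rewrite lee_fin !indicE ler_nat; have [xm|//] := boolP (x \in E m).
    by rewrite mem_set//; apply: ndE mn _ _; exact: set_mem.
suff -> : F x = ereal_sup (range (truncation E F ^~ x)).
  exact: increases_to_sup.
apply/eqP; rewrite eq_le; apply/andP; split; last first.
  by apply: ge_ereal_sup => _ [n _ <-]; exact: truncation_le.
have [k _ kx] : (\bigcup_n E n) x by rewrite ET.
have tE n : (k <= n)%N -> truncation E F n x = mine (F x) n%:R%:E.
  move=> kn; rewrite /truncation indicE mem_set ?mule1//.
  exact: ndE kn _ kx.
have H n : (k <= n)%N -> mine (F x) n%:R%:E <= ereal_sup (range (truncation E F ^~ x)).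
  by move=> kn; apply: ereal_sup_ubound; exists n; rewrite ?tE.
move: (F0 x) H; case: (F x) => [f f0 H|_ H|//].
  set n := maxn k (Num.trunc f).+1; apply: le_trans (H n (leq_maxl _ _)).
  rewrite le_min lexx/= lee_fin ltW// (lt_le_trans (truncnS_gt f))//.
  by rewrite ler_nat leq_maxr.
rewrite leye_eq; apply/eqP/eqyP => A A0.
set n := maxn k (Num.trunc A).+1; apply: le_trans (H n (leq_maxl _ _)).
rewrite le_min leey/= lee_fin ltW// (lt_le_trans (truncnS_gt A))//.
by rewrite ler_nat leq_maxr.
Qed.

End truncation.

Section duality_minkowski.
Context {R : realType} {d1 d2} {X : measurableType d1} {Y : measurableType d2}.
Variables (mu : {sigma_finite_measure set X -> \bar R})
  (nu : {sigma_finite_measure set Y -> \bar R}).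

Lemma ge0_le_integral_iter (f g : X * Y -> \bar R) :
  measurable_fun setT f -> measurable_fun setT g -> (forall z, 0 <= f z) ->
  (forall x y, f (x, y) <= g (x, y)) ->
  \int[mu]_x \int[nu]_y f (x, y) <= \int[mu]_x \int[nu]_y g (x, y).
Proof.
move=> mf mg f0 fg; have g0 z : 0 <= g z.
  by case: z => x y; exact: le_trans (f0 _) (fg _ _).
apply: ge0_le_integral => //.
- by move=> x _; exact: integral_ge0.
- exact: (measurable_fun_fubini_tonelli_F f).
- exact: (measurable_fun_fubini_tonelli_F g).
- move=> x _; apply: ge0_le_integral => //; exact: measurable_fun_pair2.
Qed.

(** A division by [I^(1 - r^-1)]. At I = +oo the hypothesis would carry no information, which is why
    duality is first applied to truncations. *)
Lemma cancel_poweR (I M : \bar R) (r : R) : (1 < r)%R -> 0 <= I -> I < +oo ->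
  0 <= M -> I <= M * I `^ (1 - r^-1) -> I <= M `^ r.
Proof.
move=> r1 I0 Ioo M0 IM.
have [->|In0] := eqVneq I 0; first exact: poweR_ge0.
have r0 : (0 < r)%R by exact: lt_trans r1.
have Igt : 0 < I by rewrite lt_neqAle eq_sym In0.
have r1' : (0 <= 1 - r^-1)%R by rewrite subr_ge0 invf_le1// ltW.
have IE : I = I `^ r^-1 * I `^ (1 - r^-1).
  by rewrite -ge0_poweRD ?invr_ge0 ?(ltW r0)// addrC subrK poweRe1.
have : I `^ r^-1 <= M.
  move: IM; rewrite {1}IE lee_pmul2r//; last exact: poweR_gt0.
  by rewrite ge0_fin_numE ?poweR_ge0// poweR_lty.
by move=> h; rewrite -(poweRVK I0 (lt0r_neq0 r0)); apply: lee_poweR;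
  rewrite ?poweR_ge0// ltW.
Qed.

(** Converse of Hoelder's inequality. The test function is a truncation w of F itself, for w <= F
    gives w^r <= F w^(r-1); the integral of w^r is finite and can be cancelled, and monotone
    convergence then removes the truncation. *)
Lemma integral_poweR_le_dual (F : X -> \bar R) (r : R) (M : \bar R) :
  (1 < r)%R -> measurable_fun setT F -> (forall x, 0 <= F x) -> 0 <= M ->
  (forall w : X -> \bar R, measurable_fun setT w -> (forall x, 0 <= w x) ->
     \int[mu]_x (F x * w x `^ (r - 1)) <=
     M * (\int[mu]_x (w x `^ r)) `^ (1 - r^-1)) ->
  \int[mu]_x (F x `^ r) <= M `^ r.
Proof.
move=> r1 mF F0 M0 H; have r0 : (0 < r)%R by exact: lt_trans r1.
have /sigma_finiteP[E [ET ndE Eoo]] := sigma_finiteT mu.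
have mE n : measurable (E n) by have [] := Eoo n.
have ndE' : {homo E : m n / (m <= n)%N >-> m `<=` n}.
  by move=> m n mn; apply/subsetPset; exact: ndE.
pose w := truncation E F.
have w0 n x : 0 <= w n x by exact: truncation_ge0.
have mw n : measurable_fun setT (w n) by exact: measurable_truncation.
have inc : increases_to (fun n => \int[mu]_x (w n x `^ r)) (\int[mu]_x (F x `^ r)).
  apply: increases_to_integral => //.
  - by move=> n; exact: measurable_fun_poweR.
  - move=> x; apply: increases_to_poweR => //.
    exact: truncation_increases.
apply: increases_to_le inc _ => n.
apply: cancel_poweR => //.
- by apply: integral_ge0 => x _; exact: poweR_ge0.
- apply: (@le_lt_trans _ _ (\int[mu]_x ((n%:R `^ r)%:E * (\1_(E n) x)%:E))).
    apply: ge0_le_integral => //.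
    + exact: measurable_fun_poweR.
    + apply: emeasurable_funM => //.
      exact/measurable_EFinP/measurable_indic.
    + move=> x _; apply: (@le_trans _ _ ((n%:R%:E * (\1_(E n) x)%:E) `^ r)).
        by apply: lee_poweR => //; [exact: ltW|exact: truncation_bound].
      rewrite indicE; case: (x \in E n) => /=; first by rewrite mulr1 mule1.
      by rewrite mulr0 mule0 powR0// gt_eqF.
  rewrite ge0_integralZl//; last first.
    exact/measurable_EFinP/measurable_indic.
  rewrite integral_indic// setIT lte_mul_pinfty//.
  by have [] := Eoo n.
- apply: le_trans (H _ (mw n) (w0 n)); apply: ge0_le_integral => //.
  + exact: measurable_fun_poweR.
  + by apply: emeasurable_funM => //; exact: measurable_fun_poweR.
  + move=> x _; have -> : w n x `^ r = w n x * w n x `^ (r - 1).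
      rewrite -[in RHS](poweRe1 (w0 n x)) -poweRrM mul1r -ge0_poweRD//.
        by rewrite addrC subrK.
      by rewrite subr_ge0 ltW.
    apply: lee_wpmul2r; first exact: poweR_ge0.
    exact: truncation_le.
Qed.

(** By duality it suffices to integrate the inner integral against w^(r-1). Tonelli's theorem brings
    y outside, and Hoelder's inequality in x for each fixed y leaves the norm of K(., y) times a
    power of the integral of w^r that does not depend on y. *)
Lemma minkowski_integral (K : X * Y -> \bar R) (r : R) : (1 <= r)%R ->
  measurable_fun setT K -> (forall z, 0 <= K z) ->
  \int[mu]_x ((\int[nu]_y K (x, y)) `^ r) <=
  (\int[nu]_y (\int[mu]_x (K (x, y) `^ r)) `^ r^-1) `^ r.
Proof.
rewrite le_eqVlt => /predU1P[<-|r1] mK K0.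
  have m1 : \int[nu]_y (\int[mu]_x (K (x, y) `^ 1)) `^ 1^-1 =
      \int[nu]_y \int[mu]_x K (x, y).
    apply: eq_integral => y _; rewrite invr1 poweRe1; last first.
      by apply: integral_ge0 => x _; exact: poweR_ge0.
    by apply: eq_integral => x _; rewrite poweRe1.
  rewrite m1 poweRe1; last by apply: integral_ge0 => y _; exact: integral_ge0.
  rewrite -(fubini_tonelli K)// le_eqVlt; apply/orP; left; apply/eqP.
  by apply: eq_integral => x _; rewrite poweRe1// integral_ge0.
have r0 : (0 < r)%R by exact: lt_trans r1.
apply: integral_poweR_le_dual => //.
- exact: (measurable_fun_fubini_tonelli_F K).
- by move=> x; exact: integral_ge0.
- by apply: integral_ge0 => y _; exact: poweR_ge0.
move=> w mw w0.
have mKw : measurable_fun setT (fun z : X * Y => K z * w z.1 `^ (r - 1)).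
  apply: emeasurable_funM => //; apply: measurable_fun_poweR.
  exact: measurableT_comp.
have mKx y : measurable_fun setT (fun x => K (x, y)).
  exact: measurableT_comp.
have mKr : measurable_fun setT (fun z : X * Y => K z `^ r).
  exact: measurable_fun_poweR.
rewrite [leLHS](_ : _ = \int[mu]_x \int[nu]_y (K (x, y) * w x `^ (r - 1))); last first.
  apply: eq_integral => x _; rewrite ge0_integralZr// ?poweR_ge0//.
  exact: measurableT_comp.
rewrite (fubini_tonelli (fun z : X * Y => K z * w z.1 `^ (r - 1)))//=; last first.
  by move=> z; rewrite mule_ge0// poweR_ge0.
rewrite -ge0_integralZr//; last first.
  apply: measurable_fun_poweR.
  exact: (measurable_fun_fubini_tonelli_G (fun z : X * Y => K z `^ r)).
apply: ge0_le_integral => //.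
- by move=> y _; apply: integral_ge0 => x _; rewrite mule_ge0// poweR_ge0.
- apply: (measurable_fun_fubini_tonelli_G (fun z : X * Y => K z * w z.1 `^ (r - 1))) => //.
  by move=> z; rewrite mule_ge0// poweR_ge0.
- apply: emeasurable_funM => //; apply: measurable_fun_poweR.
  exact: (measurable_fun_fubini_tonelli_G (fun z : X * Y => K z `^ r)).
- move=> y _; apply: hoelder_conjugate_integral => //; exact: ltW.
Qed.

End duality_minkowski.

Section product_sigma_finite.
Context {R : realType} {d1 d2} {X : measurableType d1} {Y : measurableType d2}.
Variables (mu : {sigma_finite_measure set X -> \bar R})
  (nu : {sigma_finite_measure set Y -> \bar R}).

Lemma sigma_finite_product_measure : sigma_finite setT (mu \x nu).
Proof.
have /sigma_finiteP[F [TF ndF Foo]] := sigma_finiteT mu.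
have /sigma_finiteP[G [TG ndG Goo]] := sigma_finiteT nu.
exists (fun n => F n `*` G n).
  rewrite -setXTT TF TG; apply/seteqP; split => [[x y] [/= [n _ Fx] [k _ Gy]]|].
    exists (maxn n k) => //; split => /=.
    - by move/subsetPset : (ndF _ _ (leq_maxl n k)); exact.
    - by move/subsetPset : (ndG _ _ (leq_maxr n k)); exact.
  by move=> [x y] [n _ [/= Fx Gy]]; split; exists n.
move=> k; have [? ?] := Foo k; have [? ?] := Goo k.
split; first exact: measurableX.
by rewrite product_measure1E// lte_mul_pinfty// ge0_fin_numE.
Qed.

(** Minkowski's inequality is applied below with the plane in the role of both spaces, which calls
    for the product measure as a bundled sigma-finite measure. *)
Definition sigma_finite_product :
    {sigma_finite_measure set (X * Y)%type -> \bar R} :=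
  HB.pack (mu \x nu)
    (Measure_isSigmaFinite.Build _ _ _ (mu \x nu) sigma_finite_product_measure).

End product_sigma_finite.

(** * Changes of variables *)

Section lebesgue_change_of_variables.
Context {R : realType}.
Local Notation leb := (@lebesgue_measure R).
Local Notation RT := (measurableTypeR R).

(** Uniqueness of Lebesgue measure from its values on half-open intervals concerns the whole line.
    The pushforward is therefore restricted to D and completed by Lebesgue measure on the complement
    of D. The source space is arbitrary because it is the plane in [integral_square]. *)
Lemma integral_comp_lebesgue d (X : measurableType d)
    (mu : {measure set X -> \bar R}) (phi : X -> RT) (D : set RT) :
  measurable D -> measurable_fun setT phi ->
  (forall u v : R, (u < v)%R ->
    mu (phi @^-1` (`]u, v] `&` D)) = leb (`]u, v] `&` D)) ->
  forall f : RT -> \bar R, measurable_fun D f -> (forall x, D x -> 0 <= f x) ->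
  \int[mu]_(x in phi @^-1` D) f (phi x) = \int[leb]_(x in D) f x.
Proof.
move=> mD mphi H f mf f0.
have := @ge0_integral_pushforward _ _ X RT R phi mphi mu D f mD mf.
move=> <-; last by move=> x; rewrite inE; exact: f0.
apply: eq_measure_integral => A mA AD.
pose m0 := [the measure RT R of pushforward mu phi].
pose m1 := m0 mphi.
pose m := measure_add (mrestr m1 mD) (mrestr leb (measurableC mD)).
have mE Z : m Z = m1 (Z `&` D) + leb (Z `&` ~` D) by exact: measure_addE.
have AE : leb A = m A.
  apply: lebesgue_measure_unique => // _ [[u v] _ <-]; apply: etrans (esym (mE _)).
  have [uv|vu] := ltP u v; last first.
    by rewrite set_itv_ge ?bnd_simp -?leNgt// !set0I !measure0 adde0.
  rewrite /m1/= /pushforward/= H//.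
  rewrite -measureU//; last 3 first.
  - exact: measurableI.
  - by apply: measurableI => //; exact: measurableC.
  - by rewrite setIACA setICr setI0.
  by rewrite -setIUr setUCr setIT.
apply: etrans (esym AE); rewrite mE (setIidl AD) (_ : A `&` ~` D = set0) ?measure0 ?adde0//.
by apply/seteqP; split => // x [/AD].
Qed.

Lemma integral_affine (a c : R) (f : RT -> \bar R) : a != 0%R ->
  measurable_fun setT f -> (forall x, 0 <= f x) ->
  \int[leb]_x f (a * x + c)%R = `|a|^-1%:E * \int[leb]_x f x.
Proof.
move=> a0 mf f0.
have mphi : measurable_fun (setT : set RT) (fun x : RT => (a * x + c)%R : RT).
  by apply: measurable_funD => //; exact: measurable_funM.
have aN0 : (0 <= `|a|)%R by [].
pose mu := mscale (NngNum aN0) leb.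
have H u v : (u < v)%R ->
    mu ((fun x : RT => (a * x + c)%R : RT) @^-1` (`]u, v] `&` setT)) =
    leb (`]u, v] `&` setT).
  move=> uv; rewrite !setIT /mu/= /mscale/=.
  have [a_gt0|a_lt0|/eqP] := ltgtP 0%R a; last by rewrite eq_sym (negbTE a0).
  - have -> : (fun x : RT => (a * x + c)%R) @^-1` `]u, v] =
        `]((u - c) / a)%R, ((v - c) / a)%R]%classic.
      apply/seteqP; split => x /=; rewrite !in_itv/=;
      by rewrite ltr_pdivrMr// ler_pdivlMr// ltrBlDr lerBrDr (mulrC x).
    rewrite !lebesgue_measure_itv/= !lte_fin uv ltr_pM2r ?invr_gt0// ltrD2r uv.
    rewrite -!EFinD -EFinM; congr EFin; rewrite gtr0_norm//.
    by field; rewrite gt_eqF.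
  - have -> : (fun x : RT => (a * x + c)%R) @^-1` `]u, v] =
        `[((v - c) / a)%R, ((u - c) / a)%R[%classic.
      apply/seteqP; split => x /=; rewrite !in_itv/=;
      by rewrite ler_ndivrMr// ltr_ndivlMr// ltrBlDr lerBrDr (mulrC x) andbC.
    rewrite !lebesgue_measure_itv/= !lte_fin uv ltr_nM2r ?invr_lt0// ltrD2r uv.
    rewrite -!EFinD -EFinM; congr EFin; rewrite ltr0_norm//.
    by field; rewrite lt_eqF.
have := integral_comp_lebesgue measurableT mphi H mf (fun x _ => f0 x).
rewrite preimage_setT => <-.
rewrite (ge0_integral_mscale leb measurableT)//; last first.
  exact: (measurableT_comp mf mphi).
by rewrite muleA -EFinM mulVf ?normr_eq0// mul1e.
Qed.

Lemma integral_shift (c : R) (f : RT -> \bar R) :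
  measurable_fun setT f -> (forall x, 0 <= f x) ->
  \int[leb]_x f (x + c)%R = \int[leb]_x f x.
Proof.
move=> mf f0; have := @integral_affine 1 c f (oner_neq0 _) mf f0.
rewrite normr1 invr1 mul1e => <-.
by apply: eq_integral => x _; rewrite mul1r.
Qed.

Lemma integral_even (f : RT -> \bar R) :
  measurable_fun setT f -> (forall x, 0 <= f x) -> (forall x, f (- x)%R = f x) ->
  \int[leb]_x f x = 2%:E * \int[leb]_(x in `]0%R, +oo[) f x.
Proof.
move=> mf f0 fN.
rewrite integral_itv_obnd_cbnd; last exact: measurable_funTS.
rewrite -(setUv `[0%R, +oo[%classic) ge0_integral_setU//=; last 3 first.
- exact: measurableC.
- by rewrite setUv.
- exact/disj_setPCl.
rewrite mule_natl mule2n; congr +%E.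
rewrite setCitvr integral_itv_bndo_bndc; last exact: measurable_funTS.
rewrite ge0_integration_by_substitution0//.
by apply: eq_integral => x _; rewrite fN.
Qed.

Lemma integral_id_itv (a b : R) : (0 <= a <= b)%R ->
  \int[leb]_(r in `]a, b]) (2 * r)%:E = (b ^+ 2 - a ^+ 2)%:E.
Proof.
move=> /andP[a0]; rewrite le_eqVlt => /predU1P[->|ab].
  by rewrite set_itvoc0 integral_set0 subrr.
rewrite integral_itv_obnd_cbnd; last first.
  by apply/measurable_EFinP; exact: measurable_funM.
rewrite (@continuous_FTC2 _ (fun r : R => 2 * r)%R (fun r : R => r ^+ 2)%R)//.
- apply: continuous_subspaceT => x.
  by apply: cvgM; [exact: cvg_cst|exact: cvg_id].
- split.
  + by move=> x _; exact: exprn_derivable.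
  + by apply: cvg_at_right_filter; exact: exprn_continuous.
  + by apply: cvg_at_left_filter; exact: exprn_continuous.
- by move=> x _; rewrite derive1E exp_derive expr1 /GRing.scale/= mulr1.
Qed.

(** The density 2r of the substitution t = r^2 is realised as the length of the fiber 0 < s < 2r.
    The map (r, s) -> r^2 then pushes the area of the region [B] forward to Lebesgue measure on the
    half-line, as the part of [B] over a < r <= b has area b^2 - a^2. *)
Lemma integral_square (f : RT -> \bar R) :
  measurable_fun setT f -> (forall x, 0 <= f x) ->
  \int[leb]_(r in `]0%R, +oo[) (f (r ^+ 2)%R * r%:E) =
  (2^-1)%:E * \int[leb]_(t in `]0%R, +oo[) f t.
Proof.
move=> mf f0.
pose B (z : RT * RT) := [&& (0 < z.1)%R, (0 < z.2)%R & (z.2 < 2 * z.1)%R].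
have mB : measurable_fun setT B.
  have m1 : measurable_fun setT (fun z : RT * RT => z.1 : R) by exact: measurable_fst.
  have m2 : measurable_fun setT (fun z : RT * RT => z.2 : R) by exact: measurable_snd.
  by apply: measurable_and; [|apply: measurable_and]; apply: measurable_fun_ltr => //;
    exact: measurable_funM.
(* The value -1 sends the points outside [B] outside [D]. *)
pose phi (z : RT * RT) : RT := if B z then (z.1 ^+ 2)%R else (-1)%R.
have mphi : measurable_fun setT phi.
  apply: measurable_fun_ifT => //.
  by apply: measurable_funX; exact: measurable_fst.
pose D : set RT := `]0%R, +oo[%classic.
have mD : measurable D by exact: measurable_itv.
have memD x : (x \in D) = (0 < x)%R by rewrite /D mem_setE in_itv/= andbT.
have memphi (Z : set RT) z : (z \in phi @^-1` Z) = (phi z \in Z) by [].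
have int_B (c : \bar R) (r : R) : 0 <= c ->
    \int[leb]_s (if B (r, s) then c else 0) =
    if (0 < r)%R then c * (2 * r)%:E else 0.
  move=> c0; rewrite /B/=; case: ifPn => r0 /=; last by rewrite integral0.
  transitivity (\int[leb]_(s in `]0%R, (2 * r)%R[) c).
    rewrite [RHS]integral_mkcond; apply: eq_integral => s _.
    by rewrite patchE mem_setE in_itv.
  rewrite integral_cst//= lebesgue_measure_itv/= lte_fin pmulr_rgt0// r0.
  by rewrite -EFinB subr0.
have mBz (g : RT * RT -> \bar R) : measurable_fun setT g ->
    measurable_fun setT (fun z => if B z then g z else 0).
  by move=> mg; apply: measurable_fun_ifT.
have H u v : (u < v)%R -> (leb \x leb) (phi @^-1` (`]u, v] `&` D)) = leb (`]u, v] `&` D).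
  move=> uv.
  have mS : measurable (phi @^-1` (`]u, v] `&` D)).
    rewrite -[X in measurable X]setTI; apply: mphi => //.
    by apply: measurableI => //; exact: measurable_itv.
  have mS1 : measurable_fun setT (fun z : RT * RT => (\1_(phi @^-1` (`]u, v] `&` D)) z)%:E : \bar R).
    exact/measurable_EFinP/measurable_indic.
  rewrite -[LHS]mul1e -integral_cst// integral_mkcond.
  (* A negative endpoint has square root 0, so the interval from [a] to [b] is cut off at 0
     automatically. *)
  pose a := Num.sqrt u; pose b := Num.sqrt v.
  have ab : (0 <= a <= b)%R by rewrite sqrtr_ge0/= ler_wsqrtr// ltW.
  pose S r := (a < r <= b)%R.
  have mS' : measurable_fun setT (S : RT -> bool).
    apply: measurable_and; first exact: measurable_fun_ltr.
    exact: measurable_fun_ler.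
  have -> : cst 1 \_ (phi @^-1` (`]u, v] `&` D)) =
      (fun z => if B z then (if S z.1 then 1 else 0) else 0) :> (RT * RT -> \bar R).
    apply/funext => -[r s]; rewrite patchE memphi in_setI memD mem_setE in_itv /phi/=.
    have [/and3P[/= r0 _ _]|nB] := boolP (B (r, s)); last first.
      by rewrite ltr0N1 andbF.
    rewrite exprn_gt0// andbT; congr (if _ then _ else _).
    rewrite /S; congr (_ && _).
      have [u0|u0] := leP 0%R u; last first.
        by rewrite /a ler0_sqrtr ?ltW// r0 (lt_le_trans u0)// exprn_ge0// ltW.
      by rewrite -{1}(sqr_sqrtr u0) ltr_pXn2r ?nnegrE ?sqrtr_ge0// ltW.
    have [v0|v0] := leP 0%R v; last first.
      rewrite /b (ler0_sqrtr (ltW v0)) (lt_geF r0) lt_geF//.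
      by rewrite (lt_le_trans v0)// exprn_ge0// ltW.
    by rewrite -{1}(sqr_sqrtr v0) ler_pXn2r ?nnegrE ?sqrtr_ge0// ltW.
  rewrite fubini_tonelli1//=; last 2 first.
  - apply: mBz; apply: measurable_fun_ifT => //.
    exact: (measurableT_comp mS').
  - by move=> z; case: ifP => // _; case: ifP.
  rewrite /fubini_F/=.
  transitivity (\int[leb]_(r in `]a, b]) (2 * r)%:E).
    rewrite [RHS]integral_mkcond; apply: eq_integral => r _.
    rewrite int_B; last by case: ifP.
    rewrite patchE mem_setE in_itv/= -/(S r); case: (boolP (S r)) => Sr.
      by rewrite ifT ?mul1e//; move: Sr => /andP[+ _]; apply: le_lt_trans; rewrite sqrtr_ge0.
    by rewrite mul0e if_same.
  rewrite integral_id_itv//.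
  have -> : `]u, v] `&` D = `]Num.max u 0%R, v]%classic.
    apply/seteqP; split => x; rewrite /D/= !in_itv/= ?andbT gt_max.
      by move=> [/andP[-> ->] ->].
    by move=> /andP[/andP[-> ->] ->].
  rewrite lebesgue_measure_itv/= lte_fin gt_max uv/=.
  rewrite /a /b; have [v0|v0] := ltP 0%R v.
    rewrite (sqr_sqrtr (ltW v0)) -EFinB; congr (_ - _)%:E.
    have [u0|u0] := leP 0%R u; first by rewrite sqr_sqrtr.
    by rewrite ler0_sqrtr ?ltW// expr0n.
  by rewrite !ler0_sqrtr ?subrr// (le_trans (ltW uv)).
have := @integral_comp_lebesgue _ _ (leb \x leb) phi D mD mphi H f.
move=> /(_ (measurable_funTS mf) (fun x _ => f0 x)) <-.
rewrite integral_mkcond.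
have -> : (f \o phi) \_ (phi @^-1` D) =
    (fun z => if B z then f (z.1 ^+ 2)%R else 0) :> (RT * RT -> \bar R).
  apply/funext => -[r s]; rewrite patchE memphi memD /phi/=.
  have [/and3P[/= r0 _ _]|nB] := boolP (B (r, s)).
    by rewrite exprn_gt0.
  by rewrite ltr0N1.
rewrite fubini_tonelli1//=; last 2 first.
- apply: mBz; apply: (measurableT_comp mf); apply: measurable_funX.
  exact: measurable_fst.
- by move=> z; case: ifP.
rewrite /fubini_F/=.
under [in RHS]eq_integral do rewrite int_B//.
rewrite -ge0_integralZl//; last 2 first.
- apply: measurable_fun_ifT => //; first exact: measurable_fun_ltr.
  apply: emeasurable_funM; last by apply/measurable_EFinP; exact: measurable_funM.
  by apply: (measurableT_comp mf); exact: measurable_funX.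
- move=> r _; case: ifP => // r0; rewrite mule_ge0// lee_fin mulr_ge0// ltW//.
rewrite [LHS]integral_mkcond; apply: eq_integral => r _.
rewrite patchE mem_setE in_itv/= andbT; case: ifP => r0; last by rewrite mule0.
by rewrite muleCA -EFinM mulrA mulVf// mul1r.
Qed.

End lebesgue_change_of_variables.

(** * The Hardy-Littlewood-Sobolev inequality *)

Section power_integrals.
Context {R : realType}.
Local Notation leb := (@lebesgue_measure R).
Local Notation RT := (measurableTypeR R).

Lemma integral_powR_itv (a b c : R) : (0 < a)%R -> (a <= b)%R -> (c + 1 != 0)%R ->
  \int[leb]_(x in `[a, b]) (x `^ c)%:E =
  ((b `^ (c + 1) - a `^ (c + 1)) / (c + 1))%:E.
Proof.
move=> a0; rewrite le_eqVlt => /predU1P[<- _|ab c1].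
  by rewrite subrr mul0r set_itv1 integral_set1.
have drv (x e : R) : (0 < x)%R -> derivable (fun z : R => z `^ e)%R x 1.
  by move=> x0; apply: derivable_powR; rewrite in_itv/= x0.
have cnt (x e : R) : (0 < x)%R -> {for x, continuous (fun z : R => z `^ e)%R}.
  by move=> x0; apply: differentiable_continuous; exact/derivable1_diffP/drv.
pose F (x : R) : R := ((c + 1)^-1 * x `^ (c + 1))%R.
have cF (x : R) : (0 < x)%R -> {for x, continuous F}.
  by move=> x0; apply: cvgM; [exact: cvg_cst|exact: cnt].
rewrite (@continuous_FTC2 _ (fun x : R => x `^ c)%R F)//.
- by rewrite /F -EFinB; congr EFin; rewrite -mulrBr mulrC.
- apply: continuous_in_subspaceT => x; rewrite inE/= in_itv/= => /andP[ax _].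
  exact/cnt/(lt_le_trans a0).
- split.
  + move=> x; rewrite in_itv/= => /andP[ax _].
    by apply: derivableM => //; exact/drv/(lt_trans a0).
  + exact/cvg_at_right_filter/cF.
  + by apply/cvg_at_left_filter/cF; exact: lt_trans ab.
- move=> x; rewrite in_itv/= => /andP[ax _].
  have x0 : (0 < x)%R by exact: lt_trans ax.
  rewrite derive1E deriveMl; last exact: drv.
  have [_ ->] := is_derive1_powR (c + 1) x0.
  by rewrite addrK /GRing.scale/= mulrA mulVf// mul1r.
Qed.

Lemma integral_bigcup_le d (X : measurableType d) (mu : {measure set X -> \bar R})
    (F : nat -> set X) (f : X -> \bar R) (M : \bar R) :
  (forall n, measurable (F n)) -> nondecreasing_seq F ->
  measurable_fun setT f -> (forall x, 0 <= f x) ->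
  (forall n, \int[mu]_(x in F n) f x <= M) ->
  \int[mu]_(x in \bigcup_n F n) f x <= M.
Proof.
move=> mF ndF mf f0 H.
have cv := @ge0_nondecreasing_set_cvg_integral _ _ _ F f mu ndF mF
  (fun i => measurable_funTS mf) (fun i x _ => f0 x).
rewrite -(cvg_lim _ cv)//; apply: lime_le; first by apply/cvg_ex; eexists; exact: cv.
exact: nearW.
Qed.

Lemma measurable_powRE (c : R) : measurable_fun (setT : set RT) (fun x : RT => (x `^ c)%:E).
Proof. by apply/measurable_EFinP; exact: measurable_powR. Qed.

Lemma integral_powR_near (b c : R) : (0 < b)%R -> (-1 < c)%R ->
  \int[leb]_(x in `]0%R, b]) (x `^ c)%:E <= (b `^ (c + 1) / (c + 1))%:E.
Proof.
move=> b0 c1; have c0 : (0 < c + 1)%R by rewrite -ltrBlDr sub0r.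
have -> : `]0%R, b]%classic = \bigcup_n `[(b / n.+1%:R)%R, b]%classic.
  apply/seteqP; split => x /=; rewrite ?in_itv/=.
    move=> /andP[x0 xb]; exists (Num.trunc (b / x)) => //=; rewrite in_itv/= xb andbT.
    rewrite ler_pdivrMr// mulrC -ler_pdivrMr//.
    by apply: ltW; exact: truncnS_gt.
  move=> [n _]/=; rewrite in_itv/= => /andP[bx ->]; rewrite andbT.
  by apply: lt_le_trans bx; rewrite divr_gt0.
apply: integral_bigcup_le => //.
- move=> m n mn; apply/subsetPset => x /=; rewrite !in_itv/= => /andP[+ ->].
  rewrite andbT; apply: le_trans; rewrite ler_pM2l// lef_pV2 ?posrE//.
  by rewrite ler_nat ltnS.
- exact: measurable_powRE.
- by move=> x; rewrite lee_fin powR_ge0.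
- move=> n; rewrite integral_powR_itv ?divr_gt0 ?gt_eqF//; last first.
    by rewrite ler_pdivrMr// ler_peMr ?ler1n// ltW.
  by rewrite lee_fin ler_pM2r ?invr_gt0// gerBl powR_ge0.
Qed.

Lemma integral_powR_far (a c : R) : (0 < a)%R -> (c < -1)%R ->
  \int[leb]_(x in `[a, +oo[) (x `^ c)%:E <= (a `^ (c + 1) / (- (c + 1)))%:E.
Proof.
move=> a0 c1; have c0 : (c + 1 < 0)%R by rewrite -ltrBrDr sub0r.
have -> : `[a, +oo[%classic = \bigcup_n `[a, (a + n%:R)%R]%classic.
  apply/seteqP; split => x /=; rewrite ?in_itv/=.
    rewrite andbT => ax; exists (Num.trunc (x - a)).+1 => //=; rewrite in_itv/= ax/=.
    by rewrite -lerBlDl; apply: ltW; exact: truncnS_gt.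
  by move=> [n _]/=; rewrite in_itv/= => /andP[-> _].
apply: integral_bigcup_le => //.
- move=> m n mn; apply/subsetPset => x /=; rewrite !in_itv/= => /andP[-> /=].
  by move=> /le_trans; apply; rewrite lerD2l ler_nat.
- exact: measurable_powRE.
- by move=> x; rewrite lee_fin powR_ge0.
- move=> n; rewrite integral_powR_itv ?lt_eqF// ?lerDl//.
  rewrite lee_fin -[leLHS]mulrNN -invrN ler_pM2r ?invr_gt0 ?oppr_gt0//.
  by rewrite opprB gerBl powR_ge0.
Qed.

End power_integrals.

Section hardy_littlewood_sobolev.
Context {R : realType}.
Local Notation leb := (@lebesgue_measure R).
Local Notation RT := (measurableTypeR R).

(** At 0 a negative power has the conventional value 0. The value +oo is put instead, so that the
    kernel remains an upper bound on the diagonal x = x'. *)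
Definition riesz (lam : R) (z : RT) : \bar R :=
  if z == 0%R then +oo else (`|z| `^ (- lam))%:E.

Variable lam : R.
Hypothesis lam01 : (0 < lam < 1)%R.

Let lam0 : (0 < lam)%R. Proof. by case/andP: lam01. Qed.
Let lam1 : (lam < 1)%R. Proof. by case/andP: lam01. Qed.

Lemma riesz_ge0 z : 0 <= riesz lam z.
Proof. by rewrite /riesz; case: ifP => // _; rewrite lee_fin powR_ge0. Qed.

Lemma rieszN z : riesz lam (- z)%R = riesz lam z.
Proof. by rewrite /riesz oppr_eq0 normrN. Qed.

Lemma measurable_riesz : measurable_fun setT (riesz lam).
Proof.
apply: measurable_fun_ifT.
- exact: measurable_fun_eqr.
- exact: measurable_cst.
- apply/measurable_EFinP; apply: (measurableT_comp (measurable_powR _)).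
  exact: normr_measurable.
Qed.

Let near_riesz (rho : R) (z : RT) := if (`|z| <= rho)%R then riesz lam z else 0.
Let far_riesz (rho : R) (z : RT) := if (`|z| <= rho)%R then 0 else riesz lam z.

Let measurable_normle rho : measurable_fun (setT : set RT) (fun z : RT => (`|z| <= rho)%R).
Proof. by apply: measurable_fun_ler => //; exact: normr_measurable. Qed.

Let measurable_near rho : measurable_fun setT (near_riesz rho).
Proof. by apply: measurable_fun_ifT => //; exact: measurable_riesz. Qed.

Let measurable_far rho : measurable_fun setT (far_riesz rho).
Proof. by apply: measurable_fun_ifT => //; exact: measurable_riesz. Qed.

Let near_ge0 rho z : 0 <= near_riesz rho z.
Proof. by rewrite /near_riesz; case: ifP => // _; exact: riesz_ge0. Qed.

Let far_ge0 rho z : 0 <= far_riesz rho z.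
Proof. by rewrite /far_riesz; case: ifP => // _; exact: riesz_ge0. Qed.

Let integral_near rho : (0 < rho)%R ->
  \int[leb]_z near_riesz rho z <= (2 * (rho `^ (1 - lam) / (1 - lam)))%:E.
Proof.
move=> rho0; rewrite integral_even//; last first.
  by move=> z; rewrite /near_riesz normrN rieszN.
rewrite EFinM; apply: lee_wpmul2l => //.
apply: (@le_trans _ _ (\int[leb]_(x in `]0%R, rho]) (x `^ (- lam))%:E)); last first.
  by have := @integral_powR_near R rho (- lam) rho0; rewrite ltrN2 addrC; apply.
rewrite le_eqVlt; apply/orP; left; apply/eqP.
rewrite [LHS]integral_mkcond [RHS]integral_mkcond; apply: eq_integral => z _.
rewrite !patchE !mem_setE !in_itv/= andbT /near_riesz /riesz.
case: (ltP 0%R z) => //= z0; rewrite gt_eqF//.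
by rewrite gtr0_norm.
Qed.

Let integral_far rho : (0 < rho)%R ->
  \int[leb]_z (far_riesz rho z `^ (2 / lam)) <= (2 / rho)%:E.
Proof.
move=> rho0; rewrite integral_even//; last 2 first.
- exact: measurable_fun_poweR.
- by move=> z; rewrite /far_riesz normrN rieszN.
rewrite EFinM; apply: lee_wpmul2l => //.
apply: (@le_trans _ _ (\int[leb]_(x in `[rho, +oo[) (x `^ (- 2))%:E)); last first.
  apply: (@le_trans _ _ (rho `^ (-2 + 1) / (- (-2 + 1)))%:E).
    by apply: integral_powR_far => //; rewrite ltrN2 ltr1n.
  have -> : (-2 + 1 = -1 :> R)%R by ring.
  by rewrite opprK divr1 powR_inv1// ltW.
rewrite [leLHS]integral_mkcond [leRHS]integral_mkcond; apply: ge0_le_integral => //.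
- by move=> z _; rewrite patchE; case: ifP.
- apply/(measurable_restrictT _ _).1 => //; apply: measurable_funTS.
  exact: measurable_fun_poweR.
- by apply/(measurable_restrictT _ _).1 => //; apply: measurable_funTS; exact: measurable_powRE.
move=> z _; rewrite !patchE !mem_setE !in_itv/= !andbT /far_riesz /riesz.
case: (ltP 0%R z) => z0; last by case: ifP => // _; rewrite lee_fin powR_ge0.
rewrite (gtr0_norm z0); case: (leP z rho) => zr.
  rewrite poweR0r; last by rewrite mulf_neq0// invr_neq0// gt_eqF.
  by case: ifP => // _; rewrite lee_fin powR_ge0.
rewrite (ltW zr) gt_eqF// poweR_EFin -powRrM lee_fin.
by rewrite mulNr mulrCA mulfV ?gt_eqF// mulr1.
Qed.

(** The exponent of scale invariance, 2 / pp + lam = 2. Its dual is 2 / lam, and the kernel raised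
    to the dual power is |z|^(-2), integrable at infinity. *)
Let pp : R := (2 / (2 - lam))%R.

Let lam2 : (0 < 2 - lam)%R.
Proof. by rewrite subr_gt0 (lt_trans lam1)// ltr1n. Qed.

Let pp0 : (0 < pp)%R. Proof. by rewrite divr_gt0. Qed.

(** The summands come from the near and the far part. With cut-off radius rho these scale like a
    rho^(1 - lam) and rho^(- lam / 2), and rho = a^(-pp) makes both equal to a^(pp - 1). *)
Let cc : R := (2 / (1 - lam) + 2 `^ (lam / 2))%R.

(* Points y at distance at most rho = a^(-p) from x are handled by the bound
   G y <= a, the others by Hoelder's inequality. *)
Let riesz_sublevel (G : RT -> R) (x : RT) (a : R) : (0 < a)%R ->
  measurable_fun setT G -> (forall x, 0 <= G x)%R ->
  \int[leb]_x (G x `^ pp)%:E <= 1 ->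
  \int[leb]_y (if (G y <= a)%R then (G y)%:E * riesz lam (x - y)%R else 0) <=
  (cc * a `^ (pp - 1))%:E.
Proof.
move=> a0 mG G0 G1; set rho := (a `^ (- pp))%R.
have rho0 : (0 < rho)%R by exact: powR_gt0.
have mxy (f : RT -> \bar R) : measurable_fun setT f ->
    measurable_fun setT (fun y : RT => f (x - y)%R).
  by move=> mf; apply: (measurableT_comp mf); exact: measurable_funB.
have Ixy (f : RT -> \bar R) : measurable_fun setT f -> (forall z, 0 <= f z) ->
    \int[leb]_y f (x - y)%R = \int[leb]_y f y.
  move=> mf f0; have n1 : (-1 != 0 :> R)%R by rewrite oppr_eq0 oner_neq0.
  have := @integral_affine R (-1) x f n1 mf f0.
  rewrite normrN normr1 invr1 mul1e => <-.
  by apply: eq_integral => y _; rewrite mulN1r addrC.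
apply: (@le_trans _ _ (\int[leb]_y (a%:E * near_riesz rho (x - y)%R +
    (G y)%:E * far_riesz rho (x - y)%R))).
  apply: ge0_le_integral => //.
  - by move=> y _; case: ifP => // _; rewrite mule_ge0 ?lee_fin ?riesz_ge0.
  - apply: measurable_fun_ifT => //; first exact: measurable_fun_ler.
    apply: emeasurable_funM; first exact/measurable_EFinP.
    by apply: mxy; exact: measurable_riesz.
  - apply: emeasurable_funD; apply: emeasurable_funM => //; try exact: mxy.
    exact/measurable_EFinP.
  - move=> y _; rewrite /near_riesz /far_riesz.
    case: ifP => Ga; last first.
      by rewrite adde_ge0// mule_ge0 ?lee_fin ?(ltW a0)//; case: ifP => // _; exact: riesz_ge0.
    case: ifP => _; rewrite mule0 ?adde0 ?add0e//.
    by apply: lee_wpmul2r; [exact: riesz_ge0|rewrite lee_fin].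
rewrite ge0_integralD//; last 4 first.
- by move=> y _; rewrite mule_ge0 ?lee_fin ?(ltW a0).
- by apply: emeasurable_funM => //; exact: mxy.
- by move=> y _; rewrite mule_ge0 ?lee_fin.
- by apply: emeasurable_funM => //; [exact/measurable_EFinP|exact: mxy].
rewrite /cc mulrDl EFinD; apply: leeD.
  rewrite ge0_integralZl//; [|exact: mxy|by rewrite lee_fin ltW].
  rewrite Ixy//; apply: (@le_trans _ _ (a%:E * (2 * (rho `^ (1 - lam) / (1 - lam)))%:E)).
    by apply: lee_wpmul2l; [rewrite lee_fin ltW|exact: integral_near].
  rewrite -EFinM lee_fin /rho -powRrM.
  have -> : (pp - 1 = 1 + - pp * (1 - lam))%R.
    by rewrite /pp; field; rewrite gt_eqF.
  rewrite powRD; last by rewrite (gt_eqF a0) implybT.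
  rewrite (powRr1 (ltW a0)).
  by rewrite le_eqVlt; apply/orP; left; apply/eqP; field; rewrite gt_eqF// subr_gt0.
have pp1 : (pp^-1 = 1 - lam / 2)%R by rewrite /pp invf_div; field.
have := @geometric_hoelder _ _ _ leb (fun y => (G y `^ pp)%:E)
  (fun y => far_riesz rho (x - y)%R `^ (2 / lam)) pp^-1.
have -> : (1 - pp^-1 = lam / 2)%R by rewrite pp1 opprB addrC subrK.
have s01 : (0 <= pp^-1 <= 1)%R.
  by rewrite invr_ge0 ltW//= pp1 gerBl divr_ge0// ltW.
have mGp : measurable_fun setT (fun y : RT => (G y `^ pp)%:E).
  by apply/measurable_EFinP; exact: (measurableT_comp (measurable_powR _)).
have mf : measurable_fun setT (fun y : RT => far_riesz rho (x - y)%R `^ (2 / lam)).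
  by apply: measurable_fun_poweR; exact: mxy.
move=> /(_ s01 mGp mf (fun y => _) (fun y => poweR_ge0 _ _)) => H.
apply: (@le_trans _ _ (1 * (2 / rho)%:E `^ (lam / 2))); last first.
  rewrite mul1e poweR_EFin lee_fin powRM//; last by rewrite invr_ge0 ltW.
  rewrite /rho -powRN opprK -powRrM.
  have -> : (pp * (lam / 2) = pp - 1)%R by rewrite /pp; field; rewrite gt_eqF.
  by [].
apply: (@le_trans _ _ ((\int[leb]_y (G y `^ pp)%:E) `^ pp^-1 *
    (\int[leb]_y (far_riesz rho (x - y)%R `^ (2 / lam))) `^ (lam / 2))).
  apply: le_trans (H _); last by move=> y; rewrite lee_fin powR_ge0.
  rewrite le_eqVlt; apply/orP; left; apply/eqP; apply: eq_integral => y _.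
  rewrite poweR_EFin -powRrM mulfV ?gt_eqF// powRr1// -poweRrM.
  have -> : (2 / lam * (lam / 2) = 1)%R by field; rewrite gt_eqF.
  by rewrite poweRe1.
apply: lee_pmul; [exact: poweR_ge0|exact: poweR_ge0| |].
  rewrite -[leRHS](poweR1r (pp^-1)%R); apply: lee_poweR => //.
    by rewrite invr_ge0 ltW.
  by apply: integral_ge0 => y _; rewrite lee_fin powR_ge0.
apply: lee_poweR; [by rewrite divr_ge0// ltW|exact: integral_ge0|].
rewrite (Ixy (fun z => far_riesz rho z `^ (2 / lam)))//; last exact: measurable_fun_poweR.
exact: integral_far.
Qed.

(** The pairs are split according to which of G x, G y is larger. Where G y <= G x, the bound on
    sublevel sets with a = G x makes the inner integral at most cc (G x)^(pp - 1), so this half is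
    at most cc times the integral of G^pp; the other half is its mirror image. *)
Lemma hardy_littlewood_sobolev_diagonal : exists2 C : R, (0 <= C)%R &
  forall G : RT -> R, measurable_fun setT G -> (forall x, 0 <= G x)%R ->
  \int[leb]_x (G x `^ (2 / (2 - lam)))%:E <= 1 ->
  \int[leb]_x \int[leb]_y ((G x * G y)%:E * riesz lam (x - y)%R) <= C%:E.
Proof.
have cc0 : (0 <= cc)%R by rewrite addr_ge0 ?powR_ge0// divr_ge0// subr_ge0 ltW.
exists (cc + cc)%R; first exact: addr_ge0.
move=> G mG G0 G1.
pose A (z : RT * RT) : \bar R := if (G z.2 <= G z.1)%R then
  (G z.1)%:E * ((G z.2)%:E * riesz lam (z.1 - z.2)%R) else 0.
have A0 z : 0 <= A z.
  by rewrite /A; case: ifP => // _; rewrite !mule_ge0 ?lee_fin ?riesz_ge0.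
have mG1 : measurable_fun setT (fun z : RT * RT => G z.1) by exact: measurableT_comp.
have mG2 : measurable_fun setT (fun z : RT * RT => G z.2) by exact: measurableT_comp.
have mr : measurable_fun setT (fun z : RT * RT => riesz lam (z.1 - z.2)%R).
  apply: (measurableT_comp measurable_riesz); apply: measurable_funB.
    exact: measurable_fst.
  exact: measurable_snd.
have mA : measurable_fun setT A.
  apply: measurable_fun_ifT => //; first exact: measurable_fun_ler.
  by apply: emeasurable_funM; [exact/measurable_EFinP|
    apply: emeasurable_funM => //; exact/measurable_EFinP].
have mA' : measurable_fun setT (fun z : RT * RT => A (z.2, z.1)).
  by apply: (measurableT_comp mA); exact: measurable_swap.
have IA : \int[leb]_x \int[leb]_y A (x, y) <= cc%:E.
  apply: (@le_trans _ _ (\int[leb]_x (cc%:E * (G x `^ pp)%:E))).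
    apply: ge0_le_integral => //.
    - by move=> x _; exact: integral_ge0.
    - exact: (measurable_fun_fubini_tonelli_F A).
    - apply: emeasurable_funM => //; apply/measurable_EFinP.
      exact: (measurableT_comp (measurable_powR _)).
    - move=> x _; have := G0 x; rewrite le_eqVlt => /predU1P[Gx0|Gx0].
        rewrite integral0_eq ?mule_ge0 ?lee_fin ?powR_ge0// => y _.
        by rewrite /A/= -Gx0 mul0e if_same.
      rewrite [leLHS](_ : _ = (G x)%:E * \int[leb]_y
          (if (G y <= G x)%R then (G y)%:E * riesz lam (x - y)%R else 0)); last first.
        rewrite -ge0_integralZl//.
        - by apply: eq_integral => y _; rewrite /A/=; case: ifP => // _; rewrite mule0.
        - apply: measurable_fun_ifT => //; first exact: measurable_fun_ler.
          apply: emeasurable_funM; first exact/measurable_EFinP.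
          by apply: (measurableT_comp measurable_riesz); exact: measurable_funB.
        - by move=> y _; case: ifP => // _; rewrite mule_ge0 ?lee_fin ?riesz_ge0.
        - by rewrite lee_fin.
      apply: (@le_trans _ _ ((G x)%:E * (cc * G x `^ (pp - 1))%:E)).
        by apply: lee_wpmul2l; [rewrite lee_fin|exact: riesz_sublevel].
      by rewrite -!EFinM lee_fin mulrCA mulr_powRB1.
  rewrite ge0_integralZl//.
  - by rewrite -[leRHS]mule1; apply: lee_wpmul2l.
  - by apply/measurable_EFinP; exact: (measurableT_comp (measurable_powR _)).
  - by move=> x _; rewrite lee_fin powR_ge0.
rewrite EFinD; apply: (@le_trans _ _ (\int[leb]_x (\int[leb]_y A (x, y) +
    \int[leb]_y A (y, x)))); last first.
  rewrite ge0_integralD//.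
  - apply: leeD; first exact: IA.
    rewrite -(fubini_tonelli A)//; exact: IA.
  - by move=> x _; exact: integral_ge0.
  - exact: (measurable_fun_fubini_tonelli_F A).
  - by move=> x _; exact: integral_ge0.
  - exact: (measurable_fun_fubini_tonelli_F (fun z : RT * RT => A (z.2, z.1))).
have mT : measurable_fun setT (fun z : RT * RT => (G z.1 * G z.2)%:E * riesz lam (z.1 - z.2)%R).
  by apply: emeasurable_funM => //; apply/measurable_EFinP; exact: measurable_funM.
have T0 z : 0 <= (G z.1 * G z.2)%:E * riesz lam (z.1 - z.2)%R.
  by rewrite mule_ge0 ?riesz_ge0// lee_fin mulr_ge0.
apply: ge0_le_integral => //.
- by move=> x _; apply: integral_ge0 => y _; exact: (T0 (x, y)).
- exact: (measurable_fun_fubini_tonelli_F (fun z : RT * RT =>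
    (G z.1 * G z.2)%:E * riesz lam (z.1 - z.2)%R)).
- apply: emeasurable_funD.
    exact: (measurable_fun_fubini_tonelli_F A).
  exact: (measurable_fun_fubini_tonelli_F (fun z : RT * RT => A (z.2, z.1))).
move=> x _; rewrite -ge0_integralD//; last 2 first.
- exact: (measurableT_comp mA).
- exact: (measurableT_comp mA).
apply: ge0_le_integral => //.
- by move=> y _; exact: (T0 (x, y)).
- exact: (measurable_fun_pair2 x mT).
- by apply: emeasurable_funD; [exact: (measurable_fun_pair2 x mA)|exact: (measurable_fun_pair1 x mA)].
move=> y _; rewrite /A/= -rieszN opprB EFinM -muleA; case: (leP (G y) (G x)) => [Gyx|/ltW Gxy].
  rewrite -rieszN opprB; apply: leeDl; case: ifP => // _.
  by rewrite !mule_ge0 ?lee_fin ?riesz_ge0.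
by rewrite Gxy muleCA add0e.
Qed.

End hardy_littlewood_sobolev.

(** * The parabolic operator in one dimension *)

Ltac mfun := repeat match goal with
  | |- measurable_fun _ (fun _ => ?c) => exact: measurable_cst
  | |- measurable_fun _ (fun x => x) => exact: measurable_id
  | |- measurable_fun _ fst => exact: measurable_fst
  | |- measurable_fun _ snd => exact: measurable_snd
  | |- measurable_fun _ (fun x => (_, _)) => apply: measurable_fun_pair
  | |- measurable_fun _ (fun x => (_ + - _)%R) => apply: measurable_funB
  | |- measurable_fun _ (fun x => (_ + _)%R) => apply: measurable_funD
  | |- measurable_fun _ (fun x => (_ * _)%R) => apply: measurable_funM
  | |- measurable_fun _ (fun x => (_ ^+ _)%R) => apply: measurable_funX
  | |- measurable_fun _ (fun x => (fst _)) => apply: (measurableT_comp measurable_fst)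
  | |- measurable_fun _ (fun x => (snd _)) => apply: (measurableT_comp measurable_snd)
  end.

Section one_dimensional_operator.
Context {R : realType}.
Local Notation leb := (@lebesgue_measure R).
Local Notation RT := (measurableTypeR R).

Definition parab1 (h : RT * RT -> \bar R) (y u : RT) : \bar R :=
  \int[leb]_x h (x, (u + (x - y) ^+ 2)%R).

Lemma parab1_ge0 h y u : (forall z, 0 <= h z) -> 0 <= parab1 h y u.
Proof. by move=> h0; exact: integral_ge0. Qed.

Lemma measurable_parab1 h : measurable_fun setT h -> (forall z, 0 <= h z) ->
  measurable_fun setT (fun z : RT * RT => parab1 h z.1 z.2).
Proof.
move=> mh h0.
apply: (measurable_fun_fubini_tonelli_F (m2 := leb) (fun w : (RT * RT) * RT =>
  h (w.2, (w.1.2 + (w.2 - w.1.1) ^+ 2)%R))) => //.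
by apply: (measurableT_comp mh); mfun.
Qed.

(* For fixed x <> x' the map (y, u) |-> (u + (x - y)^2, u + (x' - y)^2) is a
   bijection of the plane with constant Jacobian 2 |x - x'|. *)
Lemma integral_two_parabolas (A B : RT -> \bar R) (x x' : R) : x != x' ->
  measurable_fun setT A -> measurable_fun setT B ->
  (forall t, 0 <= A t) -> (forall t, 0 <= B t) ->
  \int[leb]_y \int[leb]_u (A (u + (x - y) ^+ 2)%R * B (u + (x' - y) ^+ 2)%R) =
  (`|2 * (x - x')|^-1)%:E * (\int[leb]_t A t * \int[leb]_t B t).
Proof.
move=> xx' mA mB A0 B0.
have d0 : (2 * (x - x') != 0)%R by rewrite mulf_neq0// subr_eq0.
(* Translating u by (x - y)^2 leaves in [B] the difference of the two squares, which is affine in y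
   with slope 2 (x - x'). *)
pose K (z : RT * RT) :=
  A z.2 * B (2 * (x - x') * z.1 + (z.2 + (x' ^+ 2 - x ^+ 2)))%R.
have mK : measurable_fun setT K.
  by apply: emeasurable_funM; [apply: (measurableT_comp mA)|apply: (measurableT_comp mB)]; mfun.
have K0 z : 0 <= K z by rewrite mule_ge0.
transitivity (\int[leb]_y \int[leb]_u K (y, u)).
  apply: eq_integral => y _.
  rewrite -(@integral_shift _ ((x - y) ^+ 2)%R (fun u => K (y, u)))//.
    by apply: eq_integral => u _; rewrite /K/=; congr (_ * B _); ring.
  exact: measurable_fun_pair2.
rewrite (fubini_tonelli K)//.
transitivity (\int[leb]_u (A u * ((`|2 * (x - x')|^-1)%:E * \int[leb]_t B t))).
  apply: eq_integral => u _; rewrite /K/= ge0_integralZl//; last first.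
    by apply: (measurableT_comp mB); mfun.
  by rewrite integral_affine.
rewrite ge0_integralZr//; last first.
  by rewrite mule_ge0// ?lee_fin ?invr_ge0//; exact: integral_ge0.
by rewrite muleCA.
Qed.

(** The input is given as G(x) k(x, u) with k normalised on each fiber, so that G dominates the
    fiber norms and the Hardy-Littlewood-Sobolev inequality applies to G. The order of the kernel is
    lam = 2 / q because the Jacobian factor |x - x'|^(-1) is raised to the power 2 / q; the exponent
    2 / (2 - lam) is then q / (q - 1). *)
Lemma parab1_diagonal (q : R) : (2 < q)%R -> exists2 C : R, (0 <= C)%R &
  forall (G : RT -> R) (k : RT * RT -> \bar R),
  measurable_fun setT G -> (forall x, 0 <= G x)%R ->
  measurable_fun setT k -> (forall z, 0 <= k z) ->
  \int[leb]_x (G x `^ (q / (q - 1)))%:E <= 1 ->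
  (forall x, \int[leb]_u (k (x, u) `^ (q / 2)) <= 1) ->
  \int[leb]_y \int[leb]_u (parab1 (fun z => (G z.1)%:E * k z) y u `^ q) <= C%:E.
Proof.
move=> q2; have q0 : (0 < q)%R by apply: lt_trans q2.
have lam01 : (0 < 2 / q < 1)%R by rewrite divr_gt0//= ltr_pdivrMr// mul1r.
have [C C0 hls] := hardy_littlewood_sobolev_diagonal lam01.
exists (C `^ (q / 2))%R; first exact: powR_ge0.
move=> G k mG G0 mk k0 G1 k1.
have r1 : (1 <= q / 2)%R by rewrite ler_pdivlMr// mul1r ltW.
have r0 : (0 < q / 2)%R by rewrite divr_gt0.
set h := fun z : RT * RT => (G z.1)%:E * k z.
have h0 z : 0 <= h z by rewrite mule_ge0// lee_fin.
have mh : measurable_fun setT h.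
  by apply: emeasurable_funM => //; apply/measurable_EFinP; exact: measurableT_comp.
pose g (x : RT) (z : RT * RT) := h (x, (z.2 + (x - z.1) ^+ 2)%R).
have g0 x z : 0 <= g x z by exact: h0.
have mg : measurable_fun setT (fun w : (RT * RT) * RT => g w.2 w.1).
  by apply: (measurableT_comp mh); mfun.
pose K (w : (RT * RT) * (RT * RT)) := g w.2.1 w.1 * g w.2.2 w.1.
have K0 w : 0 <= K w by rewrite mule_ge0.
have mK : measurable_fun setT K.
  by apply: emeasurable_funM; apply: (measurableT_comp mh); mfun.
(* The q-th power is the power q / 2 of the square, and the square of an integral over x is an
   integral over pairs. *)
have sqE z : parab1 h z.1 z.2 `^ q = (\int[leb \x leb]_X K (z, X)) `^ (q / 2).
  rewrite fubini_tonelli1//; last exact: measurable_fun_pair2.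
  rewrite /fubini_F/=.
  have -> : \int[leb]_x \int[leb]_y K (z, (x, y)) = parab1 h z.1 z.2 `^ 2.
    have mgz : measurable_fun setT (fun x => g x z) by exact: (measurable_fun_pair2 z mg).
    transitivity (\int[leb]_x (g x z * parab1 h z.1 z.2)).
      by apply: eq_integral => x _; rewrite /K/= ge0_integralZl.
    rewrite ge0_integralZr//; last exact: parab1_ge0.
    have -> : (2 = 1 + 1 :> R)%R by ring.
    by rewrite ge0_poweRD ?parab1_ge0// poweRe1// parab1_ge0.
  by rewrite -poweRrM mulrCA mulfV// mulr1.
have -> : \int[leb]_y \int[leb]_u (parab1 h y u `^ q) =
    \int[leb \x leb]_z ((\int[leb \x leb]_X K (z, X)) `^ (q / 2)).
  rewrite -[LHS](fubini_tonelli1 (fun z : RT * RT => parab1 h z.1 z.2 `^ q))//.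
    by apply: eq_integral => z _; exact: sqE.
  by apply: measurable_fun_poweR; exact: measurable_parab1.
pose leb2 := sigma_finite_product leb leb.
apply: (le_trans (@minkowski_integral R _ _ _ _ leb2 leb2 K _ r1 mK K0)).
rewrite -poweR_EFin; apply: lee_poweR; [exact: ltW|by apply: integral_ge0|].
apply: le_trans (hls G mG G0 _); last first.
  have -> : (2 / (2 - 2 / q) = q / (q - 1))%R; last by [].
  by field; repeat (apply/andP; split); rewrite gt_eqF//; lra.
pose N (w : RT * RT) := (\int[leb2]_z (K (z, w) `^ (q / 2))) `^ (q / 2)^-1.
have mKr : measurable_fun setT (fun w => K w `^ (q / 2)) by exact: measurable_fun_poweR.
have mN : measurable_fun setT N.
  by apply: measurable_fun_poweR; exact: (@measurable_fun_fubini_tonelli_G _ _ _ _ R leb2 _ mKr).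
pose M (w : RT * RT) := (G w.1 * G w.2)%:E * riesz (2 / q) (w.1 - w.2)%R.
have mM : measurable_fun setT M.
  apply: emeasurable_funM.
    by apply/measurable_EFinP; apply: measurable_funM; exact: measurableT_comp.
  by apply: (measurableT_comp (measurable_riesz _)); mfun.
rewrite [leLHS](_ : _ = \int[leb]_x \int[leb]_x' N (x, x')); last first.
  exact: (@fubini_tonelli1 _ _ _ _ R leb leb N mN (fun w => poweR_ge0 _ _)).
apply: (ge0_le_integral_iter leb leb mN mM (fun w => poweR_ge0 _ _)) => x x'.
(* On the diagonal the bound is +oo unless G x = 0, and then both sides vanish. *)
rewrite /M/=; have [<-|xx'] := eqVneq x x'.
  rewrite subrr /riesz eqxx; have [Gx0|Gx0] := eqVneq (G x) 0%R; last first.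
    by rewrite gt0_muley ?leey// lte_fin mulr_gt0// lt_neqAle eq_sym Gx0 G0.
  rewrite Gx0 mul0r mul0e /N integral0_eq ?poweR0r ?invr_neq0 ?gt_eqF//.
  by move=> z _; rewrite /K/g/h/= Gx0 !mul0e poweR0r// gt_eqF.
pose A x t := h (x, t) `^ (q / 2).
have A0 x1 t : 0 <= A x1 t by exact: poweR_ge0.
have mA x1 : measurable_fun setT (A x1).
  by apply: measurable_fun_poweR; exact: measurable_fun_pair2.
have IA x1 : \int[leb]_t A x1 t <= (G x1 `^ (q / 2))%:E.
  rewrite [leLHS](_ : _ = (G x1 `^ (q / 2))%:E * \int[leb]_t (k (x1, t) `^ (q / 2))).
    by rewrite -[leRHS]mule1; apply: lee_wpmul2l => //; rewrite lee_fin powR_ge0.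
  rewrite -ge0_integralZl//; last 2 first.
  - by apply: measurable_fun_poweR; exact: measurable_fun_pair2.
  - by rewrite lee_fin powR_ge0.
  by apply: eq_integral => t _; rewrite /A/h/= poweRM// lee_fin.
have IK : \int[leb \x leb]_z (K (z, (x, x')) `^ (q / 2)) <=
    ((`|x - x'|^-1) * (G x `^ (q / 2) * G x' `^ (q / 2)))%:E.
  rewrite (fubini_tonelli1 (fun z => K (z, (x, x')) `^ (q / 2)))//; last first.
    exact: (measurable_fun_pair1 (x, x') mKr).
  rewrite /fubini_F/= [leLHS](_ : _ = \int[leb]_y \int[leb]_u
      (A x (u + (x - y) ^+ 2)%R * A x' (u + (x' - y) ^+ 2)%R)); last first.
    by apply: eq_integral => y _; apply: eq_integral => u _; rewrite /K/g/A/= poweRM.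
  rewrite integral_two_parabolas//; do ?by move=> t; exact: poweR_ge0.
  rewrite 2!EFinM; apply: lee_pmul.
  - by rewrite lee_fin invr_ge0.
  - by apply: mule_ge0; apply: integral_ge0.
  - rewrite lee_fin lef_pV2 ?posrE ?normr_gt0 ?mulf_neq0// ?subr_eq0//.
    by rewrite normrM ler_peMl// ger0_norm// ler1n.
  - by apply: lee_pmul => //; apply: integral_ge0.
rewrite /N; apply: (@le_trans _ _ (((`|x - x'|^-1) *
    (G x `^ (q / 2) * G x' `^ (q / 2)))%:E `^ (q / 2)^-1)).
  apply: lee_poweR; [by rewrite invr_ge0 ltW|exact: integral_ge0|exact: IK].
rewrite poweR_EFin /riesz subr_eq0 (negbTE xx') -EFinM lee_fin.
rewrite -powRM//; have gg0 : (0 <= G x * G x')%R by exact: mulr_ge0.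
move: (G x * G x')%R gg0 => gg gg0.
rewrite powRM ?invr_ge0 ?powR_ge0// -powRrM mulfV ?gt_eqF// powRr1//.
rewrite mulrC ler_wpM2l//.
by rewrite -[(`|x - x'|^-1)%R]powR_inv1// -powRrM mulN1r invf_div.
Qed.

End one_dimensional_operator.

(* Mixed norms are indexed by reciprocal exponents: this is the norm of
   L^(1/rho)(mu; L^(1/beta)(du)). *)
Definition mixed_norm {R : realType} d (X : measurableType d)
    (mu : {measure set X -> \bar R}) (rho beta : R)
    (h : X * measurableTypeR R -> \bar R) : \bar R :=
  (\int[mu]_x (\int[@lebesgue_measure R]_u (h (x, u) `^ beta^-1)) `^ (beta / rho)) `^ rho.

Section one_dimensional_estimate.
Context {R : realType}.
Local Notation leb := (@lebesgue_measure R).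
Local Notation RT := (measurableTypeR R).
Lemma integral_parab1 (h : RT * RT -> \bar R) (y : RT) :
  measurable_fun setT h -> (forall z, 0 <= h z) ->
  \int[leb]_u parab1 h y u = \int[leb]_x \int[leb]_u h (x, u).
Proof.
move=> mh h0; have mk : measurable_fun setT
    (fun z : RT * RT => h (z.2, (z.1 + (z.2 - y) ^+ 2)%R)).
  by apply: (measurableT_comp mh); mfun.
rewrite [LHS](fubini_tonelli _ mk (fun z => h0 _)).
apply: eq_integral => x _ /=; apply: (@integral_shift _ _ (fun u => h (x, u))) => //.
exact: measurable_fun_pair2.
Qed.

(* The estimate parab1_diagonal is interpolated, by Hoelder's inequality,
   with the trivial bound of parab1 from L^1(dx du) to L^oo(dy; L^1(du)). *)
Lemma parab1_normalized (ro beta : R) : (0 < ro)%R -> (ro <= beta)%R ->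
  (beta + ro < 1)%R -> exists2 C : R, (0 <= C)%R &
  forall (G : RT -> R) (k : RT * RT -> \bar R),
  measurable_fun setT G -> (forall x, 0 <= G x)%R ->
  measurable_fun setT k -> (forall z, 0 <= k z) ->
  \int[leb]_x (G x `^ (1 - ro)^-1)%:E <= 1 ->
  (forall x, \int[leb]_u (k (x, u) `^ (beta + ro)^-1) <= 1) ->
  \int[leb]_y ((\int[leb]_u (parab1 (fun z => (G z.1)%:E * k z) y u `^ beta^-1))
    `^ (beta / ro)) <= C%:E.
Proof.
move=> ro0 ro_beta beta1.
have beta0 : (0 < beta)%R by exact: lt_le_trans ro_beta.
have br0 : (0 < beta + ro)%R by exact: addr_gt0.
have ro1 : (0 < 1 - ro)%R by lra.
(* Interpolating the reciprocal exponents (1/q, 1/q) with (0, 1) at weight [th] gives ro = th / q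
   and beta = th / q + 1 - th, which determines [th] and [q]. The hypothesis beta + ro < 1 is
   exactly q > 2. *)
pose th := (1 - beta + ro)%R; pose q := (th / ro)%R.
have th0 : (0 < th)%R by rewrite /th; lra.
have th1 : (th <= 1)%R by rewrite /th; lra.
have q2 : (2 < q)%R by rewrite /q ltr_pdivlMr// /th; lra.
have q0 : (0 < q)%R by lra.
have [C C0 HC] := parab1_diagonal q2.
exists C => // G k mG G0 mk k0 G1 k1.
(* [g0] and [g1] are inputs for the two endpoint estimates. Their powers of G and k turn the two
   given normalisations into those of the endpoints, and the geometric mean g1^th g0^(1 - th) is
   again G k. *)
pose g0 (z : RT * RT) := (G z.1 `^ (1 - ro)^-1)%:E * k z `^ (beta + ro)^-1.
pose G' x := (G x `^ ((1 - ro)^-1 * ((q - 1) / q)))%R.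
pose k' z := k z `^ ((beta + ro)^-1 * (2 / q)).
pose g1 (z : RT * RT) := (G' z.1)%:E * k' z.
have mG' : measurable_fun setT G' by exact: (measurableT_comp (measurable_powR _)).
have mk' : measurable_fun setT k' by exact: measurable_fun_poweR.
have g00 z : 0 <= g0 z.
  by apply: mule_ge0; [rewrite lee_fin powR_ge0|exact: poweR_ge0].
have g10 z : 0 <= g1 z.
  by apply: mule_ge0; [rewrite lee_fin powR_ge0|exact: poweR_ge0].
have mg0 : measurable_fun setT g0.
  apply: emeasurable_funM; last exact: measurable_fun_poweR.
  apply/measurable_EFinP; apply: (measurableT_comp (measurable_powR _)).
  exact: measurableT_comp.
have mg1 : measurable_fun setT g1.
  by apply: emeasurable_funM => //; apply/measurable_EFinP; exact: measurableT_comp.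
have q1n : (q - 1 != 0)%R by rewrite gt_eqF//; lra.
have B1 : \int[leb]_y \int[leb]_u (parab1 g1 y u `^ q) <= C%:E.
  have e1 : ((q - 1) / q * (q / (q - 1)) = 1)%R by field; rewrite q1n gt_eqF.
  have e2 : (2 / q * (q / 2) = 1)%R by field; rewrite gt_eqF.
  apply: HC; [exact: mG'|by move=> x; exact: powR_ge0|exact: mk'|
    by move=> z; exact: poweR_ge0| |].
  - rewrite [leLHS](_ : _ = \int[leb]_x (G x `^ (1 - ro)^-1)%:E); [exact: G1|].
    by apply: eq_integral => x _; rewrite -powRrM -mulrA e1 mulr1.
  - move=> x; rewrite [leLHS](_ : _ = \int[leb]_u (k (x, u) `^ (beta + ro)^-1)); [exact: k1|].
    by apply: eq_integral => u _; rewrite -poweRrM -mulrA e2 mulr1.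
have B0 y : \int[leb]_u parab1 g0 y u <= 1.
  rewrite integral_parab1//; apply: le_trans G1; apply: ge0_le_integral => //.
  - by move=> x _; exact: integral_ge0.
  - exact: (measurable_fun_fubini_tonelli_F g0).
  - by apply/measurable_EFinP; exact: (measurableT_comp (measurable_powR _)).
  - move=> x _; rewrite /g0/= ge0_integralZl//; last 2 first.
    + by apply: measurable_fun_poweR; exact: measurable_fun_pair2.
    + by rewrite lee_fin powR_ge0.
    by rewrite -[leRHS]mule1; apply: lee_wpmul2l => //; rewrite lee_fin powR_ge0.
have prodE z : (G z.1)%:E * k z = g1 z `^ th * g0 z `^ (1 - th).
  have Gz : 0 <= (G z.1)%:E by rewrite lee_fin.
  have qn : q != 0%R by rewrite gt_eqF.
  rewrite /g1 /g0 /G' /k' -!poweR_EFin !poweRM// muleACA -!poweRrM -!ge0_poweRD//.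
  - congr (_ * _); rewrite -[LHS]poweRe1//; congr (_ `^ _).
      by rewrite /q /th; field; repeat (apply/andP; split); rewrite gt_eqF//; lra.
    by rewrite /q /th; field; repeat (apply/andP; split); rewrite gt_eqF//; lra.
  - by rewrite !mulr_ge0 ?invr_ge0//; lra.
  - by rewrite !mulr_ge0 ?invr_ge0//; lra.
  - by rewrite !mulr_ge0 ?invr_ge0//; lra.
  - by rewrite !mulr_ge0 ?invr_ge0//; lra.
have mh : measurable_fun setT (fun z : RT * RT => (G z.1)%:E * k z).
  by apply: emeasurable_funM => //; apply/measurable_EFinP; exact: measurableT_comp.
have h0 (z : RT * RT) : 0 <= (G z.1)%:E * k z by rewrite mule_ge0// lee_fin.
have msl (f : RT * RT -> \bar R) y u : measurable_fun setT f ->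
    measurable_fun setT (fun x : RT => f (x, (u + (x - y) ^+ 2)%R)).
  by move=> mf; apply: (measurableT_comp mf); mfun.
have point y u : parab1 (fun z => (G z.1)%:E * k z) y u <=
    parab1 g1 y u `^ th * parab1 g0 y u `^ (1 - th).
  rewrite /parab1; under eq_integral do rewrite prodE.
  apply: (@geometric_hoelder _ _ _ leb (fun x => g1 (x, (u + (x - y) ^+ 2)%R))
    (fun x => g0 (x, (u + (x - y) ^+ 2)%R))) => //; [|exact: msl..].
  by rewrite th1 ltW.
have mP (f : RT * RT -> \bar R) y : measurable_fun setT f -> (forall z, 0 <= f z) ->
    measurable_fun setT (parab1 f y).
  by move=> mf f0; exact: (measurable_fun_pair2 y (measurable_parab1 mf f0)).
apply: le_trans B1; apply: ge0_le_integral => //.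
- apply: measurable_fun_poweR.
  apply: (@measurable_fun_fubini_tonelli_F _ _ _ _ R leb
    (fun z : RT * RT => parab1 (fun z => (G z.1)%:E * k z) z.1 z.2 `^ beta^-1)) => //.
  by apply: measurable_fun_poweR; exact: measurable_parab1.
- apply: (@measurable_fun_fubini_tonelli_F _ _ _ _ R leb
    (fun z : RT * RT => parab1 g1 z.1 z.2 `^ q)) => //.
  by apply: measurable_fun_poweR; exact: measurable_parab1.
move=> y _; rewrite -[leRHS](@poweRVK _ _ (beta / ro)); last 2 first.
- by apply: integral_ge0.
- by rewrite gt_eqF// divr_gt0.
apply: lee_poweR; [by rewrite divr_ge0// ltW|by apply: integral_ge0|].
(* Since th / beta = q s and (1 - th) / beta = 1 - s, a second use of Hoelder's inequality, now in
   u, separates the endpoints. Here ro <= beta is needed for s <= 1, and the factor of [g0] is at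
   most 1 uniformly in y. *)
rewrite invf_div; set s := (ro / beta)%R.
have s01 : (0 <= s <= 1)%R by rewrite divr_ge0 ?(ltW ro0) ?(ltW beta0)//= ler_pdivrMr// mul1r.
apply: (@le_trans _ _ ((\int[leb]_u (parab1 g1 y u `^ q)) `^ s *
    (\int[leb]_u parab1 g0 y u) `^ (1 - s))); last first.
  rewrite -[leRHS]mule1; apply: lee_wpmul2l; first exact: poweR_ge0.
  rewrite -[leRHS](poweR1r (1 - s)%R); apply: lee_poweR; last exact: B0.
    by case/andP: s01; rewrite subr_ge0.
  by apply: integral_ge0 => u _; exact: parab1_ge0.
apply: (@le_trans _ _ (\int[leb]_u ((parab1 g1 y u `^ q) `^ s * parab1 g0 y u `^ (1 - s)))).
  apply: ge0_le_integral => //.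
  - by apply: measurable_fun_poweR; exact: mP.
  - apply: emeasurable_funM; apply: measurable_fun_poweR; last exact: mP.
    by apply: measurable_fun_poweR; exact: mP.
  move=> u _; apply: (@le_trans _ _ ((parab1 g1 y u `^ th * parab1 g0 y u `^ (1 - th)) `^ beta^-1)).
    by apply: lee_poweR => //; [rewrite invr_ge0 ltW|exact: parab1_ge0].
  rewrite poweRM// -!poweRrM le_eqVlt; apply/orP; left; apply/eqP; congr (_ `^ _ * _ `^ _).
    by rewrite /q /s; field; rewrite !gt_eqF.
  by rewrite /th /s; field; rewrite gt_eqF.
apply: geometric_hoelder => //.
- by apply: measurable_fun_poweR; exact: mP.
- exact: mP.
- by move=> u; exact: parab1_ge0.
Qed.

End one_dimensional_estimate.

Lemma mixed_normZ {R : realType} d (X : measurableType d)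
    (mu : {measure set X -> \bar R}) (ro beta c : R)
    (h : X * measurableTypeR R -> \bar R) : (0 < ro)%R -> (0 < beta)%R -> (0 <= c)%R ->
  (forall z, 0 <= h z) -> measurable_fun setT h ->
  mixed_norm mu ro beta (fun z => c%:E * h z) = c%:E * mixed_norm mu ro beta h.
Proof.
move=> ro0 beta0 c0 h0 mh; rewrite /mixed_norm.
have mhb : measurable_fun setT (fun z => h z `^ beta^-1) by exact: measurable_fun_poweR.
have cE : 0 <= c%:E by rewrite lee_fin.
have -> : \int[mu]_x (\int[lebesgue_measure]_u ((c%:E * h (x, u)) `^ beta^-1)) `^ (beta / ro) =
    \int[mu]_x (c%:E `^ ro^-1 *
      (\int[lebesgue_measure]_u (h (x, u) `^ beta^-1)) `^ (beta / ro)).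
  apply: eq_integral => x _.
  rewrite (_ : \int[_]_u _ = c%:E `^ beta^-1 *
      \int[lebesgue_measure]_u (h (x, u) `^ beta^-1)); last first.
    rewrite -ge0_integralZl//; last exact: (measurable_fun_pair2 x mhb).
    by apply: eq_integral => u _; rewrite poweRM.
  rewrite poweRM//; last exact: integral_ge0.
  by rewrite -poweRrM mulrA mulVf ?mul1r// gt_eqF.
rewrite ge0_integralZl//; last first.
  apply: measurable_fun_poweR.
  exact: (@measurable_fun_fubini_tonelli_F _ _ _ _ R lebesgue_measure _ mhb).
by rewrite poweRM ?integral_ge0// poweRVK// gt_eqF.
Qed.

Section one_dimensional_normed.
Context {R : realType}.
Local Notation leb := (@lebesgue_measure R).
Local Notation RT := (measurableTypeR R).

Let gauss := @gauss_fun R.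

Let gauss_pow (p : R) : (1 <= p)%R ->
  \int[leb]_x (gauss x `^ p)%:E <= (Num.sqrt pi)%:E.
Proof.
move=> p1; rewrite -integralT_gauss; apply: ge0_le_integral => //.
- by move=> x _; rewrite lee_fin powR_ge0.
- apply/measurable_EFinP; apply: (measurableT_comp (measurable_powR _)).
  exact: measurable_gauss_fun.
- by apply/measurable_EFinP; exact: measurable_gauss_fun.
- move=> x _; rewrite lee_fin ge1r_powR// gauss_fun_le1 andbT.
  exact: expR_gt0.
Qed.

Let gauss_gt0 x : (0 < gauss x)%R. Proof. exact: expR_gt0. Qed.

(* The x-norms of h are bounded from below by a small Gaussian, so that
   h can be divided by them. *)
Let parab1_bounded (ro beta : R) : (0 < ro)%R -> (ro <= beta)%R ->
  (beta + ro < 1)%R -> exists2 C : R, (0 < C)%R &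
  forall (h : RT * RT -> \bar R) (L : R),
  measurable_fun setT h -> (forall z, 0 <= h z) -> (0 < L)%R ->
  mixed_norm leb (1 - ro) (beta + ro) h < L%:E ->
  mixed_norm leb ro beta (fun z => parab1 h z.1 z.2) <= (C * L)%:E.
Proof.
move=> ro0 ro_beta beta1.
have beta0 : (0 < beta)%R by exact: lt_le_trans ro_beta.
have br0 : (0 < beta + ro)%R by exact: addr_gt0.
have ro1 : (0 < 1 - ro)%R by lra.
have [C C0 HC] := parab1_normalized ro0 ro_beta beta1.
(* Adding 1 keeps the constant positive when [C] is 0. *)
exists ((C + 1) `^ ro)%R; first by rewrite powR_gt0// ltr_wpDl.
move=> h L mh h0 L0 hL.
set p := ((1 - ro)^-1)%R; set a := ((beta + ro)^-1)%R.
have p1 : (1 <= p)%R by rewrite /p invf_ge1//; lra.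
have p0 : (0 < p)%R by lra.
have a0 : (0 < a)%R by rewrite invr_gt0.
pose g x := (\int[leb]_u (h (x, u) `^ a)) `^ a^-1.
have mha : measurable_fun setT (fun z => h z `^ a) by exact: measurable_fun_poweR.
have mg : measurable_fun setT g.
  by apply: measurable_fun_poweR; exact: (@measurable_fun_fubini_tonelli_F _ _ _ _ R leb _ mha).
have g0 x : 0 <= g x by exact: poweR_ge0.
pose M := \int[leb]_x (g x `^ p).
have M0 : 0 <= M by apply: integral_ge0.
have ML : M < (L `^ p)%:E.
  have hE : mixed_norm leb (1 - ro) (beta + ro) h = M `^ p^-1.
    rewrite /mixed_norm /p invrK; congr (_ `^ _); apply: eq_integral => x _.
    by rewrite /g -poweRrM invrK.
  rewrite ltNge; apply/negP => LM; move: hL; apply/negP; rewrite -leNgt hE.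
  rewrite -(@poweRK _ L%:E p) ?lee_fin ?(ltW L0)//; last by rewrite gt_eqF.
  by apply: lee_poweR; rewrite ?poweR_EFin ?lee_fin ?powR_ge0 ?invr_ge0// ltW.
(* The strict bound on the norm leaves room for a multiple of the Gaussian without exceeding L. *)
have [e e0 He] : exists2 e : R, (0 < e)%R & M + (e `^ p)%:E * (Num.sqrt pi)%:E <= (L `^ p)%:E.
  have Mfin : M \is a fin_num by rewrite ge0_fin_numE// (lt_trans ML)// ltry.
  move: ML; rewrite -(fineK Mfin) lte_fin; set m := fine M => mL.
  pose t := ((L `^ p - m) / (Num.sqrt pi + 1))%R.
  have s1 : (0 < Num.sqrt pi + 1 :> R)%R by rewrite ltr_wpDl// sqrtr_ge0.
  have t0 : (0 < t)%R by rewrite divr_gt0// subr_gt0.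
  exists (t `^ p^-1)%R; first exact: powR_gt0.
  rewrite -powRrM mulVf ?gt_eqF// powRr1 ?(ltW t0)// -EFinM -EFinD lee_fin.
  rewrite -lerBrDl /t mulrAC ler_pdivrMr// ler_wpM2l//; first by rewrite subr_ge0 ltW.
  by rewrite lerDl.
pose G1 x := Num.max (fine (g x)) (e * gauss x)%R.
have G10 x : (0 < G1 x)%R by rewrite lt_max mulr_gt0 ?orbT.
pose G x := (G1 x / L)%R.
(* Where the fiber norm is infinite [k] is set to 0. This happens only for x in a null set, since
   g^p is integrable, so L G k still has the same image as h. *)
pose k (z : RT * RT) := (G1 z.1 `^ (-1))%:E * (if g z.1 < +oo then h z else 0).
have mG1 : measurable_fun setT G1.
  apply: measurable_maxr; first exact: measurableT_comp.
  by apply: measurable_funM => //; exact: measurable_gauss_fun.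
have G0 x : (0 <= G x)%R by rewrite divr_ge0// ltW.
have mG : measurable_fun setT G by exact: measurable_funM.
have k0 z : 0 <= k z.
  by apply: mule_ge0; [rewrite lee_fin powR_ge0|case: ifP].
have mif : measurable_fun setT (fun z : RT * RT => if g z.1 < +oo then h z else 0).
  apply: measurable_fun_ifT => //; apply: measurable_fun_lte => //.
  exact: (measurableT_comp mg).
have mk : measurable_fun setT k.
  apply: emeasurable_funM => //; apply/measurable_EFinP.
  apply: (measurableT_comp (measurable_powR _)); exact: (measurableT_comp mG1).
have GL : \int[leb]_x (G x `^ p)%:E <= 1.
  have Lp : (L `^ (- p))%:E * (L `^ p)%:E = 1 :> \bar R.
    by rewrite -EFinM -powRD ?addNr ?powRr0// (gt_eqF L0) implybT.
  rewrite -Lp; apply: (@le_trans _ _ ((L `^ (- p))%:E *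
      (M + (e `^ p)%:E * \int[leb]_x (gauss x `^ p)%:E))); last first.
    apply: lee_wpmul2l; first by rewrite lee_fin powR_ge0.
    apply: le_trans He; apply: leeD => //; apply: lee_wpmul2l.
      by rewrite lee_fin powR_ge0.
    exact: gauss_pow.
  have mgp : measurable_fun setT (fun x => (gauss x `^ p)%:E).
    apply/measurable_EFinP; apply: (measurableT_comp (measurable_powR _)).
    exact: measurable_gauss_fun.
  have gp0 x : 0 <= (gauss x `^ p)%:E by rewrite lee_fin powR_ge0.
  have ep0 : 0 <= (e `^ p)%:E by rewrite lee_fin powR_ge0.
  have mgp' : measurable_fun setT (fun x => g x `^ p) by exact: measurable_fun_poweR.
  rewrite /M -ge0_integralZl//.
  rewrite -ge0_integralD//; last 2 first.
  - by move=> x _; exact: mule_ge0.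
  - exact: emeasurable_funM.
  rewrite -ge0_integralZl//; last 3 first.
  - by apply: emeasurable_funD => //; exact: emeasurable_funM.
  - by move=> x _; apply: adde_ge0 => //; exact: mule_ge0.
  - by rewrite lee_fin powR_ge0.
  apply: ge0_le_integral => //.
  - by move=> x _; rewrite lee_fin powR_ge0.
  - by apply/measurable_EFinP; exact: (measurableT_comp (measurable_powR _)).
  - apply: emeasurable_funM => //; apply: emeasurable_funD => //.
    exact: emeasurable_funM.
  move=> x _; rewrite /G powRM ?invr_ge0 ?(ltW L0) ?(ltW (G10 x))// mulrC EFinM.
  rewrite -powR_inv1 ?(ltW L0)// -powRrM mulN1r.
  apply: lee_wpmul2l; first by rewrite lee_fin powR_ge0.
  rewrite /G1; have [_|_] := leP (fine (g x)) (e * gauss x)%R.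
    rewrite powRM ?(ltW e0) ?(ltW (gauss_gt0 x))// EFinM.
    by apply: leeDr; exact: poweR_ge0.
  apply: (@le_trans _ _ (g x `^ p)); last by apply: leeDl; exact: mule_ge0.
  case: (g x) (g0 x) => [r|_|//] //=.
  by rewrite gt_eqF// leey.
have k1 x : \int[leb]_u (k (x, u) `^ a) <= 1.
  rewrite /k/=; have [gx|gx] := boolP (g x < +oo); last first.
    by rewrite integral0_eq// => u _; rewrite mule0 poweR0r// gt_eqF.
  under eq_integral => u _ do rewrite poweRM ?lee_fin ?powR_ge0//.
  rewrite ge0_integralZl//; last exact: (measurable_fun_pair2 x mha).
  have -> : \int[leb]_u (h (x, u) `^ a) = g x `^ a.
    by rewrite /g poweRVK ?gt_eqF//; exact: integral_ge0.
  have gfin : g x \is a fin_num by rewrite ge0_fin_numE.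
  have fg0 : (0 <= fine (g x))%R by exact: fine_ge0.
  rewrite -(fineK gfin) !poweR_EFin -EFinM lee_fin -powRM ?powR_ge0//.
  have H1 : (G1 x `^ (-1) * fine (g x) <= 1)%R.
    rewrite powR_inv1 ?(ltW (G10 x))// ler_pdivrMl// mulr1.
    by rewrite /G1 le_max lexx.
  have := @ge0_ler_powR R a (ltW a0) (G1 x `^ (-1) * fine (g x))%R 1%R.
  by rewrite !nnegrE mulr_ge0 ?powR_ge0// powR1; apply.
have msl (f : RT * RT -> \bar R) y u : measurable_fun setT f ->
    measurable_fun setT (fun x : RT => f (x, (u + (x - y) ^+ 2)%R)).
  by move=> mf; apply: (measurableT_comp mf); mfun.
have mGk : measurable_fun setT (fun z : RT * RT => (G z.1)%:E * k z).
  by apply: emeasurable_funM => //; apply/measurable_EFinP; exact: measurableT_comp.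
have Gk0 (z : RT * RT) : 0 <= (G z.1)%:E * k z by rewrite mule_ge0// lee_fin.
have hE y u : parab1 h y u = L%:E * parab1 (fun z => (G z.1)%:E * k z) y u.
  rewrite /parab1 -ge0_integralZl//; last 2 first.
  - exact: (msl _ y u mGk).
  - by rewrite lee_fin ltW.
  apply: ae_eq_integral => //; first exact: msl.
    by apply: emeasurable_funM => //; exact: (msl _ y u mGk).
  have : leb.-integrable setT (fun x => g x `^ p).
    apply/integrableP; split; first exact: measurable_fun_poweR.
    rewrite (_ : \int[leb]_x `|g x `^ p| = M); first by rewrite (lt_trans ML)// ltry.
    by apply: eq_integral => x _; rewrite gee0_abs.
  move=> /(integrable_ae measurableT); apply: filterS => x /(_ I) gx _.
  rewrite /k/= ifT; last first.
    apply: (@lty_poweRy _ _ p); first by rewrite gt_eqF.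
    by rewrite -ge0_fin_numE//; exact: poweR_ge0.
  rewrite !muleA -!EFinM /G powR_inv1 ?(ltW (G10 x))//.
  by rewrite mulrCA mulfV ?gt_eqF// mulr1 mulfV ?gt_eqF// mul1e.
have -> : mixed_norm leb ro beta (fun z => parab1 h z.1 z.2) =
    L%:E * mixed_norm leb ro beta (fun z => parab1 (fun z => (G z.1)%:E * k z) z.1 z.2).
  rewrite -(mixed_normZ leb ro0 beta0 (ltW L0) (fun z => parab1_ge0 _ _ Gk0)
    (measurable_parab1 mGk Gk0)).
  by congr mixed_norm; apply/funext => z; exact: hE.
rewrite mulrC EFinM; apply: lee_wpmul2l; first by rewrite lee_fin ltW.
rewrite -poweR_EFin; apply: lee_poweR; first exact: ltW.
  by apply: integral_ge0.
by apply: le_trans (HC G k mG G0 mk k0 GL k1) _; rewrite lee_fin lerDl.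
Qed.

(** The bound for norms strictly below L is used with L = N + e / C for arbitrary e > 0. This
    includes N = 0, when the input could not be normalised. *)
Theorem parab1_mixed_norm (ro beta : R) : (0 < ro)%R -> (ro <= beta)%R ->
  (beta + ro < 1)%R -> exists2 C : R, (0 < C)%R &
  forall h : RT * RT -> \bar R, measurable_fun setT h -> (forall z, 0 <= h z) ->
  mixed_norm leb ro beta (fun z => parab1 h z.1 z.2) <=
  C%:E * mixed_norm leb (1 - ro) (beta + ro) h.
Proof.
move=> ro0 ro_beta beta1; have [C C0 HC] := parab1_bounded ro0 ro_beta beta1.
exists C => // h mh h0; set N := mixed_norm leb (1 - ro) _ _.
have N0 : 0 <= N by exact: poweR_ge0.
have [Ny|Nn] := eqVneq N +oo; first by rewrite Ny gt0_muley ?lte_fin// leey.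
have Nfin : N \is a fin_num by rewrite ge0_fin_numE// ltey.
apply/lee_addgt0Pr => e e0.
have eC : (0 < e / C)%R by exact: divr_gt0.
have fN0 : (0 <= fine N)%R by exact: fine_ge0.
have := HC h (fine N + e / C)%R mh h0 (ltr_wpDl fN0 eC).
rewrite -/N -{1}(fineK Nfin) lte_fin ltrDl => /(_ eC).
rewrite mulrDr EFinD EFinM fineK// => /le_trans; apply.
by rewrite mulrCA mulfV ?mulr1// gt_eqF.
Qed.

End one_dimensional_normed.

(** * The parabolic operator in several dimensions *)

Section euclid_integral.
Context {R : realType}.
Local Notation leb := (@lebesgue_measure R).
Local Notation RT := (measurableTypeR R).

Lemma integral_euclid0 (f : euclid R 0 -> \bar R) :
  measurable_fun setT f -> \int[lebesgue_euclid 0]_x f x = f [tuple].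
Proof. by move=> mf; rewrite integral_dirac// diracT mul1e. Qed.

Lemma integral_euclidS m (f : euclid R m.+1 -> \bar R) :
  measurable_fun setT f -> (forall x, 0 <= f x) ->
  \int[lebesgue_euclid m.+1]_x f x =
  \int[leb]_t \int[lebesgue_euclid m]_x f (consE (t, x)).
Proof.
move=> mf f0.
transitivity (\int[leb \x lebesgue_euclid m]_z f (consE z)); last first.
  rewrite fubini_tonelli1//.
  by apply: (measurableT_comp mf); exact: measurable_consE.
exact: (@ge0_integral_pushforward _ _ _ _ R _ (@measurable_consE R m)
  (leb \x lebesgue_euclid m) setT f measurableT mf (fun x _ => f0 x)).
Qed.

Lemma dist2_cons m (s t : RT) (x y : euclid R m) :
  dist2 (consE (s, x)) (consE (t, y)) = ((t - s) ^+ 2 + dist2 x y)%R.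
Proof.
rewrite /dist2 big_ord_recl !tnth0; congr (_ + _)%R.
by apply: eq_bigr => i _; rewrite !tnthS.
Qed.

Lemma measurable_dist2 m d (X : measurableType d) (f g : X -> euclid R m) :
  measurable_fun setT f -> measurable_fun setT g ->
  measurable_fun setT (fun x => dist2 (f x) (g x)).
Proof.
move=> mf mg; rewrite /dist2; apply: measurable_sum => i.
apply: measurable_funX; apply: measurable_funB.
- exact: (measurableT_comp (measurable_tnth i) mg).
- exact: (measurableT_comp (measurable_tnth i) mf).
Qed.

Lemma measurable_consE_comp m d (X : measurableType d) (f : X -> RT) (g : X -> euclid R m) :
  measurable_fun setT f -> measurable_fun setT g ->
  measurable_fun setT (fun x => consE (f x, g x)).
Proof.
move=> mf mg; apply: (measurableT_comp (@measurable_consE R m)).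
exact: measurable_fun_pair.
Qed.

Definition parab m (h : euclid R m * RT -> \bar R) (y : euclid R m) (u : RT) : \bar R :=
  \int[lebesgue_euclid m]_x h (x, (u + dist2 x y)%R).

Lemma parab_ge0 m (h : euclid R m * RT -> \bar R) y u :
  (forall z, 0 <= h z) -> 0 <= parab h y u.
Proof. by move=> h0; exact: integral_ge0. Qed.

Lemma measurable_parab_param m d (X : measurableType d)
    (h : X -> euclid R m * RT -> \bar R) (Y : X -> euclid R m) (U : X -> RT) :
  measurable_fun setT (fun z : X * (euclid R m * RT) => h z.1 z.2) ->
  (forall a z, 0 <= h a z) ->
  measurable_fun setT Y -> measurable_fun setT U ->
  measurable_fun setT (fun a => parab (h a) (Y a) (U a)).
Proof.
move=> mh h0 mY mU.
apply: (@measurable_fun_fubini_tonelli_F _ _ _ _ R (lebesgue_euclid m)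
  (fun w : X * euclid R m => h w.1 (w.2, (U w.1 + dist2 w.2 (Y w.1))%R))) => //.
apply: (measurableT_comp (f := fun z : X * (euclid R m * RT) => h z.1 z.2)
  (g := fun w : X * euclid R m => (w.1, (w.2, (U w.1 + dist2 w.2 (Y w.1))%R)))) => //.
apply: measurable_fun_pair; first exact: measurable_fst.
apply: measurable_fun_pair; first exact: measurable_snd.
apply: measurable_funD; first by apply: (measurableT_comp mU); exact: measurable_fst.
apply: measurable_dist2; first exact: measurable_snd.
by apply: (measurableT_comp mY); exact: measurable_fst.
Qed.

Lemma measurable_parab m (h : euclid R m * RT -> \bar R) :
  measurable_fun setT h -> (forall z, 0 <= h z) ->
  measurable_fun setT (fun z : euclid R m * RT => parab h z.1 z.2).
Proof.
move=> mh h0; apply: (@measurable_parab_param m _ _ (fun _ => h)) => //.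
exact: (measurableT_comp mh).
Qed.

(* Since dist2 is a sum over coordinates, parab is a composition of
   one-dimensional operators, one for each coordinate. *)
Lemma parab_cons m (h : euclid R m.+1 * RT -> \bar R) (t : RT) (y : euclid R m) (u : RT) :
  measurable_fun setT h -> (forall z, 0 <= h z) ->
  parab h (consE (t, y)) u =
  parab1 (fun z => parab (fun w => h (consE (z.1, w.1), w.2)) y z.2) t u.
Proof.
move=> mh h0.
have mm : measurable_fun setT (fun x : euclid R m.+1 => h (x, (u + dist2 x (consE (t, y)))%R)).
  apply: (measurableT_comp mh); apply: measurable_fun_pair; first exact: measurable_id.
  by apply: measurable_funD => //; apply: measurable_dist2; [exact: measurable_id|exact: measurable_cst].
rewrite [LHS](integral_euclidS mm (fun x => h0 _)).
apply: eq_integral => s _; apply: eq_integral => x _ /=.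
by rewrite dist2_cons addrA -sqrrN opprB.
Qed.

Lemma mixed_norm_euclid0 ro beta (h : euclid R 0 * RT -> \bar R) :
  measurable_fun setT h -> (0 < ro)%R ->
  mixed_norm (lebesgue_euclid 0) ro beta h =
  (\int[leb]_u (h ([tuple], u) `^ beta^-1)) `^ beta.
Proof.
move=> mh ro0; rewrite /mixed_norm integral_euclid0.
  by rewrite -poweRrM divfK// gt_eqF.
apply: measurable_fun_poweR.
apply: (@measurable_fun_fubini_tonelli_F _ _ _ _ R leb (fun z => h z `^ beta^-1)) => //.
exact: measurable_fun_poweR.
Qed.

End euclid_integral.

Section parabolic_estimate.
Context {R : realType}.
Local Notation leb := (@lebesgue_measure R).
Local Notation RT := (measurableTypeR R).

Lemma mixed_norm_poweRV d (X : measurableType d) (mu : {measure set X -> \bar R})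
    (ro beta : R) (h : X * RT -> \bar R) : (0 < ro)%R ->
  mixed_norm mu ro beta h `^ ro^-1 =
  \int[mu]_x (\int[leb]_u (h (x, u) `^ beta^-1)) `^ (beta / ro).
Proof. by move=> ro0; rewrite /mixed_norm poweRK ?gt_eqF// integral_ge0. Qed.

Lemma measurable_inner_norm d (X : measurableType d) (h : X * RT -> \bar R) (b c : R) :
  measurable_fun setT h ->
  measurable_fun setT (fun x => (\int[leb]_u (h (x, u) `^ b)) `^ c).
Proof.
move=> mh; apply: measurable_fun_poweR.
apply: (@measurable_fun_fubini_tonelli_F _ _ _ _ R leb (fun z => h z `^ b)) => //.
exact: measurable_fun_poweR.
Qed.

Lemma measurable_mixed_norm d1 d2 (Z : measurableType d1) (X : measurableType d2)
    (mu : {sigma_finite_measure set X -> \bar R}) (ro beta : R)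
    (h : Z -> X * RT -> \bar R) :
  measurable_fun setT (fun w : (Z * X) * RT => h w.1.1 (w.1.2, w.2)) ->
  measurable_fun setT (fun z => mixed_norm mu ro beta (h z)).
Proof.
move=> mh; apply: measurable_fun_poweR.
apply: (@measurable_fun_fubini_tonelli_F _ _ _ _ R mu
  (fun w : Z * X => (\int[leb]_u (h w.1 (w.2, u) `^ beta^-1)) `^ (beta / ro))).
  exact: (measurable_inner_norm _ _ mh).
by move=> w; exact: poweR_ge0.
Qed.

Lemma mixed_norm_euclidS m (ro beta : R) (h : euclid R m.+1 * RT -> \bar R) :
  (0 < ro)%R -> measurable_fun setT h ->
  mixed_norm (lebesgue_euclid m.+1) ro beta h `^ ro^-1 =
  \int[leb]_t (mixed_norm (lebesgue_euclid m) ro beta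
    (fun z => h (consE (t, z.1), z.2)) `^ ro^-1).
Proof.
move=> ro0 mh; rewrite mixed_norm_poweRV// integral_euclidS//; last first.
  exact: measurable_inner_norm.
by apply: eq_integral => t _; rewrite mixed_norm_poweRV.
Qed.

Let slice m (h : euclid R m.+1 * RT -> \bar R) (t : RT) : euclid R m * RT -> \bar R :=
  fun z => h (consE (t, z.1), z.2).

Let measurable_slice m h (t : RT) : measurable_fun setT h ->
  measurable_fun setT (@slice m h t).
Proof.
move=> mh; apply: (measurableT_comp mh); apply: measurable_fun_pair; last exact: measurable_snd.
by apply: measurable_consE_comp; [exact: measurable_cst|exact: measurable_fst].
Qed.

Let measurable_parab_slice m (h : euclid R m.+1 * RT -> \bar R) d (X : measurableType d)
    (T : X -> RT) (Y : X -> euclid R m) (U : X -> RT) :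
  measurable_fun setT h -> (forall z, 0 <= h z) -> measurable_fun setT T ->
  measurable_fun setT Y -> measurable_fun setT U ->
  measurable_fun setT (fun a => parab (slice h (T a)) (Y a) (U a)).
Proof.
move=> mh h0 mT mY mU; apply: measurable_parab_param => //; last by move=> a z; exact: h0.
apply: (measurableT_comp mh); apply: measurable_fun_pair.
  apply: measurable_consE_comp; first by apply: (measurableT_comp mT); exact: measurable_fst.
  by apply: (measurableT_comp measurable_fst); exact: measurable_snd.
by apply: (measurableT_comp measurable_snd); exact: measurable_snd.
Qed.

Let parab_fiber m (h : euclid R m.+1 * RT -> \bar R) (y : euclid R m) :
    RT * RT -> \bar R :=
  fun z => parab (slice h z.1) y z.2.

Let measurable_parab_fiber m (h : euclid R m.+1 * RT -> \bar R) :
  measurable_fun setT h -> (forall z, 0 <= h z) ->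
  measurable_fun setT (fun w : (euclid R m * RT) * RT => parab_fiber h w.1.1 (w.1.2, w.2)).
Proof.
move=> mh h0; apply: measurable_parab_slice => //.
- by apply: (measurableT_comp measurable_snd); exact: measurable_fst.
- by apply: (measurableT_comp measurable_fst); exact: measurable_fst.
- exact: measurable_snd.
Qed.

(** All space coordinates of the target carry the same exponent 1 / ro, so the order of integration
    in t and y is free there. With y outermost, what remains for fixed y is the one-dimensional
    operator in (t, u). *)
Let fiber_bound m (ro beta C1 : R) (h : euclid R m.+1 * RT -> \bar R) :
  (0 < ro)%R -> (0 < C1)%R -> measurable_fun setT h -> (forall z, 0 <= h z) ->
  (forall k : RT * RT -> \bar R, measurable_fun setT k -> (forall z, 0 <= k z) ->
     mixed_norm leb ro beta (fun z => parab1 k z.1 z.2) <=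
     C1%:E * mixed_norm leb (1 - ro) (beta + ro) k) ->
  mixed_norm (lebesgue_euclid m.+1) ro beta (fun z => parab h z.1 z.2) `^ ro^-1 <=
  C1%:E `^ ro^-1 * \int[lebesgue_euclid m]_y
     (mixed_norm leb (1 - ro) (beta + ro) (parab_fiber h y) `^ ro^-1).
Proof.
move=> ro0 C10 mh h0 H; have mp := measurable_parab mh h0.
have ri : (0 <= ro^-1)%R by rewrite invr_ge0 ltW.
rewrite mixed_norm_poweRV// integral_euclidS; last 2 first.
- exact: (measurable_inner_norm _ _ mp).
- by move=> x; exact: poweR_ge0.
pose N (w : RT * euclid R m) := (\int[leb]_u (parab h (consE w) u `^ beta^-1)) `^ (beta / ro).
have mN : measurable_fun setT N.
  apply: (measurableT_comp (measurable_inner_norm _ (beta / ro) mp)).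
  exact: measurable_consE.
rewrite (@fubini_tonelli _ _ _ _ R leb (lebesgue_euclid m) N mN (fun w => poweR_ge0 _ _)).
have mK y : measurable_fun setT (parab_fiber h y).
  exact: (@measurable_parab_slice m h _ _ (fun z : RT * RT => z.1) (cst y)
    (fun z => z.2) mh h0 measurable_fst (measurable_cst _) measurable_snd).
have K0 y z : 0 <= parab_fiber h y z by apply: parab_ge0 => ?; exact: h0.
have mM : measurable_fun setT (fun y =>
    mixed_norm leb (1 - ro) (beta + ro) (parab_fiber h y) `^ ro^-1).
  apply: measurable_fun_poweR; apply: measurable_mixed_norm.
  exact: measurable_parab_fiber.
rewrite -ge0_integralZl//.
apply: ge0_le_integral => //.
- by move=> y _; apply: integral_ge0 => x _; exact: poweR_ge0.
- exact: (@measurable_fun_fubini_tonelli_G _ _ _ _ R leb N mN (fun w => poweR_ge0 _ _)).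
- by apply: emeasurable_funM => //; exact: measurable_cst.
move=> y _; rewrite -poweRM ?lee_fin ?(ltW C10)//; last exact: poweR_ge0.
have P0 : 0 <= mixed_norm leb ro beta (fun z => parab1 (parab_fiber h y) z.1 z.2).
  exact: poweR_ge0.
have := lee_poweR ri P0 (H _ (mK y) (K0 y)).
rewrite (mixed_norm_poweRV _ _ _ ro0) => P; apply: le_trans P.
rewrite le_eqVlt; apply/orP; left; apply/eqP.
apply: eq_integral => t _; congr (_ `^ _); apply: eq_integral => u _.
by rewrite parab_cons.
Qed.

(** The one-dimensional step leaves an outer norm L^(1/ro) in y and an inner norm L^(1/(1-ro)) in t,
    whereas the estimate in m coordinates acts for fixed t. As ro <= 1/2, the ratio r = (1 - ro) /
    ro of these exponents is at least 1 and Minkowski's inequality brings t outside. *)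
Let minkowski_fiber m (ro beta gamma C2 : R) (h : euclid R m.+1 * RT -> \bar R) :
  (0 < ro)%R -> (ro + ro <= 1)%R -> (0 < C2)%R -> measurable_fun setT h -> (forall z, 0 <= h z) ->
  (forall k : euclid R m * RT -> \bar R, measurable_fun setT k -> (forall z, 0 <= k z) ->
     mixed_norm (lebesgue_euclid m) ro beta (fun z => parab k z.1 z.2) <=
     C2%:E * mixed_norm (lebesgue_euclid m) (1 - ro) gamma k) ->
  \int[lebesgue_euclid m]_y
     (mixed_norm leb (1 - ro) beta (parab_fiber h y) `^ ro^-1) <=
  (C2%:E * mixed_norm (lebesgue_euclid m.+1) (1 - ro) gamma h) `^ ro^-1.
Proof.
move=> ro0 ro2 C20 mh h0 H.
have ro1 : (0 < 1 - ro)%R by lra.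
have ri : (0 <= ro^-1)%R by rewrite invr_ge0 ltW.
pose K (w : euclid R m * RT) :=
  (\int[leb]_u (parab_fiber h w.1 (w.2, u) `^ beta^-1)) `^ (beta / (1 - ro)).
have mK : measurable_fun setT K.
  by apply: (@measurable_inner_norm _ _ (fun w : (euclid R m * RT) * RT =>
    parab_fiber h w.1.1 (w.1.2, w.2))); exact: measurable_parab_fiber.
have K0 w : 0 <= K w by exact: poweR_ge0.
pose r := ((1 - ro) / ro)%R.
have r1 : (1 <= r)%R by rewrite ler_pdivlMr// mul1r; lra.
have r0 : (0 < r)%R by exact: lt_le_trans r1.
rewrite [leLHS](_ : _ = \int[lebesgue_euclid m]_y ((\int[leb]_t K (y, t)) `^ r)); last first.
  apply: eq_integral => y _; rewrite /mixed_norm -poweRrM//.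
apply: le_trans (minkowski_integral (lebesgue_euclid m) leb r1 mK K0) _.
have rE : (ro^-1 = (1 - ro)^-1 * r)%R by rewrite /r mulrA mulVf ?mul1r// gt_eqF.
rewrite [leRHS](_ : _ = ((C2%:E * mixed_norm (lebesgue_euclid m.+1) (1 - ro) gamma h)
  `^ (1 - ro)^-1) `^ r); last by rewrite -poweRrM -rE.
 apply: lee_poweR; first exact: ltW.
  by apply: integral_ge0 => t _; exact: poweR_ge0.
have M0 : 0 <= mixed_norm (lebesgue_euclid m.+1) (1 - ro) gamma h by exact: poweR_ge0.
rewrite poweRM// ?lee_fin ?(ltW C20)//.
have mN : measurable_fun setT (fun t =>
    mixed_norm (lebesgue_euclid m) (1 - ro) gamma (slice h t) `^ (1 - ro)^-1).
  apply: measurable_fun_poweR; apply: measurable_mixed_norm.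
  apply: (measurableT_comp mh); apply: measurable_fun_pair; last exact: measurable_snd.
  apply: measurable_consE_comp.
  - by apply: (measurableT_comp measurable_fst); exact: measurable_fst.
  - by apply: (measurableT_comp measurable_snd); exact: measurable_fst.
rewrite mixed_norm_euclidS// -ge0_integralZl//.
apply: ge0_le_integral => //.
- apply: measurable_fun_poweR.
  apply: (@measurable_fun_fubini_tonelli_G _ _ _ _ R (lebesgue_euclid m) (fun w => K w `^ r)).
    exact: measurable_fun_poweR.
  by move=> w; exact: poweR_ge0.
- by apply: emeasurable_funM => //; exact: measurable_cst.
move=> t _; rewrite -poweRM// ?lee_fin ?(ltW C20)//; last exact: poweR_ge0.
have P0 : 0 <= mixed_norm (lebesgue_euclid m) ro beta
    (fun z => parab (slice h t) z.1 z.2) by exact: poweR_ge0.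
have := lee_poweR ri P0 (H _ (measurable_slice t mh) (fun z => h0 _)).
rewrite (mixed_norm_poweRV _ _ _ ro0) => /lee_poweR.
have rV : (0 <= r^-1)%R by rewrite invr_ge0 ltW.
move=> /(_ _ rV (integral_ge0 _ (fun z _ => poweR_ge0 _ _))).
rewrite -poweRrM (_ : (ro^-1 * r^-1 = (1 - ro)^-1)%R); last first.
  by rewrite /r invf_div mulrA mulVf ?mul1r// gt_eqF.
apply: le_trans; rewrite le_eqVlt; apply/orP; left; apply/eqP.
congr (_ `^ _); apply: eq_integral => y _; rewrite /K -poweRrM; congr (_ `^ _).
by rewrite /r mulrA divfK// gt_eqF.
Qed.

(** Induction on m with beta free: the one-dimensional estimate in the first coordinate raises the
    exponent in u to beta + ro, and the other m coordinates start from there. For m = 0 the operator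
    is the identity. *)
Theorem parab_mixed_norm m (ro beta : R) : (0 < ro)%R -> (ro <= beta)%R ->
  (beta + m%:R * ro < 1)%R -> exists2 C : R, (0 < C)%R &
  forall h : euclid R m * RT -> \bar R, measurable_fun setT h -> (forall z, 0 <= h z) ->
  mixed_norm (lebesgue_euclid m) ro beta (fun z => parab h z.1 z.2) <=
  C%:E * mixed_norm (lebesgue_euclid m) (1 - ro) (beta + m%:R * ro) h.
Proof.
elim: m beta => [|m IH] beta ro0 ro_beta.
  rewrite mul0r addr0 => beta1; exists 1%R => // h mh h0.
  rewrite mul1e !mixed_norm_euclid0//; last 2 first.
  - by rewrite subr_gt0 (le_lt_trans ro_beta).
  - exact: measurable_parab.
  rewrite le_eqVlt; apply/orP; left; apply/eqP; congr (_ `^ _).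
  apply: eq_integral => u _; rewrite /parab/= integral_euclid0.
    by rewrite /dist2 big_ord0 addr0.
  apply: (measurableT_comp mh); apply: measurable_fun_pair; first exact: measurable_id.
  by apply: measurable_funD => //; apply: measurable_dist2; [exact: measurable_id|exact: measurable_cst].
rewrite -natr1 mulrDl mul1r => beta1.
have m0 : (0 <= m%:R * ro)%R by rewrite mulr_ge0// ltW.
have br1 : (beta + ro < 1)%R by lra.
have br2 : (ro <= beta + ro)%R by lra.
have br3 : (beta + ro + m%:R * ro < 1)%R by lra.
have br4 : (ro + ro <= 1)%R by lra.
have [C1 C10 H1] := parab1_mixed_norm ro0 ro_beta br1.
have [C2 C20 H2] := IH (beta + ro)%R ro0 br2 br3.
have ri : (0 <= ro^-1)%R by rewrite invr_ge0 ltW.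
exists (C1 * C2)%R; first exact: mulr_gt0.
move=> h mh h0; set M := mixed_norm _ _ _ h.
have M0 : 0 <= C2%:E * M by rewrite mule_ge0 ?lee_fin ?(ltW C20)//; exact: poweR_ge0.
have C1E : 0 <= C1%:E by rewrite lee_fin ltW.
have E : mixed_norm (lebesgue_euclid m.+1) ro beta (fun z => parab h z.1 z.2) `^ ro^-1 <=
    (C1%:E * (C2%:E * M)) `^ ro^-1.
  rewrite poweRM//; apply: le_trans (fiber_bound ro0 C10 mh h0 H1) _.
  apply: lee_wpmul2l; first exact: poweR_ge0.
  by rewrite /M addrCA addrC; exact: (minkowski_fiber ro0 br4 C20 mh h0 H2).
have := lee_poweR (ltW ro0) (poweR_ge0 _ _) E.
rewrite (poweRVK (poweR_ge0 _ _) (lt0r_neq0 ro0)).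
by rewrite (poweRVK (mule_ge0 C1E M0) (lt0r_neq0 ro0)) EFinM muleA.
Qed.

End parabolic_estimate.

(** * Mixed-norm duality *)

Section mixed_norm_duality.
Context {R : realType} {d} {X : measurableType d}.
Variable mu : {sigma_finite_measure set X -> \bar R}.
Local Notation leb := (@lebesgue_measure R).
Local Notation RT := (measurableTypeR R).

Lemma mixed_norm_increases (ro beta : R) (g : nat -> X * RT -> \bar R) (f : X * RT -> \bar R) :
  (0 < ro)%R -> (0 < beta)%R ->
  (forall n, measurable_fun setT (g n)) -> (forall n z, 0 <= g n z) ->
  (forall z, increases_to (g ^~ z) (f z)) ->
  increases_to (fun n => mixed_norm mu ro beta (g n)) (mixed_norm mu ro beta f).
Proof.
move=> ro0 beta0 mg g0 gf.
have bV : (0 < beta^-1)%R by rewrite invr_gt0.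
apply: increases_to_poweR => //.
  by move=> n; apply: integral_ge0 => x _; exact: poweR_ge0.
apply: increases_to_integral.
- by move=> n; exact: measurable_inner_norm.
- by move=> n x; exact: poweR_ge0.
move=> x; apply: increases_to_poweR; first exact: divr_gt0.
  by move=> n; apply: integral_ge0 => t _; exact: poweR_ge0.
apply: increases_to_integral.
- by move=> n; apply: measurable_fun_poweR; exact: measurable_fun_pair2.
- by move=> n t; exact: poweR_ge0.
by move=> t; exact: increases_to_poweR.
Qed.

Let seg (n : nat) : set R := `[(- n%:R)%R, n%:R%R]%classic.

(** The cut is made only in t: it has to make each fiber norm finite. The outer norm in x is
    truncated separately, by [integral_poweR_le_dual]. *)
Let slab (n : nat) : set (X * RT)%type := setT `*` seg n.

Let measurable_slab n : measurable (slab n).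
Proof. by apply: measurableX => //; exact: measurable_itv. Qed.

Let slab_mono : {homo slab : m n / (m <= n)%N >-> m `<=` n}.
Proof.
move=> m n mn [x t] [_ /=]; rewrite /seg/= !in_itv/= => /andP[mt tm]; split => //=.
have mn' : (m%:R <= n%:R :> R)%R by rewrite ler_nat.
by rewrite /seg/= in_itv/=; apply/andP; split; lra.
Qed.

Let slabT : \bigcup_n slab n = setT.
Proof.
apply/seteqP; split => // -[x t] _.
exists (Num.trunc `|t|).+1 => //; split => //=.
have := ltW (truncnS_gt `|t|); rewrite ler_norml => /andP[? ?].
by rewrite /seg/= in_itv/=; apply/andP; split; lra.
Qed.

Let inner_norm (sg : R) (w : X * RT -> \bar R) (x : X) : \bar R :=
  (\int[leb]_t (w (x, t) `^ sg^-1)) `^ sg.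

Let inner_norm_fin (sg : R) (F : X * RT -> \bar R) n x : (0 < sg)%R ->
  measurable_fun setT F -> (forall z, 0 <= F z) ->
  inner_norm sg (truncation slab F n) x < +oo.
Proof.
move=> sg0 mF F0; rewrite poweR_lty//.
have mI : measurable_fun setT (fun t : RT => (\1_(seg n) t : R)%:E).
  by apply/measurable_EFinP; apply: measurable_indic; exact: measurable_itv.
apply: (@le_lt_trans _ _ (\int[leb]_t ((n%:R `^ sg^-1)%:E * (\1_(seg n) t)%:E))).
  apply: ge0_le_integral => //.
  - apply: measurable_fun_poweR; apply: measurable_fun_pair2.
    exact: measurable_truncation.
  - by apply: emeasurable_funM => //; exact: measurable_cst.
  move=> t _; apply: le_trans (lee_poweR _ _ (truncation_bound slab F n (x, t))) _.
  - by rewrite invr_ge0 ltW.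
  - exact: truncation_ge0.
  rewrite !indicE (_ : ((x, t) \in slab n) = (t \in seg n)); last first.
    by apply/idP/idP; rewrite !inE; [case|split].
  case: (t \in _) => /=; first by rewrite mulr1 mule1.
  by rewrite mulr0 mule0 powR0// gt_eqF// invr_gt0.
rewrite ge0_integralZl//.
rewrite integral_indic//; last exact: measurable_itv.
have L : lebesgue_measure (seg n) < +oo.
  by rewrite /seg lebesgue_measure_itv/= lte_fin; case: ifP => _; rewrite -?EFinB ltry.
by rewrite setIT; apply: lte_mul_pinfty; [rewrite lee_fin powR_ge0| |exact: L].
Qed.

(** Converse of Hoelder's inequality in two layers: in x it is applied to the function of fiber
    norms, and in t the fiber norm is attained by an explicit extremal function. *)
Lemma mixed_norm_le_dual (ro sg : R) (F : X * RT -> \bar R) (M : \bar R) :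
  (0 < ro < 1)%R -> (0 < sg < 1)%R -> measurable_fun setT F -> (forall z, 0 <= F z) ->
  0 <= M ->
  (forall h : X * RT -> \bar R, measurable_fun setT h -> (forall z, 0 <= h z) ->
    \int[mu]_x \int[leb]_t (F (x, t) * h (x, t)) <=
    M * mixed_norm mu (1 - ro) (1 - sg) h) ->
  mixed_norm mu ro sg F <= M.
Proof.
move=> /andP[ro0 ro1] /andP[sg0 sg1] mF F0 M0 H.
pose w := truncation slab F.
have w0 n z : 0 <= w n z by exact: truncation_ge0.
have mw n : measurable_fun setT (w n) by exact: measurable_truncation.
have winc z : increases_to (w ^~ z) (F z) by exact: truncation_increases.
apply: increases_to_le (mixed_norm_increases ro0 sg0 mw w0 winc) _ => n.
have Noo x : inner_norm sg (w n) x < +oo by exact: inner_norm_fin.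
have N0 x : 0 <= inner_norm sg (w n) x by exact: poweR_ge0.
have mN : measurable_fun setT (inner_norm sg (w n)) by exact: measurable_inner_norm.
have sgV : (1 < sg^-1)%R by rewrite invf_gt1.
have roV : (1 < ro^-1)%R by rewrite invf_gt1.
have E : mixed_norm mu ro sg (w n) = (\int[mu]_x (inner_norm sg (w n) x `^ ro^-1)) `^ ro.
  by congr (_ `^ _); apply: eq_integral => x _; rewrite /inner_norm -poweRrM.
rewrite E -[X in _ `^ X]invrK; apply: lee_poweRV => //.
- by rewrite invr_gt0.
- by apply: integral_ge0 => x _; exact: poweR_ge0.
apply: integral_poweR_le_dual => // v mv v0.
rewrite invrK.
(* The first two factors form the extremal function in t: paired with w they give the fiber norm,
   and their own dual fiber norm is 1, or 0 where the fiber norm vanishes. The last factor is the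
   test function in x. *)
pose h (z : X * RT) := w n z `^ (sg^-1 - 1) *
  (inner_norm sg (w n) z.1 `^ (1 - sg^-1) * v z.1 `^ (ro^-1 - 1)).
have mh : measurable_fun setT h.
  apply: emeasurable_funM; first exact: measurable_fun_poweR.
  apply: emeasurable_funM; apply: measurable_fun_poweR.
    exact: (measurableT_comp mN measurable_fst).
  exact: (measurableT_comp mv measurable_fst).
have h0 z : 0 <= h z by rewrite /h !mule_ge0 ?poweR_ge0.
have mwx x r : measurable_fun setT (fun t : RT => w n (x, t) `^ r).
  by apply: measurable_fun_poweR; exact: measurable_fun_pair2.
have IE x : \int[leb]_t (w n (x, t) `^ sg^-1) = inner_norm sg (w n) x `^ sg^-1.
  by rewrite /inner_norm poweRK ?gt_eqF// integral_ge0.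
apply: (@le_trans _ _ (\int[mu]_x \int[leb]_t (F (x, t) * h (x, t)))).
  apply: ge0_le_integral => //.
  - by move=> x _; apply: mule_ge0.
  - by apply: emeasurable_funM => //; exact: measurable_fun_poweR.
  - apply: (@measurable_fun_fubini_tonelli_F _ _ _ _ R leb (fun z => F z * h z)).
      exact: emeasurable_funM.
    by move=> z; exact: mule_ge0.
  move=> x _; apply: (@le_trans _ _ (\int[leb]_t (w n (x, t) `^ sg^-1 *
      (inner_norm sg (w n) x `^ (1 - sg^-1) * v x `^ (ro^-1 - 1))))).
    rewrite ge0_integralZr//; last by rewrite mule_ge0.
    rewrite IE muleA; apply: lee_wpmul2r; first exact: poweR_ge0.
    move: (N0 x) (Noo x); case: (inner_norm _ _ _) => [a|//|//]; rewrite lee_fin => a0 _.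
    have [->|an0] := eqVneq a 0%R; first by apply: mule_ge0; exact: poweR_ge0.
    by rewrite !poweR_EFin -EFinM -powRD ?an0 ?implybT// addrC subrK powRr1.
  apply: ge0_le_integral => //.
  - by move=> t _; rewrite !mule_ge0.
  - by apply: emeasurable_funM => //; exact: measurable_cst.
  - apply: emeasurable_funM; first exact: measurable_fun_pair2.
    exact: (measurable_fun_pair2 x mh).
  move=> t _; rewrite /h/= [leRHS]muleA; apply: lee_wpmul2r.
    by apply: mule_ge0; exact: poweR_ge0.
  rewrite (_ : sg^-1 = 1 + (sg^-1 - 1))%R; last by rewrite addrC subrK.
  rewrite ge0_poweRD// ?subr_ge0 ?(ltW sgV)// poweRe1// (addrC 1%R) addrK.
  by apply: lee_wpmul2r; [exact: poweR_ge0|exact: truncation_le].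
apply: le_trans (H _ mh h0) _; apply: lee_wpmul2l => //.
apply: lee_poweR; first by rewrite subr_ge0 ltW.
  by apply: integral_ge0 => x _; exact: poweR_ge0.
have s1 : (0 < 1 - sg)%R by rewrite subr_gt0.
have r1 : (0 < 1 - ro)%R by rewrite subr_gt0.
apply: ge0_le_integral => //.
- exact: measurable_inner_norm.
- exact: measurable_fun_poweR.
move=> x _; set c := v x `^ (ro^-1 - 1).
have -> : v x `^ ro^-1 = (c `^ (1 - sg)^-1) `^ ((1 - sg) / (1 - ro)).
  rewrite /c -!poweRrM; congr (_ `^ _); field.
  by rewrite !gt_eqF.
apply: lee_poweR; first exact: divr_ge0 (ltW _) (ltW _).
  by apply: integral_ge0 => t _; exact: poweR_ge0.
rewrite [leLHS](_ : _ = \int[leb]_t (w n (x, t) `^ sg^-1 *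
    ((inner_norm sg (w n) x `^ (1 - sg^-1)) `^ (1 - sg)^-1 * c `^ (1 - sg)^-1))); last first.
  apply: eq_integral => t _; rewrite /h poweRM ?mule_ge0// poweRM//; congr (_ * _).
  by rewrite -poweRrM; congr (_ `^ _); field; rewrite !gt_eqF.
rewrite ge0_integralZr//; last by rewrite mule_ge0.
rewrite IE muleA -[leRHS]mul1e; apply: lee_wpmul2r; first exact: poweR_ge0.
rewrite -poweRrM (_ : ((1 - sg^-1) / (1 - sg) = - sg^-1)%R); last by field; rewrite !gt_eqF.
move: (N0 x) (Noo x); case: (inner_norm _ _ _) => [a|//|//]; rewrite lee_fin => a0 _.
have [->|an0] := eqVneq a 0%R.
  by rewrite !poweR_EFin powR0 ?mul0e// ?gt_eqF// invr_gt0.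
by rewrite !poweR_EFin -EFinM -powRD ?an0 ?implybT// subrr powRr0.
Qed.

End mixed_norm_duality.

(** * The estimate for the parabolic operator, by duality *)

Section slant.
Context {R : realType} {m : nat}.
Local Notation leb := (@lebesgue_measure R).
Local Notation RT := (measurableTypeR R).
Local Notation lebm := (@lebesgue_euclid R m).

(* The formal adjoint of parab. *)
Definition slant (f : euclid R m * RT -> \bar R) (x : euclid R m) (t : RT) : \bar R :=
  \int[lebm]_y f (y, (t - dist2 x y)%R).

Lemma slant_ge0 f x t : (forall z, 0 <= f z) -> 0 <= slant f x t.
Proof. by move=> f0; apply: integral_ge0. Qed.

Let measurable_slant_kernel d (X : measurableType d) (f : euclid R m * RT -> \bar R)
    (T : X -> RT) (x y : X -> euclid R m) :
  measurable_fun setT f -> measurable_fun setT T -> measurable_fun setT x ->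
  measurable_fun setT y ->
  measurable_fun setT (fun a => f (y a, (T a - dist2 (x a) (y a))%R)).
Proof.
move=> mf mT mx my; apply: (measurableT_comp mf); apply: measurable_fun_pair => //.
by apply: measurable_funB => //; exact: measurable_dist2.
Qed.

Lemma measurable_slant f : measurable_fun setT f -> (forall z, 0 <= f z) ->
  measurable_fun setT (fun z : euclid R m * RT => slant f z.1 z.2).
Proof.
move=> mf f0.
apply: (@measurable_fun_fubini_tonelli_F _ _ _ _ R lebm
  (fun w : (euclid R m * RT) * euclid R m => f (w.2, (w.1.2 - dist2 w.1.1 w.2)%R))).
  apply: measurable_slant_kernel => //.
  - by apply: (measurableT_comp measurable_snd); exact: measurable_fst.
  - by apply: (measurableT_comp measurable_fst); exact: measurable_fst.
by move=> w; exact: f0.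
Qed.

Lemma slant_parab (f h : euclid R m * RT -> \bar R) :
  measurable_fun setT f -> (forall z, 0 <= f z) ->
  measurable_fun setT h -> (forall z, 0 <= h z) ->
  \int[lebm]_x \int[leb]_t (slant f x t * h (x, t)) =
  \int[lebm]_y \int[leb]_u (f (y, u) * parab h y u).
Proof.
move=> mf f0 mh h0.
have mS x t : measurable_fun setT (fun y : euclid R m => f (y, (t - dist2 x y)%R)).
  apply: (measurableT_comp mf); apply: measurable_fun_pair; first exact: measurable_id.
  by apply: measurable_funB => //; apply: measurable_dist2; [exact: measurable_cst|exact: measurable_id].
have mH y u : measurable_fun setT (fun x : euclid R m => h (x, (u + dist2 x y)%R)).
  apply: (measurableT_comp mh); apply: measurable_fun_pair; first exact: measurable_id.
  by apply: measurable_funD => //; apply: measurable_dist2; [exact: measurable_id|exact: measurable_cst].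
pose A (w : euclid R m * euclid R m) := \int[leb]_u (f (w.2, u) * h (w.1, (u + dist2 w.1 w.2)%R)).
have mA0 : measurable_fun setT (fun w : (euclid R m * euclid R m) * RT =>
    f (w.1.2, w.2) * h (w.1.1, (w.2 + dist2 w.1.1 w.1.2)%R)).
  have m11 : measurable_fun setT (fun w : (euclid R m * euclid R m) * RT => w.1.1).
    by apply: (measurableT_comp measurable_fst); exact: measurable_fst.
  have m12 : measurable_fun setT (fun w : (euclid R m * euclid R m) * RT => w.1.2).
    by apply: (measurableT_comp measurable_snd); exact: measurable_fst.
  apply: emeasurable_funM.
    by apply: (measurableT_comp mf); apply: measurable_fun_pair => //; exact: measurable_snd.
  apply: (measurableT_comp mh); apply: measurable_fun_pair => //.
  by apply: measurable_funD; [exact: measurable_snd|exact: measurable_dist2].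
have mA : measurable_fun setT A.
  apply: (@measurable_fun_fubini_tonelli_F _ _ _ _ R leb _ mA0).
  by move=> w; rewrite mule_ge0.
have A0 w : 0 <= A w by apply: integral_ge0 => u _; rewrite mule_ge0.
transitivity (\int[lebm]_x \int[lebm]_y A (x, y)).
  apply: eq_integral => x _.
  pose B (w : RT * euclid R m) := f (w.2, (w.1 - dist2 x w.2)%R) * h (x, w.1).
  have mB : measurable_fun setT B.
    apply: emeasurable_funM.
      apply: (measurableT_comp mf); apply: measurable_fun_pair; first exact: measurable_snd.
      apply: measurable_funB; first exact: measurable_fst.
      by apply: measurable_dist2; [exact: measurable_cst|exact: measurable_snd].
    by apply: (measurableT_comp mh); apply: measurable_fun_pair; [exact: measurable_cst|exact: measurable_fst].
  have B0 w : 0 <= B w by rewrite mule_ge0.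
  transitivity (\int[leb]_t \int[lebm]_y B (t, y)).
    by apply: eq_integral => t _; rewrite /slant -ge0_integralZr.
  rewrite (@fubini_tonelli _ _ _ _ R leb lebm B mB B0); apply: eq_integral => y _.
  rewrite -(@integral_shift R (dist2 x y) (fun t => B (t, y))) ; last 2 first.
  - exact: (measurable_fun_pair1 y mB).
  - by move=> t; exact: B0.
  by apply: eq_integral => u _; rewrite /B/= addrK.
rewrite (@fubini_tonelli _ _ _ _ R lebm lebm A mA A0); apply: eq_integral => y _.
pose D (w : euclid R m * RT) := f (y, w.2) * h (w.1, (w.2 + dist2 w.1 y)%R).
have mD : measurable_fun setT D.
  apply: emeasurable_funM.
    by apply: (measurableT_comp mf); apply: measurable_fun_pair; [exact: measurable_cst|exact: measurable_snd].
  apply: (measurableT_comp mh); apply: measurable_fun_pair; first exact: measurable_fst.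
  apply: measurable_funD; first exact: measurable_snd.
  by apply: measurable_dist2; [exact: measurable_fst|exact: measurable_cst].
have D0 w : 0 <= D w by rewrite mule_ge0.
rewrite [LHS](@fubini_tonelli _ _ _ _ R lebm leb D mD D0); apply: eq_integral => u _.
by rewrite /parab -ge0_integralZl.
Qed.

Lemma mixed_norm_diagonal (ro : R) (h : euclid R m * RT -> \bar R) : (0 < ro)%R ->
  measurable_fun setT h -> (forall z, 0 <= h z) ->
  mixed_norm lebm ro ro h = (\int[lebm \x leb]_z (h z `^ ro^-1)) `^ ro.
Proof.
move=> ro0 mh h0; rewrite /mixed_norm divff ?gt_eqF//; congr (_ `^ _).
rewrite fubini_tonelli1//; last exact: measurable_fun_poweR.
apply: eq_integral => x _; rewrite poweRe1//.
by apply: integral_ge0 => u _; exact: poweR_ge0.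
Qed.

(** Dual to [parab_mixed_norm] at beta = ro. There the exponent of the input in u is ro + m ro = 1 -
    (1 - (m+1) ro), and the target norm is diagonal, so the pairing with f takes a single Hoelder
    inequality on the product space. *)
Lemma slant_mixed_norm (ro : R) : (0 < ro)%R -> (m.+1%:R * ro < 1)%R ->
  exists2 C : R, (0 < C)%R &
  forall f : euclid R m * RT -> \bar R, measurable_fun setT f -> (forall z, 0 <= f z) ->
  mixed_norm lebm ro (1 - m.+1%:R * ro) (fun z => slant f z.1 z.2) <=
  C%:E * mixed_norm lebm (1 - ro) (1 - ro) f.
Proof.
move=> ro0 ro1.
have m0 : (0 <= m%:R :> R)%R by [].
have mro : (m.+1%:R * ro = ro + m%:R * ro)%R by rewrite -natr1; ring.
have mro0 : (0 <= m%:R * ro)%R by rewrite mulr_ge0// ltW.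
have rom : (ro + m%:R * ro < 1)%R by rewrite -mro.
have [C C0 HC] := parab_mixed_norm ro0 (lexx ro) rom.
exists C => // f mf f0.
have ro1' : (ro < 1)%R by lra.
have pi : (0 < 1 - ro)%R by lra.
have N0 : 0 <= mixed_norm lebm (1 - ro) (1 - ro) f by exact: poweR_ge0.
apply: mixed_norm_le_dual.
- by rewrite ro0.
- by rewrite mro; apply/andP; split; lra.
- exact: measurable_slant.
- by move=> z; exact: slant_ge0.
- by rewrite mule_ge0// lee_fin ltW.
move=> h mh h0; rewrite slant_parab//.
have mp := measurable_parab mh h0.
have := HC h mh h0; rewrite (_ : (ro + m%:R * ro = 1 - (1 - m.+1%:R * ro))%R); last first.
  by rewrite mro; ring.
move=> H; rewrite [leRHS]muleAC; apply: le_trans (lee_wpmul2r N0 H).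
pose r := ((1 - ro)^-1)%R.
have r1 : (1 < r)%R by rewrite invf_gt1//; lra.
have r10 : (0 <= (r - 1)^-1)%R by rewrite invr_ge0 subr_ge0 ltW.
(* Chosen so that g^(r - 1) is [parab h], the second factor of the pairing; then g^r is its power 1
   / ro. *)
pose g (z : euclid R m * RT) := parab h z.1 z.2 `^ (r - 1)^-1.
have mg : measurable_fun setT g by exact: measurable_fun_poweR.
rewrite !mixed_norm_diagonal//; last by move=> z; exact: parab_ge0.
have Hp := hoelder_conjugate_integral (lebm \x leb) (ltW r1) mf mg f0 (fun z => poweR_ge0 _ _).
have gE z : g z `^ (r - 1) = parab h z.1 z.2.
  by rewrite /g poweRVK//; [exact: parab_ge0|rewrite gt_eqF// subr_gt0].
have FE : \int[lebm]_y \int[leb]_u (f (y, u) * parab h y u) =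
    \int[lebm \x leb]_z (f z * g z `^ (r - 1)).
  rewrite fubini_tonelli1; first last.
  - by move=> z; exact: mule_ge0.
  - by apply: emeasurable_funM => //; exact: measurable_fun_poweR.
  by apply: eq_integral => y _; apply: eq_integral => u _; rewrite gE.
have rV : (r^-1 = 1 - ro)%R by rewrite /r invrK.
have gr z : g z `^ r = parab h z.1 z.2 `^ ro^-1.
  rewrite /g -poweRrM; congr (_ `^ _); rewrite /r; field.
  by apply/andP; split; rewrite gt_eqF//; lra.
rewrite FE muleC; apply: le_trans Hp _.
rewrite rV (_ : (1 - (1 - ro) = ro)%R); last by ring.
have -> : \int[lebm \x leb]_z (g z `^ r) = \int[lebm \x leb]_z (parab h z.1 z.2 `^ ro^-1).
  by apply: eq_integral => z _; exact: gr.
by [].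
Qed.

End slant.

(** * The hemispherical transform in parabolic coordinates *)

Section hemisphere_area.
Context {R : realType} {m : nat}.
Implicit Types (x y : euclid R m) (r : R).
Local Open Scope ring_scope.

Lemma dist2_ge0 x y : 0 <= dist2 x y.
Proof. by apply: sumr_ge0 => i _; exact: sqr_ge0. Qed.

Lemma mem_disk x r y : 0 < r -> disk x r y <-> dist2 x y < r ^+ 2.
Proof.
move=> r0; rewrite /disk/=; split=> h.
  by rewrite -(sqr_sqrtr (dist2_ge0 x y)) ltr_pXn2r// nnegrE ?sqrtr_ge0 ?ltW.
by rewrite -(ltr_pXn2r (n := 2))// ?nnegrE ?sqrtr_ge0 ?(ltW r0)// sqr_sqrtr// dist2_ge0.
Qed.

Let dist2_upd x y i t :
  dist2 x (upd y i t) = (t - tnth x i) ^+ 2 + \sum_(j < m | j != i) (tnth y j - tnth x j) ^+ 2.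
Proof.
rewrite /dist2 (bigD1 i)//= tnth_mktuple eqxx; congr (_ + _).
by apply: eq_bigr => j ji; rewrite tnth_mktuple (negbTE ji).
Qed.

Let upd_id y i : upd y i (tnth y i) = y.
Proof. by apply: eq_from_tnth => j; rewrite tnth_mktuple; case: eqP => // ->. Qed.

Lemma partial_cap x r y i : 0 < r -> disk x r y ->
  partial (cap x r) i y = - (tnth y i - tnth x i) / cap x r y.
Proof.
move=> r0 /(mem_disk _ _ r0) yr.
pose K := \sum_(j < m | j != i) (tnth y j - tnth x j) ^+ 2.
pose g (t : R) : R := r ^+ 2 - ((t - tnth x i) ^+ 2 + K).
have gE : g (tnth y i) = r ^+ 2 - dist2 x y by rewrite /g /K -dist2_upd upd_id.
have g0 : 0 < g (tnth y i) by rewrite gE subr_gt0.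
have dg : is_derive (tnth y i) 1 g (- ((tnth y i - tnth x i) *+ 2)).
  have -> : g = cst (r ^+ 2) - ((id - cst (tnth x i)) ^+ 2 + cst K) by [].
  apply: is_derive_eq.
  rewrite -[(id - cst _) _]/(tnth y i - tnth x i) -[_ *: _]/(_ * _) /=; ring.
have := is_derive1_comp (is_derive1_sqrt g0) dg.
move=> /@derive_val; rewrite -derive1E => D.
rewrite /partial (_ : (fun t => cap x r (upd y i t)) = Num.sqrt \o g); last first.
  by apply/funext => t; rewrite /cap dist2_upd.
rewrite D gE /cap; field.
by rewrite gt_eqF// sqrtr_gt0 subr_gt0.
Qed.

Lemma area_density_cap x r y : 0 < r -> disk x r y ->
  area_density (cap x r) y = r / cap x r y.
Proof.
move=> r0 dy; have yr := (mem_disk x y r0).1 dy.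
have c0 : 0 < cap x r y by rewrite sqrtr_gt0 subr_gt0.
have c2 : cap x r y ^+ 2 = r ^+ 2 - dist2 x y by rewrite sqr_sqrtr// subr_ge0 ltW.
rewrite /area_density (eq_bigr (fun i => (tnth y i - tnth x i) ^+ 2 / cap x r y ^+ 2)).
  rewrite -mulr_suml -/(dist2 x y) (_ : dist2 x y = r ^+ 2 - cap x r y ^+ 2); last by rewrite c2; ring.
  rewrite (_ : 1 + _ = (r / cap x r y) ^+ 2); last by field; rewrite gt_eqF.
  by rewrite sqrtr_sqr gtr0_norm// divr_gt0.
by move=> i _; rewrite partial_cap// expr_div_n sqrrN.
Qed.

End hemisphere_area.

Section monotone_integral.
Context {d} {X : measurableType d} {R : realType}.
Variable mu : {measure set X -> \bar R}.

(** Monotonicity is read off from the supremum over the simple functions below, for arbitrary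
    nonnegative functions. It lets the norms of H phi be compared with those of [slant] although H
    phi is not shown to be measurable in r or x. *)
Lemma le_ge0_integral (D : set X) (f g : X -> \bar R) :
  (forall x, D x -> 0 <= f x) -> (forall x, D x -> f x <= g x) ->
  \int[mu]_(x in D) f x <= \int[mu]_(x in D) g x.
Proof.
move=> f0 fg; rewrite !ge0_integralE//; last by move=> x Dx; exact: le_trans (f0 x Dx) (fg x Dx).
apply: le_ereal_sup => _ [h hf <-]; exists h => // x.
apply: le_trans (hf x) _; rewrite /patch; case: ifPn => // /set_mem; exact: fg.
Qed.

End monotone_integral.

Section fold_sonar.
Context {R : realType} {m : nat}.
Local Notation leb := (@lebesgue_measure R).
Local Notation RT := (measurableTypeR R).
Local Notation lebm := (@lebesgue_euclid R m).
Implicit Types (phi : euclidS R m -> R).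

Let pos : set RT := `]0%R, +oo[%classic.

(* In the coordinates u = y_n^2 and t = r^2, H phi (x, r) is
   r * slant (fold phi) x t for phi >= 0. *)
Definition fold phi (z : euclid R m * RT) : \bar R :=
  if (0 < z.2)%R then (`|phi (z.1, Num.sqrt z.2)| / Num.sqrt z.2)%:E else 0.

Lemma fold_ge0 phi z : 0 <= fold phi z.
Proof. by rewrite /fold; case: ifP => // _; rewrite lee_fin divr_ge0 ?sqrtr_ge0. Qed.

Lemma measurable_sqrt d (X : measurableType d) (D : set X) (f : X -> R) :
  measurable_fun D f -> measurable_fun D (fun x => Num.sqrt (f x)).
Proof.
by move=> mf; apply: (measurableT_comp _ mf); apply: continuous_measurable_fun; exact: sqrt_continuous.
Qed.

Lemma measurable_half_space : measurable (@half_space R m).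
Proof.
rewrite (_ : half_space = setT `*` pos); first by apply: measurableX => //; exact: measurable_itv.
by apply/seteqP; split => -[y t]; rewrite /half_space/= /pos/= in_itv/= andbT; [|case].
Qed.

Lemma measurable_fold phi : measurable_fun half_space phi -> measurable_fun setT (fold phi).
Proof.
move=> mphi; rewrite (_ : fold phi = patch (cst 0)  (@half_space R m)
   (fun z => (`|phi (z.1, Num.sqrt z.2)| / Num.sqrt z.2)%:E)); last first.
  apply/funext => z; rewrite /fold /patch; case: ifPn => z0; first by rewrite mem_set.
  by rewrite memNset//=; apply/negP.
apply/(measurable_restrictT _ _).1; first exact: measurable_half_space.
have m1 := measurable_half_space.
have ms : measurable_fun setT (fun z : euclidS R m => Num.sqrt z.2).
  by apply: measurable_sqrt; exact: measurable_snd.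
have mf : measurable_fun half_space (fun z : euclidS R m => (z.1, Num.sqrt z.2)).
  by apply: measurable_funTS; apply: measurable_fun_pair => //; exact: measurable_fst.
apply/measurable_EFinP; apply: measurable_funM.
  apply: (measurableT_comp (@normr_measurable R setT)).
  apply: (measurable_comp measurable_half_space _ mphi mf).
  by move=> _ [z z0 <-]; rewrite /half_space/= sqrtr_gt0.
apply: (eq_measurable_fun (fun z : euclidS R m => (Num.sqrt z.2) `^ (-1))%R).
  by move=> z _; rewrite powR_inv1// sqrtr_ge0.
by apply: measurable_funTS; exact: (measurableT_comp (measurable_powR _) ms).
Qed.

(** The area factor r / y_n accounts both for the r in front and for the division by sqrt u = y_n in
    [fold]. Only the triangle inequality is lost. *)
Lemma hemispherical_le_slant phi x r : (0 < r)%R -> measurable_fun half_space phi ->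
  `|hemispherical phi x r| <= r%:E * slant (fold phi) x (r ^+ 2)%R.
Proof.
move=> r0 mphi; rewrite /hemispherical /graph_integral.
have diskE : disk x r = [set y | (0 < r ^+ 2 - dist2 x y)%R].
  by apply/seteqP; split => y /=; rewrite subr_gt0 => /(mem_disk x y r0).
have md : measurable_fun setT (fun y : euclid R m => (r ^+ 2 - dist2 x y)%R).
  by apply: measurable_funB => //; apply: measurable_dist2; [exact: measurable_cst|exact: measurable_id].
have mdisk : measurable (disk x r).
  rewrite (_ : disk x r = setT `&` (fun y => (r ^+ 2 - dist2 x y)%R) @^-1` pos).
    by apply: md => //; exact: measurable_itv.
  by rewrite setTI diskE; apply/seteqP; split => y; rewrite /pos/= in_itv/= andbT.
have E y : disk x r y -> (`|phi (y, cap x r y) * area_density (cap x r) y|)%:E =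
    r%:E * fold phi (y, (r ^+ 2 - dist2 x y)%R).
  move=> dy; have d0 : (0 < r ^+ 2 - dist2 x y)%R by move: dy; rewrite diskE.
  rewrite area_density_cap// /fold/= d0 -EFinM normrM; congr EFin.
  rewrite [X in (_ * X)%R]gtr0_norm; last by rewrite divr_gt0// sqrtr_gt0.
  by rewrite /cap mulrCA.
have mK : measurable_fun setT (fun y : euclid R m => fold phi (y, (r ^+ 2 - dist2 x y)%R)).
  by apply: (measurableT_comp (measurable_fold mphi)); apply: measurable_fun_pair => //; exact: measurable_id.
apply: le_trans (le_abse_integral _ mdisk _) _.
  apply/measurable_EFinP; apply: (eq_measurable_fun (fun y => (phi (y, cap x r y) * (r / cap x r y))%R)).
    by move=> y /set_mem dy; rewrite area_density_cap.
  have mc : measurable_fun setT (cap x r) by exact: measurable_sqrt.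
  apply: measurable_funM.
    apply: (measurable_comp measurable_half_space _ mphi (f := phi) (g := fun y => (y, cap x r y))).
      by move=> _ [y yd <-]; rewrite /half_space/= sqrtr_gt0; move: yd; rewrite diskE.
    by apply: measurable_funTS; apply: measurable_fun_pair => //; exact: measurable_id.
  apply: measurable_funTS; apply: measurable_funM => //.
  rewrite (_ : (fun y => _) = (fun y => cap x r y `^ (-1))%R).
    exact: (measurableT_comp (measurable_powR _) mc).
  by apply/funext => y; rewrite powR_inv1// sqrtr_ge0.
rewrite /slant -ge0_integralZl//; last 2 first.
- by move=> y _; exact: fold_ge0.
- by rewrite lee_fin ltW.
rewrite integral_mkcond; apply: le_ge0_integral => y _.
  by rewrite /patch; case: ifP => // _; exact: abse_ge0.
rewrite /patch; case: ifPn => [/set_mem dy|_].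
  by rewrite -E//= lexx.
by rewrite mule_ge0 ?fold_ge0// lee_fin ltW.
Qed.

(** The factor r^s from the pointwise bound and the weight r^(1 - s) multiply to r, which is half
    the density of the substitution t = r^2. *)
Lemma hemispherical_inner_le phi x (s : R) : (0 < s)%R -> measurable_fun half_space phi ->
  \int[leb]_(r in `]0%R, +oo[) (`|hemispherical phi x r| `^ s * (r `^ (1 - s))%:E) <=
  (2^-1)%:E * \int[leb]_t (slant (fold phi) x t `^ s).
Proof.
move=> s0 mphi.
have mS : measurable_fun setT (fun t : RT => slant (fold phi) x t `^ s).
  apply: measurable_fun_poweR.
  exact: (measurable_fun_pair2 x (measurable_slant (measurable_fold mphi) (fold_ge0 phi))).
apply: (@le_trans _ _ (\int[leb]_(r in `]0%R, +oo[)
    (slant (fold phi) x (r ^+ 2)%R `^ s * r%:E))).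
  apply: le_ge0_integral => r; rewrite /= in_itv/= andbT => r0.
    by rewrite mule_ge0// ?poweR_ge0// lee_fin powR_ge0.
  have S0 : 0 <= slant (fold phi) x (r ^+ 2)%R by apply: slant_ge0 => z; exact: fold_ge0.
  have rE : 0 <= r%:E by rewrite lee_fin ltW.
  apply: (@le_trans _ _ ((r%:E * slant (fold phi) x (r ^+ 2)%R) `^ s * (r `^ (1 - s))%:E)).
    apply: lee_wpmul2r; first by rewrite lee_fin powR_ge0.
    apply: lee_poweR; [exact: ltW|exact: abse_ge0|].
    exact: hemispherical_le_slant.
  rewrite poweRM// muleAC poweR_EFin -EFinM -powRD.
    by rewrite addrC subrK powRr1 ?(ltW r0)// muleC.
  by rewrite (gt_eqF r0) implybT.
rewrite (integral_square mS) => [|t]; last exact: poweR_ge0.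
apply: lee_wpmul2l => //; rewrite integral_mkcond; apply: le_ge0_integral => t _.
  by rewrite /patch; case: ifP => // _; exact: poweR_ge0.
by rewrite /patch; case: ifP => // _; exact: poweR_ge0.
Qed.

(** The weight splits as y_n^(-p) y_n: the first factor is absorbed by [fold], the second is half
    the density of u = y_n^2. *)
Lemma fold_norm phi (p : R) : (0 < p)%R -> measurable_fun half_space phi ->
  \int[lebesgue_euclidS m]_(y in half_space) (`|phi y| `^ p * y.2 `^ (1 - p))%:E =
  (2^-1)%:E * \int[lebm]_y \int[leb]_u (fold phi (y, u) `^ p).
Proof.
move=> p0 mphi; rewrite integral_mkcond.
have mF : measurable_fun setT (fun z => fold phi z `^ p).
  by apply: measurable_fun_poweR; exact: measurable_fold.
rewrite fubini_tonelli1; first last.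
- move=> z; rewrite /patch; case: ifP => // _.
  by rewrite lee_fin mulr_ge0 ?powR_ge0.
- apply/(measurable_restrictT _ _).1; first exact: measurable_half_space.
  apply/measurable_EFinP; apply: measurable_funM.
    apply: (measurableT_comp (measurable_powR _)).
    exact: (measurableT_comp (@normr_measurable R setT)).
  apply: measurable_funTS; apply: (measurableT_comp (measurable_powR _)).
  exact: measurable_snd.
rewrite -ge0_integralZl//; first last.
- by move=> y _; apply: integral_ge0 => u _; exact: poweR_ge0.
- apply: (@measurable_fun_fubini_tonelli_F _ _ _ _ R leb _ mF).
  by move=> z; exact: poweR_ge0.
apply: eq_integral => y _.
have mFy := measurable_fun_pair2 y mF.
rewrite [RHS](_ : _ = (2^-1)%:E * \int[leb]_(u in `]0%R, +oo[) (fold phi (y, u) `^ p)); last first.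
  congr (_ * _); rewrite [RHS]integral_mkcond; apply: eq_integral => u _; rewrite /patch.
  case: ifPn => //; rewrite notin_setE/= in_itv/= andbT => /negP/negbTE u0.
  by rewrite /fold/= u0 poweR0r// gt_eqF.
rewrite -(integral_square mFy) => [|u]; last exact: poweR_ge0.
rewrite [RHS]integral_mkcond; apply: eq_integral => u _; rewrite /patch.
have [u0|u0] := boolP (0 < u)%R; last first.
  rewrite memNset; last by apply/negP.
  by rewrite memNset//= in_itv/= andbT; exact/negP.
rewrite mem_set// mem_set/=; last by rewrite in_itv/= u0.
have -> : fold phi (y, (u ^+ 2)%R) = (`|phi (y, u)| / u)%:E.
  by rewrite /fold/= exprn_gt0// sqrtr_sqr (gtr0_norm u0).
rewrite poweR_EFin -EFinM; congr EFin.
rewrite powRM ?invr_ge0 ?(ltW u0)// -mulrA; congr (_ * _)%R.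
by rewrite -powR_inv1 ?(ltW u0)// -powRrM mulN1r addrC powRD ?powRr1 ?(ltW u0)// (gt_eqF u0) implybT.
Qed.

End fold_sonar.

(** * Sufficiency of the exponent conditions *)

Section sufficiency.
Context {R : realType} {m : nat}.
Local Notation leb := (@lebesgue_measure R).
Local Notation RT := (measurableTypeR R).
Local Notation lebm := (@lebesgue_euclid R m).
Implicit Types (phi : euclidS R m -> R).

Lemma hemispherical_bound (ro sg : R) : (0 < ro)%R -> (0 < sg)%R ->
  (sg = 1 - m.+1%:R * ro)%R -> exists2 C : R, (0 < C)%R &
  forall phi, measurable_fun half_space phi ->
  (\int[lebm]_x (\int[leb]_(r in `]0%R, +oo[)
     (`|hemispherical phi x r| `^ sg^-1 * (r `^ (1 - sg^-1))%:E)) `^ (sg / ro)) `^ ro <=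
  C%:E * (\int[lebesgue_euclidS m]_(y in half_space)
     (`|phi y| `^ (1 - ro)^-1 * y.2 `^ (1 - (1 - ro)^-1))%:E) `^ (1 - ro).
Proof.
move=> ro0 sg0 sgE.
have mro : (m.+1%:R * ro = ro + m%:R * ro)%R by rewrite -natr1; ring.
have m0 : (0 <= m%:R * ro)%R by rewrite mulr_ge0// ltW.
have ro1 : (m.+1%:R * ro < 1)%R by lra.
have p0 : (0 < 1 - ro)%R by lra.
have [C C0 HC] := slant_mixed_norm ro0 ro1.
(* The power of 2 undoes the factor 1/2 of [fold_norm], which stands under the power 1 - ro. *)
exists (C * 2 `^ (1 - ro))%R; first by rewrite mulr_gt0// powR_gt0.
move=> phi mphi; have mF := measurable_fold mphi; have F0 := fold_ge0 phi.
apply: (@le_trans _ _ (mixed_norm lebm ro sg (fun z => slant (fold phi) z.1 z.2))).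
  apply: lee_poweR; first exact: ltW.
    by apply: integral_ge0 => x _; exact: poweR_ge0.
  apply: le_ge0_integral => x _; first exact: poweR_ge0.
  apply: lee_poweR; first by rewrite divr_ge0// ltW.
    by apply: integral_ge0 => r _; rewrite mule_ge0 ?poweR_ge0// lee_fin powR_ge0.
  apply: (le_trans (hemispherical_inner_le x _ mphi)); first by rewrite invr_gt0.
  rewrite -[leRHS]mul1e; apply: lee_wpmul2r.
    by apply: integral_ge0 => t _; exact: poweR_ge0.
  by rewrite lee_fin; lra.
have := HC _ mF F0; rewrite -sgE => /le_trans; apply.
rewrite fold_norm ?invr_gt0// mixed_norm_diagonal//.
rewrite fubini_tonelli1; first last.
- by move=> z; exact: poweR_ge0.
- exact: measurable_fun_poweR.
set I := \int[lebm]_x _.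
have I0 : 0 <= I by apply: integral_ge0 => y _; apply: integral_ge0 => u _; exact: poweR_ge0.
rewrite [in leRHS]poweRM// poweR_EFin EFinM -muleA; apply: lee_wpmul2l.
  by rewrite lee_fin ltW.
rewrite muleA -EFinM -powRM// mulfV// powR1 mul1e.
exact: lexx.
Qed.

(** For p = 1 the bound holds at every x: after Tonelli's theorem, integration over t absorbs the
    shift by [dist2 x y]. *)
Lemma hemispherical_bound1 phi x : measurable_fun half_space phi ->
  \int[leb]_(r in `]0%R, +oo[) `|hemispherical phi x r| <=
  \int[lebesgue_euclidS m]_(y in half_space) `|phi y|%:E.
Proof.
move=> mphi; have mF := measurable_fold mphi; have F0 := fold_ge0 phi.
have := hemispherical_inner_le x (@ltr01 R) mphi.
rewrite subrr [X in X <= _](_ : _ = \int[leb]_(r in `]0%R, +oo[) `|hemispherical phi x r|); last first.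
  by apply: eq_integral => r _; rewrite powRr0 mule1 poweRe1.
move=> /le_trans; apply; rewrite le_eqVlt; apply/orP; left; apply/eqP.
have := fold_norm (@ltr01 R) mphi; rewrite subrr.
rewrite [X in X = _](_ : _ = \int[lebesgue_euclidS m]_(y in half_space) `|phi y|%:E); last first.
  by apply: eq_integral => y _; rewrite powRr0 mulr1 powRr1.
move=> ->; congr (_ * _).
transitivity (\int[leb]_t slant (fold phi) x t).
  by apply: eq_integral => t _; rewrite poweRe1//; exact: slant_ge0.
have mK : measurable_fun setT (fun w : RT * euclid R m => fold phi (w.2, (w.1 - dist2 x w.2)%R)).
  apply: (measurableT_comp mF); apply: measurable_fun_pair; first exact: measurable_snd.
  apply: measurable_funB; first exact: measurable_fst.
  by apply: measurable_dist2; [exact: measurable_cst|exact: measurable_snd].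
rewrite /slant (@fubini_tonelli _ _ _ _ R leb lebm _ mK (fun w => F0 _)).
apply: eq_integral => y _; rewrite /=.
have mFy := measurable_fun_pair2 y mF.
rewrite (integral_shift (- dist2 x y)%R mFy) => [|u]; last exact: F0.
by apply: eq_integral => u _; rewrite poweRe1.
Qed.

End sufficiency.

(** * Test functions and necessity *)

Section Lnorm_lower_bound.
Context {R : realType}.

(* 1/q, with 1/oo = 0. *)
Definition exponent_inv (q : \bar R) : R := if q is r%:E then r^-1%R else 0%R.

Lemma Lnorm_ge_on d (X : measurableType d) (mu : {measure set X -> \bar R})
    (E : set X) (f : X -> \bar R) (q : \bar R) (K M : R) :
  measurable E -> mu E = M%:E -> (0 < M)%R -> (0 < K)%R -> 0 < q ->
  (forall x, E x -> K%:E <= f x) -> (K * M `^ exponent_inv q)%:E <= Lnorm mu q f.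
Proof.
move=> mE EM M0 K0 q0 Kf; rewrite unlock; case: q q0 => [q||//]; last first.
  (* For q = +oo the power of M is 1, and M > 0 serves to show that E is not contained in a null
     set. *)
  move=> _; have muT : 0 < mu setT.
    apply: (@lt_le_trans _ _ (mu E)); first by rewrite EM lte_fin.
    by apply: le_measure; rewrite ?inE.
  rewrite /= muT powRr0 mulr1 leNgt; apply/negP => h.
  have /ess_supP : ess_sup mu (abse \o f) <= ess_sup mu (abse \o f) by [].
  move=> [N [mN N0 sN]].
  have : mu E <= 0.
    rewrite -N0; apply: le_measure; rewrite ?inE//.
    move=> x Ex; apply: sN => /= fx.
    have := le_lt_trans fx h; rewrite ltNge => /negP; apply.
    by apply: le_trans (Kf x Ex) _; exact: lee_abs.
  by rewrite EM lee_fin leNgt M0.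
rewrite lte_fin => q0 /=.
have KE : (K * M `^ q^-1)%:E = ((K `^ q * M)%:E) `^ q^-1.
  rewrite poweR_EFin powRM ?powR_ge0// ?(ltW M0)// -powRrM mulfV ?gt_eqF// powRr1//.
  exact: ltW.
rewrite KE; apply: lee_poweR.
- by rewrite invr_ge0 ltW.
- by rewrite lee_fin mulr_ge0 ?powR_ge0// ltW.
rewrite EFinM -EM -integral_cst//.
rewrite integral_mkcond; apply: le_ge0_integral => x _.
  by rewrite /patch; case: ifP => // _; rewrite lee_fin powR_ge0.
rewrite /patch; case: ifPn => [/set_mem Ex|_]; last exact: poweR_ge0.
rewrite -[leLHS]/((K%:E) `^ q); apply: lee_poweR; first exact: ltW.
  by rewrite lee_fin ltW.
by apply: le_trans (Kf x Ex) _; exact: lee_abs.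
Qed.

Lemma affine_bounded_eq0 (a b K : R) :
  (forall l v : R, (a * l + b * v <= K)%R) -> (a = 0 /\ b = 0)%R.
Proof.
move=> H; split; apply/eqP/negPn/negP => n0.
- have := H ((K + 1) / a)%R 0%R; rewrite mulr0 addr0 mulrC divfK//; lra.
- have := H 0%R ((K + 1) / b)%R; rewrite mulr0 add0r mulrC divfK//; lra.
Qed.

End Lnorm_lower_bound.

Section box_test.
Context {R : realType} {m : nat}.
Local Notation leb := (@lebesgue_measure R).
Local Notation RT := (measurableTypeR R).
Local Notation lebm := (@lebesgue_euclid R m).
Local Open Scope ring_scope.

Definition cube (c : R) : set (euclid R m) := [set y | forall i, 0 <= tnth y i <= c].

Lemma measurable_cube c : measurable (cube c).
Proof.
rewrite (_ : cube c = \bigcap_(i in [set: 'I_m])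
    ((fun y : euclid R m => tnth y i) @^-1` `[0, c]%classic)); last first.
  by apply/seteqP; split => y /= yc i; [move=> _|]; have := yc i; rewrite /= in_itv/=; [|exact].
apply: fin_bigcap_measurable => // i _; rewrite -[X in measurable X]setTI.
by apply: measurable_tnth => //; exact: measurable_itv.
Qed.

Lemma lebesgue_cube c : 0 <= c -> lebm (cube c) = (c ^+ m)%:E.
Proof.
move=> c0; rewrite (_ : cube c = [set x | forall i, (fun=> `[0, c]%classic) i (tnth x i)]); last first.
  by apply/seteqP; split => y /= yc i; have := yc i; rewrite /= in_itv.
rewrite [LHS](@lebesgue_euclid_box R m (fun=> `[0, c]%classic) (fun=> measurable_itv _)).
rewrite (eq_bigr (fun _ => c%:E)) => [|i _].
  by rewrite prodEFin big_const_ord iter_mulr_1.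
rewrite lebesgue_measure_itv/= lte_fin; case: ltP => [_|]; first by rewrite -EFinB subr0.
by move=> c0'; congr EFin; apply/eqP; rewrite eq_le c0 c0'.
Qed.

Lemma integral_cube k c : 0 <= k -> 0 <= c ->
  (\int[lebm]_y (k%:E * (\1_(cube c) y)%:E) = (k * c ^+ m)%:E)%E.
Proof.
move=> k0 c0; rewrite ge0_integralZl//.
  rewrite integral_indic//; last exact: measurable_cube.
  by rewrite setIT EFinM; congr (_ * _)%E; exact: lebesgue_cube.
by apply/measurable_EFinP; apply: measurable_indic; exact: measurable_cube.
Qed.

Definition origin : euclid R m := [tuple 0 | _ < m].

(* For x in a cube of side v / (4 m l) and |x|^2 + A < r^2 < |x|^2 + A + v/2,
   the whole cube of side l lies under the part of the hemisphere of radius r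
   about x that is in the shell. *)
Definition shell (l A v : R) : set (euclidS R m) :=
  [set z | cube l z.1 /\ A < z.2 ^+ 2 + dist2 origin z.1 < A + v].

Definition shell_test (l A v : R) (z : euclidS R m) : R := z.2 * \1_(shell l A v) z.

Lemma measurable_shell_test l A v : measurable_fun setT (shell_test l A v).
Proof.
apply: measurable_funM; first exact: measurable_snd.
apply: measurable_indic.
rewrite (_ : shell l A v = (cube l `*` setT) `&`
   ((fun z : euclidS R m => z.2 ^+ 2 + dist2 origin z.1) @^-1` `]A, (A + v)[%classic)); last first.
  by apply/seteqP; split => z /=; rewrite in_itv/=; [case|case=> -[]].
apply: measurableI; first by apply: measurableX => //; exact: measurable_cube.
have mf : measurable_fun setT (fun z : euclidS R m => z.2 ^+ 2 + dist2 origin z.1).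
  apply: measurable_funD; first by apply: measurable_funX; exact: measurable_snd.
  by apply: measurable_dist2; [exact: measurable_cst|exact: measurable_fst].
by rewrite -[X in measurable X]setTI; apply: mf => //; exact: measurable_itv.
Qed.

Let dist2_origin (y : euclid R m) : dist2 origin y = \sum_(i < m) tnth y i ^+ 2.
Proof. by apply: eq_bigr => i _; rewrite tnth_mktuple subr0. Qed.

Lemma cube_dist2 l y : cube l y -> dist2 origin y <= m%:R * l ^+ 2.
Proof.
move=> yl; rewrite dist2_origin.
apply: (@le_trans _ _ (\sum_(i < m) l ^+ 2)); last by rewrite sumr_const card_ord mulr_natl.
apply: ler_sum => i _; have /andP[? ?] := yl i.
by apply: lerXn2r => //; rewrite nnegrE//; lra.
Qed.

Lemma dist2_inner x y : dist2 x y = dist2 origin x + dist2 origin y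
  - 2 * \sum_(i < m) tnth x i * tnth y i.
Proof.
rewrite !dist2_origin /dist2 mulr_sumr -sumrN -!big_split/=.
by apply: eq_bigr => i _; ring.
Qed.

Lemma inner_cube a l x y : 0 <= a -> cube a x -> cube l y ->
  0 <= \sum_(i < m) tnth x i * tnth y i <= m%:R * (a * l).
Proof.
move=> a0 xa yl; apply/andP; split.
  by apply: sumr_ge0 => i _; have /andP[? _] := xa i; have /andP[? _] := yl i; exact: mulr_ge0.
apply: (@le_trans _ _ (\sum_(i < m) (a * l))); last by rewrite sumr_const card_ord mulr_natl.
apply: ler_sum => i _; have /andP[? ?] := xa i; have /andP[? ?] := yl i.
by apply: ler_pM.
Qed.

(** As the test function is y_n on the shell, its [fold] is the indicator of a set whose section
    over each y in the cube is contained in an interval of length v. *)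
Lemma half_space_norm_shell_test (p l A v : R) : 0 < p -> 0 < l -> 0 < v ->
  (half_space_norm p (shell_test l A v) <= ((v * l ^+ m) `^ p^-1)%:E)%E.
Proof.
move=> p0 l0 v0; rewrite /half_space_norm.
have mphi : measurable_fun half_space (shell_test l A v).
  by apply: measurable_funTS; exact: measurable_shell_test.
rewrite -poweR_EFin; apply: lee_poweR.
- by rewrite invr_ge0 ltW.
- by apply: integral_ge0 => z _; rewrite lee_fin mulr_ge0 ?powR_ge0.
rewrite fold_norm//; set I := (\int[lebm]_y _)%E.
have I0 : (0 <= I)%E by apply: integral_ge0 => y _; apply: integral_ge0 => u _; exact: poweR_ge0.
apply: (@le_trans _ _ I).
  by rewrite -[leRHS]mul1e; apply: lee_wpmul2r => //; rewrite lee_fin; lra.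
apply: (@le_trans _ _ (\int[lebm]_y (v%:E * (\1_(cube l) y)%:E))%E); last first.
  by rewrite integral_cube// ltW.
apply: le_ge0_integral => y _; first by apply: integral_ge0 => u _; exact: poweR_ge0.
rewrite indicE; have [yl|yl] := boolP (y \in cube l); last first.
  rewrite mule0 integral0_eq// => u _.
  have -> : fold (shell_test l A v) (y, u) = 0%E.
    rewrite /fold; case: ifP => // _; rewrite /shell_test/= indicE memNset ?mulr0 ?normr0 ?mul0r//.
    by move=> [yl' _]; move/negP : yl; apply; exact: mem_set.
  by rewrite poweR0r// gt_eqF.
pose J : set RT := `](A - dist2 origin y), (A + v - dist2 origin y)[%classic.
have mJ : measurable J by exact: measurable_itv.
apply: (@le_trans _ _ (\int[leb]_u (\1_J u)%:E)%E).
  apply: le_ge0_integral => u _; first exact: poweR_ge0.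
  rewrite /fold /shell_test/=; case: ifPn => [u0|_]; last by rewrite poweR0r ?gt_eqF// lee_fin indicE.
  rewrite normrM (gtr0_norm (_ : 0 < Num.sqrt u)) ?sqrtr_gt0// mulrAC mulfV ?gt_eqF ?sqrtr_gt0// mul1r.
  rewrite !indicE; have [uS|_] := boolP (_ \in shell _ _ _); last first.
    by rewrite normr0 poweR0r ?gt_eqF// lee_fin.
  move/set_mem : uS => [_ /=]; rewrite sqr_sqrtr ?(ltW u0)// => /andP[h1 h2].
  rewrite mem_set ?normr1 ?poweR_EFin ?powR1// /J/= in_itv/=; apply/andP; split; lra.
rewrite integral_indic// setIT [leLHS]lebesgue_measure_itv/= lte_fin.
by case: ifP => _; rewrite mule1 ?lee_fin -?EFinB ?lee_fin; lra.
Qed.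

(** On the hemisphere y_n^2 + |y|^2 = r^2 - |x|^2 + 2 x.y. The first difference lies between A and A
    + v/2, and 0 <= 2 x.y <= 2 m a l <= v/2, so over the cube the hemisphere stays in the shell; m
    l^2 <= A puts the cube inside the disk. There the integrand is y_n times r / y_n, that is r. *)
Lemma hemispherical_shell_test_ge (l A v a : R) x r : 0 < l -> 0 < v -> m%:R * l ^+ 2 <= A ->
  0 <= a -> 4 * (m%:R * (a * l)) <= v -> cube a x ->
  0 < r -> A + dist2 origin x < r ^+ 2 < A + dist2 origin x + v / 2 ->
  ((r * l ^+ m)%:E <= `|hemispherical (shell_test l A v) x r|)%E.
Proof.
move=> l0 v0 lA a0 av xa r0 /andP[r1 r2].
apply: le_trans (lee_abs _); rewrite /hemispherical /graph_integral.
have -> : ((r * l ^+ m)%:E = \int[lebm]_y (r%:E * (\1_(cube l) y)%:E))%E.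
  by rewrite integral_cube// ltW.
rewrite [leRHS]integral_mkcond; apply: le_ge0_integral => y _.
  by rewrite mule_ge0// lee_fin ?indicE// ltW.
have I := inner_cube a0 xa; have D := dist2_inner x.
rewrite indicE; have [/set_mem yl|_] := boolP (y \in cube l); last first.
  rewrite mule0 /patch; case: ifPn => // /set_mem yd.
  rewrite area_density_cap// lee_fin mulr_ge0//; last by rewrite divr_ge0 ?sqrtr_ge0 ?ltW.
  by rewrite mulr_ge0 ?sqrtr_ge0// indicE.
have /andP[I1 I2] := I _ _ yl; have Dy := D y; have yA := cube_dist2 yl.
have yd : disk x r y by apply/(mem_disk x y r0); lra.
rewrite /patch mem_set// area_density_cap// /shell_test/=.
have c0 : 0 < cap x r y by rewrite sqrtr_gt0 subr_gt0; apply/(mem_disk x y r0).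
rewrite indicE mem_set.
  by rewrite mulr1 mule1 lee_fin mulrCA mulfV ?mulr1// gt_eqF.
split => //=; rewrite sqr_sqrtr; last by rewrite subr_ge0 ltW//; apply/(mem_disk x y r0).
by apply/andP; split; lra.
Qed.

(** As before the powers of r combine to r. The admissible t = r^2 fill an interval of length v/2,
    and the substitution contributes another 1/2, whence v/4. *)
Lemma inner_shell_test_ge (l A v a s : R) x : 0 < s -> 0 < l -> 0 < v -> m%:R * l ^+ 2 <= A ->
  0 <= a -> 4 * (m%:R * (a * l)) <= v -> cube a x ->
  ((l ^+ m * (v / 4) `^ s^-1)%:E <= (\int[leb]_(r in `]0%R, +oo[)
    (`|hemispherical (shell_test l A v) x r| `^ s * (r `^ (1 - s))%:E)) `^ s^-1)%E.
Proof.
move=> s0 l0 v0 lA a0 av xa.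
have lm0 : 0 <= l ^+ m by rewrite exprn_ge0// ltW.
have v4 : 0 <= v / 4 by lra.
pose b := A + dist2 origin x.
have b0 : 0 <= b.
  by rewrite addr_ge0 ?dist2_ge0//; apply: le_trans lA; rewrite mulr_ge0// sqr_ge0.
pose J : set RT := `]b, (b + v / 2)[%classic.
have mJ : measurable J by exact: measurable_itv.
have mf : measurable_fun setT (fun t : RT => ((l ^+ m) `^ s * \1_J t)%:E).
  by apply/measurable_EFinP; apply: measurable_funM => //; exact: measurable_indic.
have -> : l ^+ m * (v / 4) `^ s^-1 = ((l ^+ m) `^ s * (v / 4)) `^ s^-1.
  by rewrite (powRM _ (powR_ge0 _ _) v4) -powRrM mulfV ?gt_eqF// powRr1.
rewrite -poweR_EFin; apply: lee_poweR.
- by rewrite invr_ge0 ltW.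
- by rewrite lee_fin mulr_ge0 ?powR_ge0.
apply: (@le_trans _ _ (\int[leb]_(r in `]0%R, +oo[) (((l ^+ m) `^ s * \1_J (r ^+ 2))%:E * r%:E))%E).
  rewrite (@integral_square _ _ mf) => [|t]; last by rewrite lee_fin mulr_ge0 ?powR_ge0// indicE.
  rewrite (_ : (\int[leb]_(t in _) _ = \int[leb]_t ((l ^+ m) `^ s * \1_J t)%:E)%E); last first.
    rewrite integral_mkcond; apply: eq_integral => t _; rewrite /patch; case: ifPn => //.
    rewrite notin_setE/= in_itv/= andbT => t0.
    have Jt : ~ J t by rewrite /J/= in_itv/= => /andP[? _]; apply: t0; lra.
    by rewrite indicE memNset// mulr0.
  under eq_integral do rewrite EFinM.
  rewrite ge0_integralZl//; first last.
  - by rewrite lee_fin powR_ge0.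
  - by apply/measurable_EFinP; exact: measurable_indic.
  rewrite integral_indic// setIT [X in (_ * (_ * X))%E]lebesgue_measure_itv/= lte_fin.
  rewrite ifT; last by lra.
  rewrite -EFinB -!EFinM lee_fin.
  by rewrite le_eqVlt; apply/orP; left; apply/eqP; field.
apply: le_ge0_integral => r; rewrite /= in_itv/= andbT => r0.
  by rewrite -EFinM lee_fin !mulr_ge0 ?powR_ge0 ?indicE// ltW.
rewrite indicE; have [/set_mem|_] := boolP (_ \in J); last first.
  by rewrite mulr0 mul0e mule_ge0 ?poweR_ge0// lee_fin powR_ge0.
rewrite /J/= in_itv/= => rJ.
have := hemispherical_shell_test_ge l0 v0 lA a0 av xa r0 rJ.
have rl : (0 <= (r * l ^+ m)%:E)%E by rewrite lee_fin mulr_ge0// ltW.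
move=> /(lee_poweR (ltW s0) rl) H.
have r1 : (0 <= (r `^ (1 - s))%:E)%E by rewrite lee_fin powR_ge0.
apply: le_trans (lee_wpmul2r r1 H); rewrite poweR_EFin -!EFinM lee_fin mulr1.
rewrite powRM ?(ltW r0)// mulrAC -powRD ?(gt_eqF r0) ?implybT//.
by rewrite addrC subrK powRr1 ?(ltW r0)// mulrC.
Qed.

End box_test.

Section necessity.
Context {R : realType} {m : nat}.

Lemma hemispherical_norm_shell_test_ge (q : \bar R) (s l A v a : R) :
  0 < q -> (0 < s)%R -> (0 < l)%R -> (0 < v)%R -> (m%:R * l ^+ 2 <= A)%R ->
  (0 < a)%R -> (4 * (m%:R * (a * l)) <= v)%R ->
  (l ^+ m * (v / 4) `^ s^-1 * (a ^+ m) `^ exponent_inv q)%:E <=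
  @hemispherical_norm R m q s (shell_test l A v).
Proof.
move=> q0 s0 l0 v0 lA a0 av; rewrite /hemispherical_norm.
apply: (Lnorm_ge_on (measurable_cube a) (lebesgue_cube (ltW a0))) => //.
- exact: exprn_gt0.
- by rewrite mulr_gt0 ?exprn_gt0// powR_gt0// divr_gt0.
by move=> x xa; apply: (inner_shell_test_ge s0 l0 v0 lA (ltW a0) av xa).
Qed.

(** In the variables L = ln l and V = ln v the inequality for the shell functions says that an
    affine function is bounded above on the whole plane, so both its coefficients vanish. *)
Lemma hemispherical_norm_exponents (p : R) (q : \bar R) (s C : R) : (0 < m)%N ->
  (0 < p)%R -> 0 < q -> (0 < s)%R -> (0 < C)%R ->
  (forall phi : euclidS R m -> R, measurable_fun (@half_space R m) phi ->
     hemispherical_norm q s phi <= C%:E * half_space_norm p phi) ->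
  (p^-1 + exponent_inv q = 1 /\ s^-1 = 1 - m.+1%:R * exponent_inv q)%R.
Proof.
move=> m0 p0 q0 s0 C0 H; set iq := exponent_inv q.
have mR : (0 < m%:R :> R)%R by rewrite ltr0n.
pose k : R := ((4 * m%:R)^-1)%R.
have k0 : (0 < k)%R by rewrite invr_gt0 mulr_gt0.
pose ln4 : R := ln 4.
suff [h1 h2] : (m%:R * (1 - iq - p^-1) = 0 /\ s^-1 + m%:R * iq - p^-1 = 0)%R.
  have h3 : (1 - iq - p^-1 = 0)%R.
    by apply/eqP; move/eqP : h1; rewrite mulf_eq0 gt_eqF.
  split; first by lra.
  by rewrite -natr1 mulrDl mul1r; lra.
apply: (@affine_bounded_eq0 _ _ _ (ln C + s^-1 * ln4 - m%:R * iq * ln k)%R) => L V.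
(* [a] is the largest side allowed by 4 m a l <= v. The choice A = m l^2 below is the least
   admissible one; A does not enter the bounds. *)
pose l := expR L; pose v := expR V; pose a := (k * v / l)%R.
have l0 : (0 < l)%R by exact: expR_gt0.
have v0 : (0 < v)%R by exact: expR_gt0.
have a0 : (0 < a)%R by rewrite divr_gt0// mulr_gt0.
have av : (4 * (m%:R * (a * l)) <= v)%R.
  rewrite /a divfK ?gt_eqF// /k le_eqVlt; apply/orP; left; apply/eqP; field.
  by rewrite gt_eqF.
have mt : measurable_fun (@half_space R m) (shell_test l (m%:R * l ^+ 2) v).
  by apply: measurable_funTS; exact: measurable_shell_test.
have := le_trans (hemispherical_norm_shell_test_ge q0 s0 l0 v0 (lexx _) a0 av) (H _ mt).
have CE : 0 <= C%:E by rewrite lee_fin ltW.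
have := half_space_norm_shell_test (m%:R * l ^+ 2) p0 l0 v0 (m := m).
move=> /(lee_wpmul2l CE) + h => /(le_trans h); rewrite -EFinM lee_fin -/iq.
have lm0 : (0 < l ^+ m)%R by exact: exprn_gt0.
have am0 : (0 < a ^+ m)%R by exact: exprn_gt0.
have v4 : (0 < v / 4)%R by rewrite divr_gt0.
have vl : (0 < v * l ^+ m)%R by exact: mulr_gt0.
rewrite -ler_ln ?posrE; [|by rewrite !mulr_gt0 ?powR_gt0|by rewrite mulr_gt0 ?powR_gt0].
rewrite !lnM ?posrE ?mulr_gt0 ?powR_gt0 ?invr_gt0//.
have lnl : ln (l ^+ m) = (m%:R * L)%R by rewrite lnXn// /l expRK mulr_natl.
have lna : ln (a ^+ m) = (m%:R * (ln k + V - L))%R.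
  have kv0 : (k * v \is Num.pos)%R by rewrite posrE mulr_gt0.
  have li0 : (l^-1 \is Num.pos)%R by rewrite posrE invr_gt0.
  have lna1 : ln a = (ln k + V - L)%R.
    by rewrite /a (lnM kv0 li0) lnM ?posrE// lnV ?posrE// /l /v !expRK.
  by rewrite lnXn// lna1 mulr_natl.
have lnv : ln (v / 4) = (V - ln4)%R.
  by rewrite lnM ?posrE ?invr_gt0// lnV ?posrE// /v expRK.
have lnvl : ln (v * l ^+ m) = (V + m%:R * L)%R by rewrite lnM ?posrE// lnl /v expRK.
rewrite !ln_powR lnl lna lnv lnvl => h'; rewrite -subr_ge0.
move: h'; rewrite -subr_ge0 => h'.
by apply: le_trans h' _; rewrite le_eqVlt; apply/orP; left; apply/eqP; ring.
Qed.

End necessity.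

(** * The estimates in terms of p, q and s *)

Section exponents.
Context {R : realType} {m : nat}.
Implicit Types (phi : euclidS R m -> R).

Lemma hoelder_conjugate_gt1 (p : R) : (1 < p)%R ->
  hoelder_conjugate p%:E = ((1 - p^-1)^-1)%:E.
Proof.
move=> p1; have p0 : (0 < p)%R by lra.
have pn0 : p%:E != 0 by rewrite eqe gt_eqF.
apply/esym/(hoelder_conjugateP _ (ltNyr p) pn0).
have ro0 : (0 < 1 - p^-1)%R by rewrite subr_gt0 invf_lt1.
have i0 : (0 < (1 - p^-1)^-1)%R by rewrite invr_gt0.
rewrite !inver (gt_eqF p0) (gt_eqF i0) invrK -EFinD; congr EFin; ring.
Qed.

Lemma hemispherical_norm_le (p s : R) : (1 < p)%R -> (0 < s)%R ->
  (s^-1 = 1 - m.+1%:R * (1 - p^-1))%R -> exists2 C : R, (0 < C)%R &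
  forall phi, measurable_fun (@half_space R m) phi ->
  hemispherical_norm (hoelder_conjugate p%:E) s phi <= C%:E * half_space_norm p phi.
Proof.
move=> p1 s0 sE; have p0 : (0 < p)%R by lra.
set ro := (1 - p^-1)%R; have ro0 : (0 < ro)%R by rewrite subr_gt0 invf_lt1.
have si : (0 < s^-1)%R by rewrite invr_gt0.
have [C C0 HC] := hemispherical_bound (m := m) ro0 si sE.
exists C => // phi mphi; have := HC phi mphi.
rewrite (_ : (1 - ro)%R = p^-1%R); last by rewrite /ro; ring.
rewrite !invrK; apply: le_trans; rewrite /hemispherical_norm hoelder_conjugate_gt1// unlock invrK.
rewrite le_eqVlt; apply/orP; left; apply/eqP; congr (_ `^ _).
apply: eq_integral => x _; rewrite gee0_abs ?poweR_ge0//.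
by rewrite -poweRrM.
Qed.

Lemma hemispherical_norm_le1 phi : measurable_fun (@half_space R m) phi ->
  hemispherical_norm +oo 1 phi <= half_space_norm 1 phi.
Proof.
move=> mphi; have -> : half_space_norm 1 phi =
    \int[lebesgue_euclidS m]_(y in half_space) `|phi y|%:E.
  rewrite /half_space_norm invr1 poweRe1; last first.
    by apply: integral_ge0 => y _; rewrite lee_fin mulr_ge0 ?powR_ge0.
  by apply: eq_integral => y _; rewrite subrr powRr0 mulr1 powRr1.
have I0 : 0 <= \int[lebesgue_euclidS m]_(y in half_space) `|phi y|%:E.
  by apply: integral_ge0 => y _; rewrite lee_fin.
rewrite /hemispherical_norm unlock; case: ifP => // _; apply/ess_supP; apply: aeW => x /=.
rewrite gee0_abs ?poweR_ge0// invr1 poweRe1; last first.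
  by apply: integral_ge0 => r _; rewrite mule_ge0 ?poweR_ge0// lee_fin powR_ge0.
apply: le_trans (hemispherical_bound1 x mphi); rewrite le_eqVlt; apply/orP; left; apply/eqP.
by apply: eq_integral => r _; rewrite subrr powRr0 mule1 poweRe1.
Qed.

Lemma hemispherical_norm_bounded_iff (p : R) (q : \bar R) (s : R) : (0 < m)%N ->
  (0 < p)%R -> 0 < q -> (0 < s)%R ->
  (exists2 C : R, (0 < C)%R & forall phi, measurable_fun (@half_space R m) phi ->
     hemispherical_norm q s phi <= C%:E * half_space_norm p phi) <->
  [/\ (1 <= p < m.+1%:R / (m.+1%:R - 1))%R, q = hoelder_conjugate p%:E
    & (s^-1)%:E = 1 - m.+1%:R%:E / hoelder_conjugate p%:E].
Proof.
move=> m0 p0 q0 s0.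
have mE : (m.+1%:R - 1 = m%:R :> R)%R by rewrite -natr1; ring.
have mR : (0 < m%:R :> R)%R by rewrite ltr0n.
split=> [[C C0 H]|[/andP[p1 pm] -> sE]].
  have [pq sq] := hemispherical_norm_exponents m0 p0 q0 s0 C0 H.
  have iq0 : (0 <= exponent_inv q)%R.
    by case: (q) q0 => //= r; rewrite lte_fin invr_ge0; exact: ltW.
  have qE : q^-1 = (exponent_inv q)%:E.
    by case: (q) q0 => //= r; rewrite lte_fin inver => r0; rewrite gt_eqF.
  have qp : q = hoelder_conjugate p%:E.
    have pn0 : p%:E != 0 by rewrite eqe gt_eqF.
    apply/(hoelder_conjugateP _ (ltNyr p) pn0).
    by rewrite qE inver gt_eqF// -EFinD pq.
  split=> //; last by rewrite -qp qE -EFinM -EFinB sq.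
  have pi : (p^-1 = 1 - exponent_inv q)%R by rewrite -pq; ring.
  have si : (0 < s^-1)%R by rewrite invr_gt0.
  (* The bound 1 <= p is 1/q >= 0, and p < n/(n-1) is 1/s > 0, that is n (1 - 1/p) < 1. *)
  apply/andP; split.
    by rewrite -invf_le1//; lra.
  rewrite mE ltr_pdivlMr// -ltr_pdivlMl// mulrC pi.
  by move: sq si; rewrite -natr1; lra.
(* For p = 1 the conjugate exponent is +oo, its inverse is 0, and the relation gives s = 1. *)
move: p1; rewrite le_eqVlt => /predU1P[p1|p1].
  exists 1%R => // phi mphi; rewrite mul1e; move: sE.
  rewrite -p1 hoelder_conjugate1 invey mule0 sube0 => sE'.
  have -> : s = 1%R by rewrite -(invrK s) (EFin_inj sE') invr1.
  exact: hemispherical_norm_le1.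
apply: hemispherical_norm_le => //; move: sE.
have ro0 : (0 < 1 - p^-1)%R by rewrite subr_gt0 invf_lt1.
rewrite hoelder_conjugate_gt1// inver gt_eqF ?invr_gt0// invrK -EFinM -EFinB.
by move=> sE'; exact: EFin_inj sE'.
Qed.

(** With n = m + 1, the number 1 / (n + 1) is the fixed point of ro -> 1 - n ro. There q = s, the
    power between the two integrals is 1, and the mixed norm becomes a plain one. *)
Lemma hemispherical_bound_diagonal : exists2 C : R, (0 < C)%R &
  forall phi, measurable_fun (@half_space R m) phi ->
  (\int[lebesgue_euclid m]_x \int[lebesgue_measure]_(r in `]0%R, +oo[)
     (`|hemispherical phi x r| `^ (m.+2%:R) * (r ^- m.+1)%:E)) `^ (m.+2%:R^-1) <=
  C%:E * (\int[lebesgue_euclidS m]_(y in half_space)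
    (`|phi y| `^ (m.+2%:R / m.+1%:R) / y.2 `^ (m.+1%:R^-1))%:E) `^ (m.+1%:R / m.+2%:R).
Proof.
have m1 : (0 < m.+1%:R :> R)%R by rewrite ltr0n.
have m2 : (0 < m.+2%:R :> R)%R by rewrite ltr0n.
have m2E : (m.+2%:R = m.+1%:R + 1 :> R)%R by rewrite natr1.
have ro0 : (0 < m.+2%:R^-1 :> R)%R by rewrite invr_gt0.
have sE : (m.+2%:R^-1 = 1 - m.+1%:R * m.+2%:R^-1 :> R)%R.
  rewrite m2E; move: (m.+1%:R : R) m1 => N N0; field.
  by rewrite gt_eqF// addr_gt0.
have [C C0 HC] := hemispherical_bound (m := m) ro0 ro0 sE.
exists C => // phi mphi; have := HC phi mphi.
have pE : (1 - m.+2%:R^-1 = m.+1%:R / m.+2%:R :> R)%R.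
  rewrite m2E; move: (m.+1%:R : R) m1 => N N0; field.
  by rewrite gt_eqF// addr_gt0.
rewrite pE (divff (lt0r_neq0 ro0)) !invrK invf_div => {}HC.
rewrite [leLHS](_ : _ = (\int[lebesgue_euclid m]_x (\int[lebesgue_measure]_(r in `]0%R, +oo[)
  (`|hemispherical phi x r| `^ m.+2%:R * (r `^ (1 - m.+2%:R))%:E)) `^ 1) `^ m.+2%:R^-1); last first.
  congr (_ `^ _); apply: eq_integral => x _; rewrite poweRe1; last first.
    by apply: integral_ge0 => r _; rewrite mule_ge0 ?poweR_ge0// lee_fin powR_ge0.
  apply: eq_integral => r; rewrite inE/= in_itv/= andbT => r0.
  congr (_ * _%:E); rewrite (_ : (1 - m.+2%:R = - m.+1%:R :> R)%R); last by rewrite m2E; ring.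
  by rewrite powRN powR_mulrn// ltW.
apply: le_trans HC _; rewrite le_eqVlt; apply/orP; left; apply/eqP; congr (_ * _ `^ _).
apply: eq_integral => y _; congr (_ * _)%:E.
by rewrite -powRN; congr (_ `^ _)%R; rewrite m2E; move: (m.+1%:R : R) m1 => N N0; field; rewrite gt_eqF.
Qed.

End exponents.

Local Close Scope ereal_scope.

Theorem theorem1p1 (R : realType) (n : nat) (hn : (2 <= n)%N) :
  (forall (p : R) (q : \bar R) (s : R),
      0 < p -> (0 < q)%E -> 0 < s ->
      ((exists2 C : R, 0 < C &
          forall phi : euclidS R n.-1 -> R,
            measurable_fun (@half_space R n.-1) phi ->
            (hemispherical_norm q s phi <= C%:E * half_space_norm p phi)%E)
       <->
       [/\ 1 <= p < n%:R / (n%:R - 1),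
           q = hoelder_conjugate p%:E
         & ((s^-1)%:E = 1 - n%:R%:E / hoelder_conjugate p%:E)%E]))
  /\
  (exists2 C : R, 0 < C &
     forall phi : euclidS R n.-1 -> R,
       measurable_fun (@half_space R n.-1) phi ->
       ((\int[lebesgue_euclid n.-1]_x
           \int[lebesgue_measure]_(r in `]0%R, +oo[)
             (`|hemispherical phi x r| `^ (n.+1%:R) * (r ^- n)%:E))
          `^ (n.+1%:R^-1)
        <= C%:E *
           (\int[lebesgue_euclidS n.-1]_(y in @half_space R n.-1)
              (`|phi y| `^ (n.+1%:R / n%:R) / y.2 `^ (n%:R^-1))%:E)
             `^ (n%:R / n.+1%:R))%E).
Proof.
case: n hn => [//|m]; rewrite ltnS => m0 /=.
split; last exact: hemispherical_bound_diagonal.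
by move=> p q s p0 q0 s0; exact: hemispherical_norm_bounded_iff.
Qed.
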